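(* Neretin's group $\mathcal{N}_2$ has a polynomially bounded Dehn function; more precisely, $\delta_{\mathcal{N}_2}(n) \preccurlyeq n^{11}$.
   Context: Neretin's group $\mathcal{N}_d$ is the group of almost automorphisms of the non-rooted regular tree $T$ of degree $d+1$, i.e. the homeomorphisms of $\partial_\infty T$ induced by piecewise tree automorphisms (isomorphisms $T\setminus F\to T\setminus F'$ of complements of finite complete subtrees), with the group topology for which $\mathrm{Aut}(T)$ (with its usual locally compact topology) is an open subgroup. Thus $\mathcal{N}_2$ is the group for the regular trivalent tree. Equivalently, $\mathcal{N}_2\simeq \mathrm{AAut}(\mathcal{T}_{2,2})$, where $\mathcal{T}_{2,2}$ is the rooted binary tree and $\mathrm{AAut}(\mathcal{T}_{2,2})$ is the group of homeomorphisms of $\partial_\infty\mathcal{T}_{2,2}$ induced by forest isomorphisms $\mathcal{T}_{2,2}\setminus T\to\mathcal{T}_{2,2}\setminus T'$, with $T,T'$ finite subtrees containing the root, in which every vertex that is not a leaf has both of its children, the root not being a leaf, and with the same number of leaves (each component, a subtree hanging at a leaf of $T$, is mapped by a tree isomorphism onto a component of the target); the topology is the group topology for which $\mathrm{Aut}(\mathcal{T}_{2,2})$ with its profinite topology is an open subgroup. $\mathcal{N}_2$ is a compactly presented locally compact group: it has a compact generating subset $S$ and a presentation, as an abstract group, with generating set $S$ and relators of bounded length. For a compactly presented group $G$ with compact generating set $S$, for some $m$ one has $G=\langle S\mid R_m\rangle$ with $R_m$ the set of relations of length at most $m$; the area $a(w)$ of a word $w$ in $S$ representing $1$ is the least number of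 conjugates of relators of $R_m$ (and their inverses) whose product equals $w$ in the free group $F_S$, and the Dehn function is $\delta_G(n)=\sup\{a(w): w \text{ a relation of length at most } n\}$. For $f,g:\mathbb{N}\to\mathbb{N}$, $f\preccurlyeq g$ means that there is a constant $c$ with $f(n)\leq c\,g(cn)+cn+c$ for all $n\ge 0$. The class of $\delta_G$ up to $\approx$ (where $f\approx g$ means $f\preccurlyeq g$ and $g\preccurlyeq f$) does not depend on $S$ and $m$. *)

(* Defs.v *)
From HB Require Import structures.
From mathcomp Require Import all_boot all_order all_algebra.
From mathcomp Require Import all_classical all_reals all_analysis.
From mathcomp Require Import zify.

Set Implicit Arguments.
Unset Strict Implicit.
Unset Printing Implicit Defensive.

Local Open Scope classical_set_scope.

(* The regular tree of degree d + 1 is realised as the Cayley graph of the free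
   product of d + 1 copies of Z/2: vertices are the words without two equal
   consecutive letters, and ends are the infinite such words (an end being
   identified with the geodesic ray from the empty word that represents it). *)

Section Tree.
Variable d : nat.

Definition reduced : pred (seq 'I_d.+1) := sorted (fun i j => i != j).

Record vertex := Vertex { letters :> seq 'I_d.+1; _ : reduced letters }.
HB.instance Definition _ := [isSub for letters].
HB.instance Definition _ := [Choice of vertex by <:].

Definition adj : rel vertex := fun u v =>
  [exists i, (v == rcons u i :> seq _) || (u == rcons v i :> seq _)].

Record tend := End { ray :> nat -> 'I_d.+1; _ : forall n, ray n != ray n.+1 }.
HB.instance Definition _ := gen_eqMixin tend.
HB.instance Definition _ := gen_choiceMixin tend.

Fact trunc_subproof (x : tend) n : reduced (mkseq x n).
Proof.
case: x => x Hx /=; rewrite /reduced /mkseq; case: n => // n /=.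
by elim: n 0 => //= n IHn m; rewrite Hx IHn.
Qed.

Definition trunc (x : tend) n : vertex := Vertex (trunc_subproof x n).

Definition tend_open (U : set tend) :=
  forall x, U x -> exists n, forall y : tend, trunc y n = trunc x n -> U y.

Fact tend_openT : tend_open setT.
Proof. by move=> x _; exists 0. Qed.

Lemma trunc_le (x y : tend) m n :
  m <= n -> trunc y n = trunc x n -> trunc y m = trunc x m.
Proof.
move=> mn /(congr1 letters) /= /(congr1 (take m)) H; apply/val_inj => /=.
by move: H; rewrite -!map_take !take_iota (minn_idPl mn).
Qed.

Fact tend_openI : setI_closed tend_open.
Proof.
move=> U V Uo Vo x [/Uo [m Um] /Vo [n Vn]]; exists (maxn m n) => y xy.
by split; [apply: Um|apply: Vn]; apply: trunc_le xy;
   rewrite ?leq_maxl ?leq_maxr.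
Qed.

Fact tend_open_bigU (I : Type) (f : I -> set tend) :
  (forall i, tend_open (f i)) -> tend_open (\bigcup_i f i).
Proof. by move=> fo x [i _ /fo[n fn]]; exists n => y /fn; exists i. Qed.

HB.instance Definition _ :=
  isOpenTopological.Build tend tend_openT tend_openI tend_open_bigU.

Definition subtree (F : set vertex) :=
  F !=set0 /\
  forall u v, F u -> F v -> exists p, [/\ path adj u p, last u p = v &
                                         forall w, w \in u :: p -> F w].

Definition leaf (F : set vertex) (v : vertex) :=
  forall u w, F u -> F w -> adj v u -> adj v w -> u = w.

Definition complete_subtree (F : set vertex) :=
  [/\ finite_set F, subtree F &
      forall v, F v -> leaf F v \/ (forall u, adj v u -> F u)].

(* [f] restricts to an isomorphism of the subgraphs induced on the complements
   of [F] and [F']; its values on [F] are irrelevant. *)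
Definition forest_iso (F F' : set vertex) (f : vertex -> vertex) :=
  set_bij (~` F) (~` F') f /\
  forall u v, ~ F u -> ~ F v -> adj (f u) (f v) = adj u v.

Definition induces (f : vertex -> vertex) (g : tend -> tend) :=
  forall x, \forall n \near \oo, exists m, f (trunc x n) = trunc (g x) m.

Definition homeomorphism (g : tend -> tend) :=
  continuous g /\
  exists h, [/\ cancel g h, cancel h g & continuous h].

Definition almost_automorphism (g : tend -> tend) :=
  homeomorphism g /\
  exists F F' f, [/\ complete_subtree F, complete_subtree F',
                     forest_iso F F' f & induces f g].

Definition tree_automorphism (f : vertex -> vertex) :=
  bijective f /\ forall u v, adj (f u) (f v) = adj u v.

Record neretin :=
  Neretin { nfun :> tend -> tend; nfunP : almost_automorphism nfun }.
HB.instance Definition _ := gen_eqMixin neretin.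
HB.instance Definition _ := gen_choiceMixin neretin.

Implicit Types u v w : vertex.

Lemma neretin_eq (g h : neretin) : (forall x, g x = h x) -> g = h.
Proof.
case: g h => [g gP] [h hP] /= /funext gh; move: gP; rewrite gh => gP.
by congr Neretin; exact: Prop_irrelevance.
Qed.

Lemma homeomorphism_id : homeomorphism id.
Proof. by split; [|exists id; split]; move=> // x; exact: cvg_id. Qed.

Lemma homeomorphism_comp g h :
  homeomorphism g -> homeomorphism h -> homeomorphism (g \o h).
Proof.
move=> [gc [g' [gK g'K g'c]]] [hc [h' [hK h'K h'c]]]; split.
  by move=> x; apply: continuous_comp; [exact: hc|exact: gc].
exists (h' \o g'); split; try exact: can_comp.
by move=> x; apply: continuous_comp; [exact: g'c|exact: h'c].
Qed.

Lemma trunc_inj x : injective (trunc x).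
Proof. by move=> m n /(congr1 (size \o letters)) /=; rewrite !size_mkseq. Qed.

Lemma size_trunc x n : size (trunc x n) = n.
Proof. exact: size_mkseq. Qed.

Lemma reduced_rcons s i j :
  reduced (rcons (rcons s i) j) = reduced (rcons s i) && (i != j).
Proof.
rewrite /reduced -cats1; case: s => [|a s] /=; first by rewrite andbT.
by rewrite cat_path last_rcons /= andbT.
Qed.

Lemma reduced_prefix s i : reduced (rcons s i) -> reduced s.
Proof. by case/lastP: s => // s j; rewrite reduced_rcons => /andP[]. Qed.

Fact take_subproof k (v : vertex) : reduced (take k v).
Proof. by case: v => v vP /=; apply: take_sorted. Qed.
Definition vtake k v := Vertex (take_subproof k v).

Lemma adjP u v : reflect
  (exists i, v = rcons u i :> seq _ \/ u = rcons v i :> seq _) (adj u v).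
Proof.
apply: (iffP existsP) => -[i H]; exists i.
  by case/orP: H => /eqP; [left|right].
by case: H => /eqP ->; rewrite ?orbT.
Qed.

Lemma adj_sym : symmetric adj.
Proof. by move=> u v; apply/adjP/adjP => -[i []]; exists i; auto. Qed.

Lemma adj_size u v : adj u v -> size v = (size u).+1 \/ size u = (size v).+1.
Proof. by case/adjP => i [] ->; rewrite size_rcons; auto. Qed.

Lemma nbr_ex (u : vertex) i : exists v : vertex, v = rcons u i :> seq _ \/ u = rcons v i :> seq _.
Proof.
have [r|nr] := boolP (reduced (rcons u i)); first by exists (Vertex r); left.
case: u nr => s sP /=; case/lastP: s sP => [//|s j] sP.
rewrite reduced_rcons sP /= negbK => /eqP ji.
by exists (Vertex (reduced_prefix sP)); right; rewrite /= ji.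
Qed.

Definition nbr u i := projT1 (cid (nbr_ex u i)).

Lemma nbrP (u : vertex) i : nbr u i = rcons u i :> seq _ \/ u = rcons (nbr u i) i :> seq _.
Proof. exact: projT2 (cid (nbr_ex u i)). Qed.

Lemma vertex_nrep s i (v : vertex) : v = rcons (rcons s i) i :> seq _ -> False.
Proof. by case: v => v vP /= E; move: vP; rewrite E reduced_rcons eqxx andbF. Qed.

Lemma nbr_inj u : injective (nbr u).
Proof.
move=> i j E; have := nbrP u i; have := nbrP u j; rewrite E.
case=> [->|uj] [].
- by move/rcons_inj; case.
- by move/(congr1 size); rewrite !size_rcons => /eqP; rewrite ltn_eqF// leqW.
- by move=> E2; move/(congr1 size): uj; rewrite E2 !size_rcons => /eqP; rewrite ltn_eqF// leqW.
- by rewrite uj => /rcons_inj [].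
Qed.

Lemma adj_nbr u v : adj u v <-> v \in codom (nbr u).
Proof.
split=> [/adjP[i H]|/codomP[i ->]]; last by apply/adjP; exists i; exact: nbrP.
apply/codomP; exists i; apply/val_inj => /=.
case: (nbrP u i) H => E [] E'; first by rewrite E E'.
- by case: (@vertex_nrep v i (nbr u i)); rewrite -E'.
- by case: (@vertex_nrep (nbr u i) i v); rewrite -E.
- by move: E; rewrite E' => /rcons_inj[].
Qed.

Lemma forest_iso_nbr A B f u : forest_iso A B f ->
  ~ A u -> (forall v, adj u v -> ~ A v) ->
  forall w, adj (f u) w -> exists2 v, adj u v & w = f v.
Proof.
move=> [[_ finj _] fadj] Au Nu w /adj_nbr wN.
have adjn i : adj u (nbr u i) by apply/adj_nbr/codom_f.
have inj : injective (f \o nbr u).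
  move=> i j /= E; apply: (@nbr_inj u); apply: finj E; rewrite inE;
  exact/Nu/adjn.
have sub : {subset codom (f \o nbr u) <= codom (nbr (f u))}.
  move=> _ /codomP[i ->]; apply/adj_nbr; rewrite fadj//; exact/Nu.
have [] := uniq_min_size _ sub _.
- by rewrite map_inj_uniq// enum_uniq.
- by rewrite !size_codom.
- by move=> _ /(_ w); rewrite wN => /codomP[i ->]; exists (nbr u i).
Qed.

Lemma cycle_path_rev u p : path adj u p ->
  exists q, [/\ path adj (last u p) q, last (last u p) q = u &
    last u p :: q =i u :: p].
Proof.
move=> up; exists (rev (belast u p)); split.
- by rewrite rev_path (eq_path (e' := adj))// => x y; rewrite adj_sym.
- case: p {up} => //= v p; by rewrite rev_cons last_rcons.
- by move=> w; rewrite -rev_rcons -lastI mem_rev.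
Qed.

Lemma root_path (F : set vertex) u : (forall k, F (vtake k u)) ->
  exists p, [/\ path adj u p, last u p = vtake 0 u & forall w, w \in u :: p -> F w].
Proof.
move=> Fu; have uE : vtake (size u) u = u by apply/val_inj/take_size.
suff: forall k, k <= size u ->
  exists p, [/\ path adj (vtake k u) p, last (vtake k u) p = vtake 0 u
    & forall w, w \in vtake k u :: p -> F w].
  by move=> /(_ _ (leqnn _)); rewrite uE.
elim=> [_|k IHk ku].
  by exists [::]; split=> // w; rewrite inE => /eqP ->; exact: Fu.
have [p [pp pl pF]] := IHk (ltnW ku); exists (vtake k u :: p); split=> //=.
  rewrite pp andbT; apply/adjP.
  by exists (nth ord0 u k); right; rewrite /= (take_nth ord0).
by move=> w; rewrite inE => /orP[/eqP ->|/pF//]; exact: Fu.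
Qed.

Lemma connectedT u v : exists2 p, path adj u p & last u p = v.
Proof.
have [p [up pl _]] := @root_path setT u (fun=> I).
have [q [vq ql _]] := @root_path setT v (fun=> I).
have [r [rp rl _]] := cycle_path_rev vq.
have E : vtake 0 u = vtake 0 v by apply/val_inj; rewrite /= !take0.
exists (p ++ r); first by rewrite cat_path up pl E -ql.
by rewrite last_cat pl E -ql.
Qed.

Lemma forest_iso_id : forest_iso set0 set0 id.
Proof. by split=> //; split=> // x Hx; exists x. Qed.

Definition ball k : set vertex := [set v : vertex | size v <= k].

Lemma finite_ball k : finite_set (ball k).
Proof.
suff : finite_set [set s : seq 'I_d.+1 | size s <= k].
  move=> fs; apply: (finite_preimage (f := letters) _ fs).
  by move=> u v _ _ /val_inj.
elim: k => [|k IHk].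
  apply: (@sub_finite_set _ _ [set [::]]); last exact: finite_set1.
  by move=> s /=; rewrite leqn0 size_eq0 => /eqP.
apply: (@sub_finite_set _ _ ([set [::]] `|`
  (fun x : 'I_d.+1 * seq 'I_d.+1 => x.1 :: x.2) @` ([set: 'I_d.+1] `*` [set s | size s <= k]))).
  by case=> [|i s] /= H; [left|right; exists (i, s)].
rewrite finite_setU; split; first exact: finite_set1.
by apply: finite_image; apply: finite_setX.
Qed.

Lemma finite_sub_ball A : finite_set A -> exists k, A `<=` ball k.
Proof.
move=> /finite_seqP[X ->].
exists (\max_(v <- X) size v) => v /= vX.
exact: (@leq_bigmax_seq _ _ xpredT (fun v : vertex => size v)).
Qed.

Lemma vtake_adj k u v : adj u v -> k < size u -> k < size v ->
  vtake k u = vtake k v.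
Proof.
move=> /adjP[i [] E] ku kv; apply/val_inj; rewrite /= E -cats1 takel_cat// ltnW//.
Qed.

Lemma refine_complete A B f k : finite_set B -> forest_iso A B f ->
  A `<=` ball k -> complete_subtree (~` (f @` (~` ball k.+2))).
Proof.
move=> finB fiso Ak; have [[ffun finj fsurj] fadj] := fiso.
set D := ~` ball k.+2; set C := ~` (f @` D).
have big v : k < size v -> ~ A v by move=> kv /Ak; rewrite /ball /=; lia.
have DP v : D v <-> k.+2 < size v by rewrite /D /ball /=; split; lia.
have nbrf v : k.+1 < size v -> forall w, adj (f v) w -> exists2 u, adj v u & w = f u.
  move=> kv; apply: (forest_iso_nbr fiso) => [|u /adj_size uv]; apply: big; lia.
have Cf v : ~ A v -> C (f v) -> size v <= k.+2.
  by move=> Av Cv; rewrite leqNgt; apply/negP => /DP Dv; apply: Cv; exists v.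
have fC v : k < size v -> size v <= k.+2 -> C (f v).
  move=> kv kv2 [w /DP Dw wv0]; have wv := finj w v _ _ wv0.
  suff : w = v by move=> E; move: Dw; rewrite E; lia.
  by apply: wv; rewrite inE; apply: big; lia.
have par v : D v -> C (f (vtake k.+2 v)).
  by move=> /DP kv; apply: fC; rewrite /= size_take kv; lia.
have adjC u v : C u -> adj u (f v) -> D v -> u = f (vtake k.+2 v).
  move=> Cu; rewrite adj_sym => uv Dv; have kv := (DP v).1 Dv.
  have [w vw uE] := nbrf v (ltac:(lia)) u uv; rewrite uE; congr f.
  have wk : size w <= k.+2.
    apply: Cf; last by rewrite -uE.
    by apply: big; case: (adj_size vw); lia.
  case/adjP: vw => i [] E; first by move: wk; rewrite E size_rcons; lia.
  apply/val_inj => /=; have := kv; rewrite E size_rcons => kw.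
  by rewrite -cats1 takel_cat ?take_oversize//; lia.
have CVD u : C u \/ exists2 v, D v & u = f v.
  have [|nC] := pselect (C u); [by left|right].
  by have [v Dv <-] := contrapT nC; exists v.
have r_ex u : exists v, (C u -> v = u) /\
    (forall w, D w -> u = f w -> v = f (vtake k.+2 w)).
  have [Cu|[w Dw ->]] := CVD u.
    by exists u; split=> // w Dw uE; case: Cu; exists w.
  exists (f (vtake k.+2 w)); split=> [[]|w' Dw']; first by exists w.
  move=> ww'; congr (f (vtake _ _)); apply: finj => //; rewrite inE;
    apply: big; [move/DP: Dw|move/DP: Dw']; lia.
pose r u := projT1 (cid (r_ex u)).
have rC u : C u -> r u = u by exact: (projT2 (cid (r_ex u))).1.
have rD w : D w -> r (f w) = f (vtake k.+2 w).
  by move=> Dw; apply: (projT2 (cid (r_ex (f w)))).2.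
have Cr u : C (r u).
  by have [Cu|[w Dw ->]] := CVD u; [rewrite rC|rewrite rD//; exact: par].
have r_adj u v : adj u v -> r u = r v \/ adj (r u) (r v).
  have [Cu|[u' Du ->]] := CVD u; have [Cv|[v' Dv ->]] := CVD v => uv.
  - by right; rewrite !rC.
  - left; rewrite (rC u)// (rD v')//; exact: adjC.
  - by left; rewrite (rC v)// (rD u')//; apply/esym/adjC => //; rewrite adj_sym.
  - left; rewrite !rD//; congr f; apply: vtake_adj; [|exact/DP..].
    rewrite -fadj//; apply: big; [move/DP: Du|move/DP: Dv]; lia.
split.
- apply: (@sub_finite_set _ _ (B `|` f @` ball k.+2)).
    move=> u Cu; have [Bu|nB] := pselect (B u); [by left|right].
    by have [v Av fv] := fsurj u nB; exists v => //; apply: Cf; rewrite ?fv.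
  by rewrite finite_setU; split=> //; apply/finite_image/finite_ball.
- split.
    by exists (r (@Vertex [::] isT)).
  move=> u v Cu Cv; have [p up pl] := connectedT u v.
  suff : exists p, [/\ path adj (r u) p, last (r u) p = r v &
      forall w, w \in r u :: p -> C w] by rewrite !rC.
  elim: p u up pl {Cu} => [|w p IHp] u /=.
    move=> _ ->; exists [::]; split=> // z; rewrite inE => /eqP ->; exact: Cr.
  move=> /andP[uw wp] pl; have [q [wq ql qC]] := IHp w wp pl.
  have [->|ruw] := r_adj _ _ uw; first by exists q.
  exists (r w :: q); split=> //=; first by rewrite ruw.
  by move=> z; rewrite inE => /orP[/eqP ->|/qC//]; exact: Cr.
- move=> u Cu; have [|nC] := pselect (forall v, adj u v -> C v); [by right|left].
  move: nC => /existsNP[v /not_implyP[uv nCv]].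
  have [//|[w Dw vE]] := CVD v.
  move: uv; rewrite vE => /adjC /(_ Dw) -> //.
  have kw := (DP w).1 Dw.
  set p := vtake k.+2 w; have sp : size p = k.+2 by rewrite /= size_take kw.
  suff H y : C y -> adj (f p) y -> y = f (vtake k.+1 p).
    by move=> y z Cy Cz py pz; rewrite (H y)// (H z).
  move=> Cy /nbrf[|q pq yE]; first by rewrite sp.
  rewrite yE; congr (f _); have : size q <= k.+2.
    apply: Cf; last by rewrite -yE.
    by apply: big; case: (adj_size pq); lia.
  case/adjP: pq => i [] E; first by rewrite E size_rcons; lia.
  have : size q = k.+1 by move: sp; rewrite E size_rcons; lia.
  move=> sq _; apply/val_inj; change (letters q = take k.+1 (letters p)).
  by rewrite E -cats1 takel_cat ?take_oversize// sq.
Qed.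

Lemma complete_ball k : complete_subtree (ball k.+2).
Proof.
have := @refine_complete set0 set0 id k (finite_set0 _) forest_iso_id.
by rewrite image_id setCK; apply; exact: sub0set.
Qed.

Lemma forest_iso_refine A B f : finite_set A -> finite_set B ->
  forest_iso A B f -> exists F F',
    [/\ complete_subtree F, complete_subtree F' & forest_iso F F' f].
Proof.
move=> /finite_sub_ball[k Ak] finB fiso.
exists (ball k.+2), (~` (f @` (~` ball k.+2))); split.
- exact: complete_ball.
- exact: refine_complete fiso Ak.
have Ak2 : A `<=` ball k.+2 by move=> u /Ak; rewrite /ball /=; lia.
have [[_ finj _] fadj] := fiso; split; last first.
  by move=> u v nu nv; apply: fadj => /Ak2.
rewrite setCK; split=> //.
move=> u v; rewrite !inE => nu nv; apply: finj; rewrite inE => /Ak2; [exact: nu|exact: nv].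
Qed.

Lemma forest_iso_inv A B f : forest_iso A B f ->
  exists f', forest_iso B A f' /\ forall u, ~ A u -> f' (f u) = u.
Proof.
move=> [[ffun finj fsurj] fadj].
have /choice[f' f'P] u : exists v, ~ B u -> ~ A v /\ f v = u.
  have [Bu|nB] := pselect (B u); first by exists u.
  by have [v Av fv] := fsurj u nB; exists v.
have f'K u : ~ A u -> f' (f u) = u.
  move=> nA; have [nA' E] := f'P _ (ffun u nA).
  by apply: finj E; rewrite inE.
exists f'; split=> //; split; last first.
  move=> u v /f'P[nu uE] /f'P[nv vE].
  by rewrite -[in RHS]uE -[in RHS]vE fadj.
split.
- by move=> u /f'P[].
- move=> u v; rewrite !inE => /f'P[_ uE] /f'P[_ vE] E.
  by rewrite -uE -vE E.
- by move=> u nA; exists (f u); [exact: ffun|exact: f'K].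
Qed.

Lemma forest_iso_comp A B C D f e : finite_set A -> finite_set B ->
  finite_set C -> finite_set D -> forest_iso A B f -> forest_iso C D e ->
  exists A' B', [/\ finite_set A', finite_set B' & forest_iso A' B' (e \o f)].
Proof.
move=> finA finB finC finD fiso; have [f' [_ f'K]] := forest_iso_inv fiso.
move: fiso => [[ffun finj fsurj] fadj] [[efun einj esurj] eadj].
set A' := A `|` [set u | ~ A u /\ C (f u)].
exists A', (~` ((e \o f) @` (~` A'))).
have nA u : ~ A' u -> ~ A u by move=> nu Au; apply: nu; left.
have nC u : ~ A' u -> ~ C (f u).
  by move=> nu Cu; apply: (nu); right; split=> //; exact: nA.
split.
- rewrite finite_setU; split=> //.
  apply: (@sub_finite_set _ _ (f' @` C)); last exact: finite_image.
  by move=> u [nAu Cu]; exists (f u) => //; exact: f'K.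
- apply: (@sub_finite_set _ _ (D `|` e @` B)).
    move=> u nu; have [Du|nD] := pselect (D u); [by left|right].
    have [v nCv ev] := esurj u nD; exists v => //.
    apply: contrapT => nB; have [w nAw fw] := fsurj v nB.
    apply: nu; exists w; rewrite /= ?fw// => -[//|[_]].
    by rewrite fw.
  by rewrite finite_setU; split=> //; exact: finite_image.
- split; last by move=> u v nu nv; rewrite /= eadj ?fadj//; auto.
  rewrite setCK; split=> //.
  move=> u v; rewrite !inE => nu nv /= E; apply: finj; rewrite ?inE; [exact: nA|exact: nA|].
  by apply: einj E; rewrite inE; exact: nC.
Qed.

Lemma adj_trunc (x : tend) n : adj (trunc x n) (trunc x n.+1).
Proof. by apply/adjP; exists (x n); left; rewrite /= mkseqS. Qed.

Lemma induces_tail A B f g x : finite_set A -> forest_iso A B f ->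
  induces f g -> exists M N, forall j, f (trunc x (M + j)) = trunc (g x) (N + j).
Proof.
move=> /finite_sub_ball[k Ak] [[_ finj _] fadj] /(_ x)[n1 _ n1P].
set n0 := maxn k.+1 n1.
have nA n : n0 <= n -> ~ A (trunc x n).
  by move=> nn /Ak; rewrite /ball /= size_mkseq; lia.
have /choice[m mP] n : exists m, n0 <= n -> f (trunc x n) = trunc (g x) m.
  have [nn|_] := leqP n0 n; last by exists 0.
  by have [|m mP] := n1P n; [rewrite /=; lia|exists m].
have m_step n : n0 <= n -> m n.+1 = (m n).+1 \/ m n = (m n.+1).+1.
  move=> nn; have := adj_trunc x n; rewrite -fadj; [|exact: nA|apply: nA; lia].
  by rewrite !mP; [move/adj_size; rewrite !size_trunc|lia|lia].
have m_inj n : n0 <= n -> m n.+2 <> m n.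
  move=> nn E; have : trunc x n.+2 = trunc x n.
    apply: finj; rewrite ?inE; [apply: nA; lia|exact: nA|].
    by rewrite !mP ?E//; lia.
  by move/trunc_inj; lia.
have [[M [M0 MP]]|dec] :=
    pselect (exists n, n0 <= n /\ m n.+1 = (m n).+1); last first.
  have dec' j : m (n0 + j) + j = m n0.
    elim: j => [|j <-]; first by rewrite !addn0.
    have [|E|] := m_step (n0 + j); rewrite ?addnS; [lia| |lia].
    by case: dec; exists (n0 + j); split=> //; lia.
  by have := dec' (m n0).+1; lia.
exists M, (m M).
suff H j : m (M + j) = m M + j /\ m (M + j).+1 = (m (M + j)).+1.
  by move=> j; rewrite mP ?(H j).1//; lia.
elim: j => [|j [IH1 IH2]]; first by rewrite !addn0.
rewrite !addnS; split; first by rewrite IH2 IH1.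
have [|//|] := m_step (M + j).+1; first lia.
by have := m_inj (M + j); lia.
Qed.

Lemma almost_automorphism_id : almost_automorphism id.
Proof.
split; first exact: homeomorphism_id.
have [F [F' [Fc F'c Fi]]] :=
  forest_iso_refine (finite_set0 _) (finite_set0 _) forest_iso_id.
exists F, F', id; split=> // x.
by exists 0 => // n _; exists n.
Qed.

Lemma almost_automorphism_comp g h :
  almost_automorphism g -> almost_automorphism h -> almost_automorphism (g \o h).
Proof.
move=> [gh [C [D [e [[finC _ _] [finD _ _] eiso eg]]]]].
move=> [hh [A [B [f [[finA _ _] [finB _ _] fiso fh]]]]].
split; first exact: homeomorphism_comp.
have [A' [B' [finA' finB' iso]]] := forest_iso_comp finA finB finC finD fiso eiso.
have [F [F' [Fc F'c Fi]]] := forest_iso_refine finA' finB' iso.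
exists F, F', (e \o f); split=> // x.
have [M [N MN]] := induces_tail x finA fiso fh.
have [n0 _ n0P] := eg (h x).
exists (M + n0) => // n /= nn; rewrite -(@subnKC M n); last lia.
rewrite MN; apply: n0P; rewrite /=; lia.
Qed.

Lemma almost_automorphism_inv g : almost_automorphism g ->
  exists h, [/\ almost_automorphism h, cancel g h & cancel h g].
Proof.
move=> [[gc [h [gK hK hc]]] [F [F' [f [Fc F'c fiso fg]]]]].
exists h; split=> //; split; first by split=> //; exists g; split.
have [f' [f'iso f'K]] := forest_iso_inv fiso.
exists F', F, f'; split=> // x; have [finF _ _] := Fc.
have [M [N MN]] := induces_tail (h x) finF fiso fg.
have [k Fk] := finite_sub_ball finF.
exists (N + k.+1) => // n /= nn; exists (M + (n - N)).
rewrite -[in LHS](@subnKC N n); last lia.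
rewrite -{1}[x]hK -MN f'K// => /Fk; rewrite /ball /= size_mkseq; lia.
Qed.

Definition neretin1 := Neretin almost_automorphism_id.
Definition neretin_mul (g h : neretin) :=
  Neretin (almost_automorphism_comp (nfunP g) (nfunP h)).
Definition neretin_inv (g : neretin) :=
  let: exist h (And3 hP _ _) := cid (almost_automorphism_inv (nfunP g)) in
  Neretin hP.

Lemma neretin_invK (g : neretin) : cancel g (neretin_inv g) /\ cancel (neretin_inv g) g.
Proof. by rewrite /neretin_inv; case: cid => h []. Qed.

Fact neretin_mulA : associative neretin_mul.
Proof. by move=> g h k; apply: neretin_eq. Qed.
Fact neretin_mul1g : left_id neretin1 neretin_mul.
Proof. by move=> g; apply: neretin_eq. Qed.
Fact neretin_mulg1 : right_id neretin1 neretin_mul.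
Proof. by move=> g; apply: neretin_eq. Qed.
Fact neretin_mulVg : left_inverse neretin1 neretin_inv neretin_mul.
Proof. by move=> g; apply: neretin_eq; exact: (neretin_invK g).1. Qed.
Fact neretin_mulgV : right_inverse neretin1 neretin_inv neretin_mul.
Proof. by move=> g; apply: neretin_eq; exact: (neretin_invK g).2. Qed.

HB.instance Definition _ := isGroup.Build neretin neretin_mulA neretin_mul1g
  neretin_mulg1 neretin_mulVg neretin_mulgV.

Definition stabilizer (A : set vertex) : set neretin :=
  [set h | exists f, [/\ tree_automorphism f, forall v, A v -> f v = v &
                         induces f h]].

(* Pointwise stabilisers in Aut(T) of finite sets of vertices form a basis of
   neighbourhoods of 1 in Aut(T), hence in any group topology on [neretin] for
   which Aut(T) is an open subgroup; their left translates form a base of it. *)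
Definition neretin_open (U : set neretin) :=
  forall g, U g -> exists2 A, finite_set A &
    forall h, stabilizer A h -> U (g * h)%g.

Fact neretin_openT : neretin_open setT.
Proof. by move=> g _; exists set0. Qed.

Fact neretin_openI : setI_closed neretin_open.
Proof.
move=> U V Uo Vo g [/Uo [A fA UA] /Vo [B fB VB]]; exists (A `|` B).
  by rewrite finite_setU.
move=> h [f [fa fi fh]]; split.
- by apply: UA; exists f; split=> // v Av; apply: fi; left.
- by apply: VB; exists f; split=> // v Bv; apply: fi; right.
Qed.

Fact neretin_open_bigU (I : Type) (f : I -> set neretin) :
  (forall i, neretin_open (f i)) -> neretin_open (\bigcup_i f i).
Proof.
move=> fo g [i _ /fo[A fA fiA]]; exists A => // h hA.
by exists i => //; exact: fiA.
Qed.

HB.instance Definition _ := isOpenTopological.Build neretin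
  neretin_openT neretin_openI neretin_open_bigU.

End Tree.

Section Presentation.
Variables (G : groupType) (S : set G).
Local Open Scope group_scope.

(* The letter (s, true) is the formal inverse of the generator s. *)
Definition word := seq (S * bool).

Definition word_inv (w : word) : word := rev [seq (l.1, ~~ l.2) | l <- w].

Definition eval (w : word) : G :=
  \prod_(l <- w) (if l.2 then (val l.1)^-1 else val l.1).

(* Equality of two words in the free group on S. *)
Inductive free_eq : word -> word -> Prop :=
| free_refl u : free_eq u u
| free_sym u v : free_eq u v -> free_eq v u
| free_trans u v w : free_eq u v -> free_eq v w -> free_eq u w
| free_cancel u v s b : free_eq (u ++ (s, b) :: (s, ~~ b) :: v) (u ++ v).

Definition relation : set word := [set w | eval w = 1].

Definition relator m : set word := [set r | relation r /\ size r <= m].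

Definition conj_product m k (w : word) :=
  exists c : seq (word * word),
    [/\ size c = k,
        forall p, p \in c -> relator m p.2 \/ relator m (word_inv p.2) &
        free_eq w (flatten [seq p.1 ++ p.2 ++ word_inv p.1 | p <- c])].

Definition is_area m (w : word) k :=
  conj_product m k w /\ forall j, conj_product m j w -> k <= j.

Definition generating := forall g, exists w, eval w = g.

Definition presented m :=
  generating /\
  (forall w, relation w -> exists k, conj_product m k w).

(* In particular the supremum is finite for each n. *)
Definition dehn_function m (delta : nat -> nat) :=
  forall n, supremums
    [set k | exists w, [/\ relation w, size w <= n & is_area m w k]] (delta n).

End Presentation.

Definition asymp_le (f g : nat -> nat) :=
  exists c, forall n, f n <= c * g (c * n) + c * n + c.

(* Main.v *)
(* A state is a partition of the boundary of the tree into clopen sets, recorded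
   as a forest of binary trees whose leaves are words standing for cylinders;
   states are adjacent when merging two pieces of one gives the other.  With a
   state comes the family of clopen sets formed by the vertices of its trees and
   by the cylinders below the leaves.  Neretin's group acts transitively on the
   families with n + 3 pieces, and the stabiliser K of the family fam0 of all
   proper cylinders is compact and open.  Merging two pieces changes the group
   element that marks the state by one out of finitely many cosets of K, and by
   Baire's theorem and compactness such a set of elements has bounded word
   length.  So a relation of length n becomes a loop of O(n) states with boundedly
   many pieces and O(n) leaves, and it suffices to fill this loop by loops of
   bounded length.  This is done by deleting the leaves one after the other: a
   leaf is peeled off from every state of the loop along the spine of its tree,
   and the strips between consecutive states have cost O(n^3) by divide and
   conquer on the spine.  Altogether the area is O(n^5). *)

Require Import Defs.
From HB Require Import structures.
From mathcomp Require Import all_boot all_order all_algebra.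
From mathcomp Require Import all_classical all_reals all_analysis.
From mathcomp Require Import perm finmap multiset zify.

Set Implicit Arguments.
Unset Strict Implicit.
Unset Printing Implicit Defensive.

Local Open Scope mset_scope.

(** * Filling loops by small loops *)

(** Two constraints shape the argument. First, the finite set of cosets met by a move depends on the
    number of pieces, so a loop is turned into relators only within a fixed width. A deep leaf
    therefore cannot be freed by opening its whole spine, which would produce one root per tooth.
    Instead a second root, the carrier, takes over the teeth of the spine and hands them back. The
    carrier is an arbitrary choice, and most of the combinatorial work shows that exchanging one
    carrier for another is cheap. For the same reason a freed leaf is merged at once into a root
    that stays constant along the loop. Second, a group element determines only a family, and one
    family is carried by many forests. A path of families is lifted to forests by refining leaves on
    demand, at most one new leaf per move; this is why the leaves stay linear in number and common
    to all states. The lift of a closed path closes up because forests with equal leaves and equal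
    families coincide. The widths are 7 for the loops that come from words and 18 = 7 + 11 for
    filling them. *)

Section Homotopy.
Variables (X : Type) (e : rel X).
Implicit Types (x y : X) (p q r s : seq X).

Definition rv x p := rev (belast x p).

Lemma rv_cat x p q : rv x (p ++ q) = rv (last x p) q ++ rv x p.
Proof. by rewrite /rv belast_cat rev_cat. Qed.

Lemma rv_cons x y p : rv x (y :: p) = rv y p ++ [:: x].
Proof. by rewrite /rv /= rev_cons cats1. Qed.

Lemma last_rv x p : last (last x p) (rv x p) = x.
Proof. by case: p => //= y p; rewrite rv_cons last_cat. Qed.

Lemma size_rv x p : size (rv x p) = size p.
Proof. by rewrite /rv size_rev size_belast. Qed.

Lemma rvK x p : rv (last x p) (rv x p) = p.
Proof.
by elim: p x => //= y p IHp x; rewrite rv_cons rv_cat last_rv IHp.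
Qed.

(* [htp c n x p q]: the paths [p] and [q] from [x] (given without their first
   vertex) bound a disc tiled by at most [n] loops of length at most [c]. *)
Inductive htp (c : nat) : nat -> X -> seq X -> seq X -> Prop :=
| htp_small x p q : path e x p -> path e x q -> last x p = last x q ->
    size p + size q <= c -> htp c 1 x p q
| htp_refl x p : path e x p -> htp c 0 x p p
| htp_sym n x p q : htp c n x p q -> htp c n x q p
| htp_trans m n x p q r :
    htp c m x p q -> htp c n x q r -> htp c (m + n) x p r
| htp_cat m n x p q r s : htp c m x p q -> htp c n (last x p) r s ->
    htp c (m + n) x (p ++ r) (q ++ s)
| htp_weak m n x p q : htp c m x p q -> m <= n -> htp c n x p q.

Hypothesis e_sym : symmetric e.

Lemma rv_path x p : path e x p -> path e (last x p) (rv x p).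
Proof. by rewrite /rv rev_path (eq_path (e' := e))// => y z; rewrite e_sym. Qed.

Section Fixc.
Variable c : nat.
Local Notation htp := (htp c).

Lemma htp_path n x p q : htp n x p q ->
  [/\ path e x p, path e x q & last x p = last x q].
Proof.
elim=> {n x p q} //.
- by move=> n x p q _ [].
- by move=> m n x p q r _ [? ? ->] _ [? ? ->].
move=> m n x p q r s _ [px qx pq] _ [rx sx rs].
by rewrite !cat_path !last_cat -pq px qx rx sx.
Qed.

Lemma htp_trans_le m n k x p q r : htp m x p q -> htp n x q r -> m + n <= k ->
  htp k x p r.
Proof. by move=> h1 h2; apply: htp_weak; exact: htp_trans h1 h2. Qed.

Lemma htp_cat_le m n k x p q r s : htp m x p q -> htp n (last x p) r s ->
  m + n <= k -> htp k x (p ++ r) (q ++ s).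
Proof. by move=> h1 h2; apply: htp_weak; exact: htp_cat h1 h2. Qed.

Lemma htp_catl n x p r s : path e x p -> htp n (last x p) r s ->
  htp n x (p ++ r) (p ++ s).
Proof. by move=> px rs; apply: (htp_cat_le (htp_refl c px) rs). Qed.

Lemma htp_catr n x p q r : htp n x p q -> path e (last x p) r ->
  htp n x (p ++ r) (q ++ r).
Proof. by move=> pq rx; apply: (htp_cat_le pq (htp_refl c rx)); rewrite addn0. Qed.

Lemma htp_rv n x p q : htp n x p q -> htp n (last x p) (rv x p) (rv x q).
Proof.
elim=> {n x p q}.
- move=> x p q px qx pq sz; apply: htp_small; rewrite ?size_rv//.
  + exact: rv_path.
  + by rewrite pq; exact: rv_path.
  + by rewrite last_rv pq last_rv.
- by move=> x p px; apply: htp_refl; exact: rv_path.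
- by move=> n x p q /htp_path[_ _ <-]; exact: htp_sym.
- move=> m n x p q r /htp_path[_ _ <-] + _; exact: htp_trans.
- move=> m n x p q r s /htp_path[_ _ pq] pq' /htp_path[_ _ rs] rs'.
  rewrite !rv_cat last_cat addnC -pq; apply: htp_cat => //.
  by rewrite last_rv.
- by move=> m n x p q _ + mn; move/htp_weak; apply.
Qed.

Lemma htp_rvK x p : 2 <= c -> path e x p -> htp (size p) x (p ++ rv x p) [::].
Proof.
move=> c2; elim: p x => [|y p IHp] x /=; first by move=> _; exact: htp_refl.
move=> /andP[xy yp].
have -> : y :: p ++ rv x (y :: p) = [:: y] ++ (p ++ rv y p) ++ [:: x].
  by rewrite rv_cons /= catA.
apply: (htp_trans_le (m := size p) (n := 1) (q := [:: y] ++ [::] ++ [:: x])); last by rewrite addn1.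
- apply: htp_catl; first by rewrite /= xy.
  by apply: htp_catr; [exact: IHp|rewrite last_cat last_rv /= e_sym xy].
- by apply: htp_small => //=; rewrite xy e_sym xy.
Qed.

Lemma htp_Krv x p : 2 <= c -> path e x p ->
  htp (size p) (last x p) (rv x p ++ p) [::].
Proof.
move=> c2 px; have := htp_rvK c2 (rv_path px).
by rewrite rvK size_rv.
Qed.

(** Commuting [p] past [q] turns it into [p'], which [s] then cancels; this is how a detour
    disappears after sliding across another path. *)
Lemma htp_slide m n x p q q' p' s r :
  htp m x (p ++ q) (q' ++ p') -> htp n (last x q') (p' ++ s) [::] ->
  path e (last x q') r ->
  htp (m + n) x (p ++ q ++ s ++ r) (q' ++ r).
Proof.
move=> pq ps rP; have [_ P1 L1] := htp_path pq; have [P2 _ L2] := htp_path ps.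
move: P1 P2; rewrite !cat_path => /andP[q'P _] /andP[_ sP].
rewrite !last_cat /= in L1 L2.
apply: (htp_trans_le (m := m) (n := n) (q := (q' ++ p') ++ s ++ r)) => //.
  rewrite (catA p); apply: htp_catr => //.
  by rewrite last_cat L1 cat_path sP L2.
rewrite -catA; apply: htp_catl => //.
by rewrite catA; apply: (htp_catr (q := [::])) => //; rewrite last_cat L2.
Qed.

End Fixc.
End Homotopy.

Lemma htp_map (X Y : Type) (e : rel X) (e' : rel Y) c (f : X -> Y) n x p q :
  (forall x y, e x y -> e' (f x) (f y)) ->
  htp e c n x p q -> htp e' c n (f x) (map f p) (map f q).
Proof.
move=> ef; have fpath x0 s : path e x0 s -> path e' (f x0) (map f s).
  by elim: s x0 => //= y s IHs x0 /andP[/ef -> /IHs].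
elim=> {n x p q}.
- move=> x p q /fpath px /fpath qx pq sz.
  by apply: htp_small; rewrite ?size_map// !last_map pq.
- by move=> x p /fpath; exact: htp_refl.
- by move=> n x p q _; exact: htp_sym.
- by move=> m n x p q r _ + _; exact: htp_trans.
- by move=> m n x p q r s _ pq _ rs; rewrite !map_cat; apply: htp_cat => //; rewrite last_map.
- by move=> m n x p q _ h mn; exact: htp_weak h mn.
Qed.

Lemma msetDE (T : choiceType) (A B : {mset T}) x : (A `+` B) x = A x + B x.
Proof. by rewrite msetE2. Qed.

Ltac mset_ac := apply/msetP => ?; rewrite !msetDE ?mset0E /=; clear; lia.

(* [simpl] identifies the various coercions to the carrier type. *)
Ltac slia :=
  repeat match goal with H : ?P |- _ =>
    lazymatch type of P with Prop => lazymatch P with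
    | is_true (leq _ _) => fail
    | is_true (andb (leq _ _) (leq _ _)) => fail
    | @eq nat _ _ => fail
    | _ => clear H
    end end end;
  first [lia | simpl in *; lia].

Lemma size_msetD (T : choiceType) (A B : {mset T}) :
  size (A `+` B) = size A + size B.
Proof.
rewrite -size_cat; apply: perm_size; apply/allP => x _ /=.
by rewrite count_cat !count_mem_mset msetE2.
Qed.

Lemma size_mset1 (T : choiceType) (a : T) : size [mset a] = 1.
Proof. by rewrite enum_msetn. Qed.

Definition sizeE := (size_msetD, size_mset1, @size_mset0).

(** * Multisets of roots *)

Section States.
Variables (T : choiceType) (node : T -> T -> T).
Local Notation state := {mset T}.
Implicit Types (x y z u r : state) (p q : seq state) (a b c d : T) (g : seq T).

(* The elements of a state are the roots of a forest; a move merges two roots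
   or splits one. *)
Definition step x y := [\/ x = y,
  exists a b u, x = a +` (b +` u) /\ y = node a b +` u |
  exists a b u, y = a +` (b +` u) /\ x = node a b +` u].

Definition sadj l h : rel state := fun x y =>
  [&& l <= size x <= h, l <= size y <= h & `[< step x y >]].

Lemma sadjE l h x y : sadj l h x y = [&& l <= size x <= h, l <= size y <= h & `[< step x y >]].
Proof. by []. Qed.

Lemma step_sym x y : step x y -> step y x.
Proof. by case=> [->|H|H]; [apply: Or31|apply: Or33|apply: Or32]. Qed.

Lemma sadj_sym l h : symmetric (sadj l h).
Proof.
move=> x y; apply/and3P/and3P => -[-> -> /asboolP xy]; split=> //; apply/asboolP; exact: step_sym.
Qed.

Lemma step_ctx u x y : step x y -> step (u `+` x) (u `+` y).
Proof.
case=> [->|[a [b [v [-> ->]]]]|[a [b [v [-> ->]]]]].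
- exact: Or31.
- by apply: Or32; exists a, b, (u `+` v); split; mset_ac.
- by apply: Or33; exists a, b, (u `+` v); split; mset_ac.
Qed.

Lemma sadjxx l h x : l <= size x <= h -> sadj l h x x.
Proof. by move=> xs; rewrite /sadj xs /=; apply/asboolP; exact: Or31. Qed.

Lemma sadj_merge l h x y a b u : x = a +` (b +` u) -> y = node a b +` u ->
  l <= (size u).+1 -> (size u).+2 <= h -> sadj l h x y.
Proof.
move=> -> -> lu hu; rewrite /sadj !sizeE; apply/and3P; split; [lia|lia|].
by apply/asboolP/Or32; exists a, b, u.
Qed.

Lemma sadj_split l h x y a b u : x = node a b +` u -> y = a +` (b +` u) ->
  l <= (size u).+1 -> (size u).+2 <= h -> sadj l h x y.
Proof. by move=> xE yE lu hu; rewrite sadj_sym; exact: (sadj_merge yE xE). Qed.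

Definition walk l h x p := (l <= size x <= h) && path (sadj l h) x p.

Lemma walkE l h x p : walk l h x p = (l <= size x <= h) && path (sadj l h) x p.
Proof. by []. Qed.

Definition ctx u p := map (msetD u) p.

Arguments ctx : simpl never.

Lemma ctx_nil u : ctx u [::] = [::].
Proof. by []. Qed.

Lemma ctx_cons u x p : ctx u (x :: p) = (u `+` x) :: ctx u p.
Proof. by []. Qed.

Lemma ctx_cat u p q : ctx u (p ++ q) = ctx u p ++ ctx u q.
Proof. exact: map_cat. Qed.

Lemma ctx0 p : ctx mset0 p = p.
Proof. by rewrite /ctx (eq_map (g := id)) ?map_id// => x; rewrite mset0D. Qed.

Lemma ctxD u v p : ctx (u `+` v) p = ctx u (ctx v p).
Proof. by rewrite /ctx -map_comp; apply: eq_map => x /=; rewrite msetDA. Qed.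

Lemma last_ctx u x p : last (u `+` x) (ctx u p) = u `+` last x p.
Proof. exact: last_map. Qed.

Lemma rv_ctx u x p : rv (u `+` x) (ctx u p) = ctx u (rv x p).
Proof. by rewrite /rv /ctx map_rev belast_map. Qed.

Lemma size_ctx u p : size (ctx u p) = size p.
Proof. exact: size_map. Qed.

Lemma sadj_ctx l h l' h' u x y : sadj l h x y -> l' <= size u + l ->
  size u + h <= h' -> sadj l' h' (u `+` x) (u `+` y).
Proof.
move=> /and3P[xs ys /asboolP xy] lu hu; apply/and3P; rewrite !sizeE; split.
- lia.
- lia.
- exact/asboolP/step_ctx.
Qed.

Lemma walk_ctx l h l' h' u x p : walk l h x p -> l' <= size u + l ->
  size u + h <= h' -> walk l' h' (u `+` x) (ctx u p).
Proof.
move=> /andP[xs px] lu hu; apply/andP; split; first by rewrite !sizeE; lia.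
elim: p x xs px => //= y p IHp x xs /andP[xy yp].
rewrite (sadj_ctx xy)//= IHp//; by case/and3P: xy.
Qed.

Lemma path_ctx l h l' h' u x p : walk l h x p -> l' <= size u + l ->
  size u + h <= h' -> path (sadj l' h') (u `+` x) (ctx u p).
Proof. by move=> xp lu hu; case/andP: (walk_ctx xp lu hu). Qed.

Lemma walk_cat l h x p q :
  walk l h x (p ++ q) = walk l h x p && walk l h (last x p) q.
Proof.
rewrite /walk cat_path; case xs: (l <= size x <= h) => //=.
case px: (path _ x p) => //=.
suff -> : l <= size (last x p) <= h by [].
elim: p x xs px => //= y p IHp x xs /andP[/and3P[_ ys _]]; exact: IHp.
Qed.

Lemma walk_last l h x p : walk l h x p -> l <= size (last x p) <= h.
Proof. by rewrite -{1}[p]cats0 walk_cat => /andP[_ /andP[]]. Qed.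

Lemma walk_rv l h x p : walk l h x p -> walk l h (last x p) (rv x p).
Proof.
move=> xp; rewrite /walk (walk_last xp) rv_path//; first exact: sadj_sym.
by case/andP: xp.
Qed.

Lemma walk_le l h l' h' x p : walk l h x p -> l' <= l -> h <= h' -> walk l' h' x p.
Proof.
move=> xp ll hh; rewrite -[p]ctx0 -[x]mset0D.
by apply: (walk_ctx xp); rewrite sizeE.
Qed.

Lemma htp_ctx C l h l' h' u n x p q : htp (sadj l h) C n x p q ->
  l' <= size u + l -> size u + h <= h' ->
  htp (sadj l' h') C n (u `+` x) (ctx u p) (ctx u q).
Proof. by move=> pq lu hu; apply: htp_map pq => y z yz; exact: sadj_ctx yz lu hu. Qed.

Section Bounds.
Variables (C l h : nat).
Hypothesis C4 : 4 <= C.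
Local Notation htp := (htp (sadj l h) C).

(** Moves in disjoint parts of a forest commute: the two orders bound a grid of [size p * size q]
    squares with four sides. Widths add, which gives the bounds [l1 + l2] and [h1 + h2]. *)
Lemma htp_comm l1 h1 l2 h2 x p y q :
  walk l1 h1 x p -> walk l2 h2 y q -> l <= l1 + l2 -> h1 + h2 <= h ->
  htp (size p * size q) (x `+` y)
    (ctx y p ++ ctx (last x p) q) (ctx x q ++ ctx (last y q) p).
Proof.
move=> + + ll hh.
suff one l1' h1' x' x1 y' q' : walk l1' h1' x' [:: x1] -> walk l2 h2 y' q' -> l <= l1' + l2 -> h1' + h2 <= h ->
    htp (size q') (x' `+` y') (ctx y' [:: x1] ++ ctx x1 q') (ctx x' q' ++ ctx (last y' q') [:: x1]).
  elim: p x => [|x1 p IHp] x xp yq.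
    rewrite mul0n /= cats0; apply: htp_refl; apply: path_ctx yq _ _; case/andP: xp; lia.
  have /andP[xx1 x1p] : walk l1 h1 x [:: x1] && walk l1 h1 x1 p by rewrite -(walk_cat l1 h1 x [:: x1]).
  rewrite mulSn.
  apply: (htp_trans_le (m := size p * size q) (n := size q) (q := ctx y [:: x1] ++ ctx x1 q ++ ctx (last y q) p)).
  - rewrite -[ctx y (x1 :: p)]/(ctx y [:: x1] ++ ctx y p) -catA; apply: htp_catl.
      by rewrite msetDC; apply: path_ctx xx1 _ _; case/andP: yq; lia.
    rewrite /= msetDC; exact: IHp.
  - rewrite -[ctx (last y q) (x1 :: p)]/(ctx (last y q) [:: x1] ++ ctx (last y q) p) !catA.
    apply: htp_catr.
      exact: (one _ _ _ _ _ _ xx1 yq).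
    rewrite last_cat ctx_cons /= [y `+` x1]msetDC last_ctx [x1 `+` _]msetDC; apply: path_ctx x1p _ _; have := walk_last yq; lia.
  - by rewrite addnC.
elim: q' y' => [|y1 q' IHq] y' xx yq ll' hh'.
  rewrite -[ctx x1 [::]]/[::] -[ctx x' [::]]/[::] cats0 /= msetDC; apply: htp_refl.
  by apply: path_ctx xx _ _; case/andP: yq; lia.
have /andP[yy1 y1q] : walk l2 h2 y' [:: y1] && walk l2 h2 y1 q' by rewrite -(walk_cat l2 h2 y' [:: y1]).
apply: (htp_trans_le (m := 1) (n := size q') (q := ctx x' [:: y1] ++ ctx y1 [:: x1] ++ ctx x1 q')) => //.
- rewrite -[ctx x1 (y1 :: q')]/(ctx x1 [:: y1] ++ ctx x1 q') !catA; apply: htp_catr.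
    have p1 : path (sadj l h) (x' `+` y') (ctx y' [:: x1] ++ ctx x1 [:: y1]).
      rewrite cat_path /= [y' `+` x1]msetDC; apply/andP; split.
        by rewrite [x' `+` _]msetDC [x1 `+` _]msetDC; apply: path_ctx xx _ _; case/andP: yq; lia.
      by apply: path_ctx yy1 _ _; have := walk_last xx; rewrite /=; lia.
    have p2 : path (sadj l h) (x' `+` y') (ctx x' [:: y1] ++ ctx y1 [:: x1]).
      rewrite cat_path; apply/andP; split.
        by apply: path_ctx yy1 _ _; case/andP: xx; lia.
      rewrite /= [x' `+` _]msetDC; apply: path_ctx xx _ _; have := walk_last yy1; rewrite /=; lia.
    by apply: htp_small => //=; rewrite msetDC.
  rewrite last_cat /=; apply: path_ctx y1q _ _; have := walk_last xx; rewrite /=; lia.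
- rewrite -[ctx x' (y1 :: q')]/(ctx x' [:: y1] ++ ctx x' q') -catA.
  apply: htp_catl; first by apply: path_ctx yy1 _ _; case/andP: xx; lia.
  exact: IHq.
Qed.
End Bounds.
End States.

Arguments ctx : simpl never.

(** * Taking a leaf out of the bottom of a comb within bounded width *)

Section Zipper.
Variables (T : choiceType) (node : T -> T -> T).
Local Notation state := {mset T}.
Implicit Types (x y z u r : state) (p q : seq state) (a b c d : T) (g : seq T).
Local Notation sadj := (sadj node).
Local Notation walk := (walk node).
Local Notation LC := (foldl node).
Local Notation RC g b := (foldr node b g).

Lemma mset_neq0_ex r : 0 < size r -> exists a r', r = a +` r'.
Proof.
case: (mset_0Vmem r) => [->|[a ar] _]; first by rewrite size_mset0.
by exists a, (r `\ a); rewrite msetB1K.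
Qed.

(* [LC A g] and [RC g b] are the left comb on [A] and the right comb on [b] with
   the same teeth [g]; the teeth are handed over one at a time. *)
Fixpoint zip A g b : seq state :=
  if g is c :: g' then
    zip (node A c) g' b ++ [:: [mset A; c; RC g' b]; [mset A; node c (RC g' b)]]
  else [::].

Lemma last_zip A g b : last [mset LC A g; b] (zip A g b) = [mset A; RC g b].
Proof. by case: g => [|c g] //=; rewrite last_cat. Qed.

Lemma last_zip_cons A d g b :
  last [mset LC (node A d) g; b] (zip A (d :: g) b) = [mset A; node d (RC g b)].
Proof. exact: last_zip A (d :: g) b. Qed.

Lemma size_zip A g b : size (zip A g b) = 2 * size g.
Proof. by elim: g A => //= c g IHg A; rewrite size_cat IHg /=; lia. Qed.

Lemma walk_zip A g b : walk 2 3 [mset LC A g; b] (zip A g b).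
Proof.
elim: g A => [|c g IHg] A /=; first by rewrite /walk !sizeE.
rewrite walk_cat IHg /= last_zip /walk !sizeE /=.
rewrite (@sadj_split _ node 2 3 _ _ A c [mset RC g b]) ?sizeE//=; [|mset_ac].
by rewrite (@sadj_merge _ node 2 3 _ _ c (RC g b) [mset A]) ?sizeE//=; mset_ac.
Qed.

Lemma zip_cat A g1 g2 b :
  zip A (g1 ++ g2) b = zip (LC A g1) g2 b ++ zip A g1 (RC g2 b).
Proof.
elim: g1 A => [|c g1 IHg] A /=; first by rewrite cats0.
by rewrite IHg foldr_cat -catA.
Qed.

(* Takes [A] out of the bottom of a left comb with the help of a root [b], which
   carries the other teeth in the meantime and is recovered at the end. *)
Definition xtr A a g b : seq state :=
  zip (node A a) g b ++ [:: [mset A; a; RC g b]] ++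
  ctx [mset A] (rv [mset LC a g; b] (zip a g b)).

Lemma xtr0 A a b : xtr A a [::] b = zip (node A a) [::] b ++ [:: [mset A; a; b]] ++
  ctx [mset A] (rv [mset a; b] (zip a [::] b)).
Proof. by []. Qed.

(** The upper teeth [d :: g2] leave first and return last, so the extraction along [g1] sits in the
    middle, with the whole upper part packed onto its carrier. *)
Lemma xtr_cat_def A a b d g1 g2 : xtr A a (g1 ++ d :: g2) b =
  zip (LC (node A a) g1) (d :: g2) b ++ xtr A a g1 (RC (d :: g2) b) ++
  ctx [mset A] (rv [mset LC (node (LC a g1) d) g2; b] (zip (LC a g1) (d :: g2) b)).
Proof.
rewrite /xtr !zip_cat foldr_cat foldl_cat rv_cat ctx_cat -!catA.
by rewrite [LC _ (d :: g2)]/= last_zip_cons.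
Qed.

Lemma last_xtr A a g b :
  last [mset LC (node A a) g; b] (xtr A a g b) = [mset A; LC a g; b].
Proof.
rewrite /xtr last_cat /= (_ : [mset A; a; RC g b] = [mset A] `+` [mset a; RC g b]); last by mset_ac.
by rewrite -last_zip last_ctx last_rv; mset_ac.
Qed.

Lemma size_xtr A a g b : size (xtr A a g b) = (4 * size g).+1.
Proof. by rewrite /xtr !size_cat /= size_ctx size_rv !size_zip; lia. Qed.

Lemma walk_xtr A a g b : walk 2 4 [mset LC (node A a) g; b] (xtr A a g b).
Proof.
rewrite /xtr walk_cat (walk_le (walk_zip _ _ _))//= last_zip.
rewrite -[_ :: ctx _ _]cat1s walk_cat; apply/andP; split.
  rewrite /walk !sizeE /= (@sadj_split _ node 2 4 _ _ A a [mset RC g b]) ?sizeE//.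
  mset_ac.
rewrite /= (_ : [mset A; a; RC g b] = [mset A] `+` [mset a; RC g b]); last by mset_ac.
by rewrite -last_zip; apply: walk_ctx (walk_rv (walk_zip _ _ _)) _ _; rewrite sizeE.
Qed.

Definition pack d g b : seq state := zip d g b ++ [:: [mset node d (RC g b)]].

Lemma last_pack d g b : last [mset LC d g; b] (pack d g b) = [mset RC (d :: g) b].
Proof. by rewrite last_cat. Qed.

Lemma size_pack d g b : size (pack d g b) = (2 * size g).+1.
Proof. by rewrite size_cat size_zip /=; lia. Qed.

Lemma walk_pack d g b : walk 1 3 [mset LC d g; b] (pack d g b).
Proof.
rewrite walk_cat (walk_le (walk_zip _ _ _))//= last_zip /walk !sizeE /=.
by rewrite (@sadj_merge _ node 1 3 _ _ d (RC g b) mset0) ?sizeE ?msetD0.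
Qed.

Section Bounds.
Variables (C N : nat).
Hypothesis C12 : 12 <= C.

(** Extracting [A] ends by moving the teeth [g] from the carrier back onto [d], and [pack] begins by
    moving them to the carrier again. Once this backtrack is removed, what remains is the zip. *)
Lemma zip_xtr A d g b : htp (sadj 2 4) C (2 * size g) [mset LC (node A d) g; b]
  (zip A (d :: g) b) (xtr A d g b ++ ctx [mset A] (pack d g b)).
Proof.
have symA := @sadj_sym _ node 2 4.
apply: htp_sym; rewrite /xtr /pack /= ctx_cat -!catA; apply: htp_catl.
  by case/andP: (walk_le (l' := 2) (h' := 4) (walk_zip (node A d) g b) isT isT).
rewrite last_zip cat_cons -[_ :: (ctx _ _ ++ _)]cat1s -[[:: _; _]]cat1s; apply: htp_catl.
  rewrite /= andbT; apply: (@sadj_split _ node 2 4 _ _ A d [mset RC g b]); rewrite ?sizeE//.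
  mset_ac.
have AE : [mset A; d; RC g b] = [mset A] `+` [mset d; RC g b] by mset_ac.
have Ad : sadj 2 4 [mset A; d; RC g b] [mset A; node d (RC g b)].
  by apply: (@sadj_merge _ node 2 4 _ _ d (RC g b) [mset A]); rewrite ?sizeE//; mset_ac.
have -> : [:: [mset A; node d (RC g b)]] = [::] ++ ctx [mset A] [:: [mset node d (RC g b)]] by [].
rewrite catA; apply: htp_catr.
  rewrite -ctx_cat /= AE -last_zip -(size_zip d g b).
  have /andP[_ zp] := walk_zip d g b.
  have K := htp_Krv (@sadj_sym _ node 2 3) (ltac:(lia) : 2 <= C) zp.
  by apply: htp_ctx K _ _; rewrite sizeE.
by rewrite last_cat ctx_cons /= AE last_ctx -(last_zip d) last_rv last_ctx last_zip -AE andbT.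
Qed.

Local Notation sadj := (sadj 3 N).
Local Notation htp := (htp sadj C).
Let symA := @sadj_sym _ node 3 N.

(** Merging two roots of the context [r] commutes with both walks. Conjugating by such merges
    reduces the claim to a context with a single root, at a cost of [size p + size q + 2] for each
    merge. *)
Lemma htp_compress n h x p q : walk 3 h x p -> walk 3 h x q ->
  last x p = last x q ->
  (forall r, size r = 1 -> htp n (r `+` x) (ctx r p) (ctx r q)) ->
  forall r, 0 < size r -> size r + h <= N ->
  htp (n + size r * (size p + size q + 2)) (r `+` x) (ctx r p) (ctx r q).
Proof.
move=> xp xq pq npq r; move: {2}(size r) (leqnn (size r)) => k.
elim: k r => [|k IHk] r rk r0 rN; first by lia.
have [r1|r1] := eqVneq (size r) 1.
  by apply: htp_weak (npq _ r1) _; lia.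
have [a [r' rE]] := mset_neq0_ex r0.
have [|b [r'' r'E]] := @mset_neq0_ex r'; first by move: r1 r0; rewrite rE !sizeE; lia.
pose s := node a b +` r''.
have ss : (size s).+1 = size r by rewrite rE r'E !sizeE; lia.
have rs : walk 0 (size r) r [:: s].
  rewrite /walk leqnn /= (@sadj_merge _ node 0 _ _ _ a b r'')//; rewrite ?rE ?r'E// !sizeE; lia.
have detour p' : walk 3 h x p' ->
    htp (size p').+1 (r `+` x) (ctx r p') ([:: s `+` x] ++ ctx s p' ++ [:: r `+` last x p']).
  move=> xp'; have := @htp_comm _ node C 3 N (ltac:(lia)) _ _ _ _ _ _ _ _ xp' rs (ltac:(lia)) (ltac:(lia)).
  rewrite !ctx_cons /= muln1 => cm.
  have es : sadj (r `+` last x p') (s `+` last x p').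
    have := path_ctx (u := last x p') (l' := 3) (h' := N) rs; rewrite ctx_cons /= andbT.
    rewrite msetDC [_ `+` s]msetDC; apply; have := walk_last xp'; lia.
  apply: (htp_trans_le (m := 1) (n := size p') (q := ctx r p' ++ [:: s `+` last x p'] ++ [:: r `+` last x p'])) => //.
    rewrite -{1}[ctx r p']cats0; apply: htp_catl.
      by apply: path_ctx xp' _ _; lia.
    rewrite last_ctx; apply: htp_small => //=; last by lia.
    by rewrite es symA es.
  rewrite (catA (ctx r p')) (_ : s `+` x :: _ = ([:: s `+` x] ++ ctx s p') ++ [:: r `+` last x p'])//; apply: htp_catr.
    by move: cm; rewrite [x `+` s]msetDC [last x p' `+` s]msetDC [x `+` r]msetDC.
  by rewrite /= last_cat /= symA es.
have IH := IHk s (ltac:(lia)) (ltac:(lia)) (ltac:(lia)).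
apply: (htp_trans_le (detour p xp) (n := n + size s * (size p + size q + 2) + (size q).+1)); last first.
  by rewrite -ss; nia.
apply: htp_trans_le (htp_sym (detour q xq)) _; last by exact: leqnn.
apply: htp_catl.
  have /andP[_] := walk_ctx (u := x) (l' := 3) (h' := N) rs (ltac:(case/andP: xp; lia)) (ltac:(case/andP: xp; lia)).
  by rewrite ctx_cons /= msetDC [x `+` s]msetDC.
rewrite /= pq; apply: htp_catr; first exact: IH.
rewrite last_ctx pq; set y := last x q.
have := path_ctx (u := y) (l' := 3) (h' := N) rs; rewrite ctx_cons /= !andbT.
rewrite [s `+` _]msetDC [r `+` _]msetDC symA; apply; have := walk_last xq; rewrite -/y; lia.
Qed.

(** [F] bounds the cost of exchanging the carrier [b] for the idle root [c]. The margin 7 leaves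
    room for an extraction, of width 4, beside a [pack], of width 3. *)
Definition swap_cost F g := forall A a b c r, size r + 7 <= N ->
  htp F ([mset c] `+` r `+` [mset LC (node A a) g; b])
    (ctx ([mset c] `+` r) (xtr A a g b)) (ctx ([mset b] `+` r) (xtr A a g c)).

(** The middle extraction of [xtr_cat_def] has carrier [RC (d :: g2) b]. Once this is exchanged for
    [c], at cost [F], the upper part of the comb is free: its packing onto [b], split off by
    [zip_xtr], slides across the extraction and cancels. *)
Lemma xtr_cat F A a b c d g1 g2 r : swap_cost F g1 -> size r + 7 <= N ->
  let u := [mset c] `+` r in
  let E1 := LC (node A a) g1 in let E2 := LC a g1 in
  htp (F + 4 * size g2 + (4 * size g1).+1 * (2 * size g2).+1 + (2 * size g2).+1)
    (u `+` [mset LC (node A a) (g1 ++ d :: g2); b])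
    (ctx u (xtr A a (g1 ++ d :: g2) b))
    (ctx u (xtr E1 d g2 b) ++ ctx ([mset LC d g2; b] `+` r) (xtr A a g1 c) ++
     ctx (A +` u) (rv [mset LC (node E2 d) g2; b] (xtr E2 d g2 b))).
Proof.
move=> Hg1 rN u E1 E2; pose R := RC (d :: g2) b.
have us : size u = (size r).+1 by rewrite /u !sizeE.
have z1 := @zip_xtr E1 d g2 b.
have z2 := htp_rv (@sadj_sym _ node 2 4) (@zip_xtr E2 d g2 b).
have s1 : htp (2 * size g2) (u `+` [mset LC (node E1 d) g2; b])
    (ctx u (zip E1 (d :: g2) b)) (ctx u (xtr E1 d g2 b) ++ ctx (u `+` [mset E1]) (pack d g2 b)).
  by rewrite ctxD -ctx_cat; apply: htp_ctx z1 _ _; lia.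
have s2 := Hg1 A a R c r rN.
have s3 : htp (2 * size g2) (A +` u `+` [mset E2; R])
    (ctx (A +` u) (rv [mset LC (node E2 d) g2; b] (zip E2 (d :: g2) b)))
    (ctx (A +` u `+` [mset E2]) (rv [mset LC d g2; b] (pack d g2 b)) ++
     ctx (A +` u) (rv [mset LC (node E2 d) g2; b] (xtr E2 d g2 b))).
  have := htp_ctx (u := A +` u) (l' := 3) (h' := N) z2; rewrite !sizeE.
  rewrite last_zip_cons.
  rewrite rv_cat ctx_cat last_xtr (_ : [mset E2; LC d g2; b] = [mset E2] `+` [mset LC d g2; b]); last by mset_ac.
  rewrite rv_ctx -ctxD; apply; lia.
have s4 : htp ((4 * size g1).+1 * (2 * size g2).+1) (u `+` [mset E1] `+` [mset LC d g2; b])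
    (ctx (u `+` [mset E1]) (pack d g2 b) ++ ctx ([mset R] `+` r) (xtr A a g1 c))
    (ctx ([mset LC d g2; b] `+` r) (xtr A a g1 c) ++ ctx (A +` u `+` [mset E2]) (pack d g2 b)).
  have p1 : walk (size r + 2) (size r + 4) (r `+` [mset E1; c]) (ctx r (xtr A a g1 c)).
    by apply: walk_ctx (walk_xtr _ _ _ _) _ _; lia.
  have := @htp_comm _ node C 3 N ltac:(lia) _ _ _ _ _ _ _ _ p1 (walk_pack d g2 b) ltac:(lia) ltac:(lia).
  rewrite last_ctx last_xtr last_pack -!ctxD size_ctx size_xtr size_pack.
  rewrite (_ : r `+` [mset E1; c] `+` [mset LC d g2; b] = u `+` [mset E1] `+` [mset LC d g2; b]); last by rewrite /u; mset_ac.
  rewrite (_ : r `+` [mset A; LC a g1; c] = A +` u `+` [mset E2]); last by rewrite /u /E2; mset_ac.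
  rewrite (_ : r `+` [mset E1; c] = u `+` [mset E1]); last by rewrite /u; mset_ac.
  exact: htp_sym.
have s5 : htp (2 * size g2).+1 (A +` u `+` [mset E2] `+` [mset LC d g2; b])
    (ctx (A +` u `+` [mset E2]) (pack d g2 b) ++
     ctx (A +` u `+` [mset E2]) (rv [mset LC d g2; b] (pack d g2 b))) [::].
  rewrite -ctx_cat -(size_pack d g2 b).
  have /andP[_ pp] := walk_pack d g2 b.
  have K := htp_rvK (@sadj_sym _ node 1 3) (ltac:(lia) : 2 <= C) pp.
  by apply: htp_ctx K _ _; rewrite !sizeE; lia.
have EA : u `+` [mset E1; R] = last (u `+` [mset LC (node E1 d) g2; b]) (ctx u (zip E1 (d :: g2) b)).
  by rewrite last_ctx last_zip_cons.
have EB : A +` u `+` [mset E2; R] = last (u `+` [mset E1; R]) (ctx u (xtr A a g1 R)).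
  by rewrite last_ctx last_xtr /E2; mset_ac.
have -> : ctx u (xtr A a (g1 ++ d :: g2) b) =
    ctx u (zip E1 (d :: g2) b) ++ ctx u (xtr A a g1 R) ++
    ctx (A +` u) (rv [mset LC (node E2 d) g2; b] (zip E2 (d :: g2) b)).
  by rewrite xtr_cat_def ctx_cat (ctx_cat u (xtr A a g1 _)) -ctxD (msetDC u [mset A]).
have -> : u `+` [mset LC (node A a) (g1 ++ d :: g2); b] = u `+` [mset LC (node E1 d) g2; b].
  by rewrite foldl_cat.
apply: (htp_trans_le (m := 4 * size g2 + F) (n := (4 * size g1).+1 * (2 * size g2).+1 + (2 * size g2).+1) (q := (ctx u (xtr E1 d g2 b) ++ ctx (u `+` [mset E1]) (pack d g2 b)) ++
  ctx ([mset R] `+` r) (xtr A a g1 c) ++ (ctx (A +` u `+` [mset E2]) (rv [mset LC d g2; b] (pack d g2 b)) ++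
     ctx (A +` u) (rv [mset LC (node E2 d) g2; b] (xtr E2 d g2 b))))).
- apply: (htp_cat_le (m := 2 * size g2) (n := F + 2 * size g2)); [exact: s1| |lia].
  rewrite -EA; apply: (htp_cat_le (s2 : htp F (u `+` _) (ctx u _) _) _ (leqnn _)); rewrite -EB; exact: s3.
- have [xp xq _] := htp_path s1.
  rewrite -catA; apply: htp_catl; first by move: xq; rewrite cat_path => /andP[].
  set y := last _ _; have yE : y = u `+` [mset E1] `+` [mset LC d g2; b].
    by rewrite /y last_ctx last_xtr; mset_ac.
  rewrite yE; apply: htp_slide s4 _ _.
    move: s5; rewrite (_ : last _ _ = A +` u `+` [mset E2] `+` [mset LC d g2; b])//.
    rewrite (_ : u `+` [mset E1] `+` [mset LC d g2; b] = ([mset LC d g2; b] `+` r) `+` [mset E1; c]); last by rewrite /u; mset_ac.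
    by rewrite last_ctx last_xtr /u /E2; mset_ac.
  have [_ + _] := htp_path s3; rewrite cat_path => /andP[_].
  rewrite (_ : last _ _ = last (u `+` [mset E1] `+` [mset LC d g2; b]) (ctx ([mset LC d g2; b] `+` r) (xtr A a g1 c)))//.
  rewrite (_ : A +` u `+` [mset E2; R] = A +` u `+` [mset E2] `+` [mset R]); last by mset_ac.
  rewrite -/R -(last_pack d g2 b) last_ctx last_rv.
  rewrite (_ : u `+` [mset E1] `+` [mset LC d g2; b] = ([mset LC d g2; b] `+` r) `+` [mset E1; c]); last by rewrite /u; mset_ac.
  by rewrite last_ctx last_xtr /u /E2; mset_ac.
- lia.
Qed.

Definition swap_small F g := forall A a b c r, size r <= 1 ->
  htp F ([mset c] `+` r `+` [mset LC (node A a) g; b])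
    (ctx ([mset c] `+` r) (xtr A a g b)) (ctx ([mset b] `+` r) (xtr A a g c)).

(** Each level of the recursion in [swap_cat] puts one more root into the context. Compressing
    contexts back to one root keeps [N] independent of the depth of the recursion. *)
Lemma swap_small_cost F g :
  swap_small F g -> swap_cost (F + N * (8 * size g + 4)) g.
Proof.
move=> small A a b c r rN.
have [r1|r1] := leqP (size r) 1; first by apply: htp_weak (small _ _ _ _ _ r1) _; lia.
pose x := [mset c] `+` [mset LC (node A a) g; b].
have xE : x = [mset b] `+` [mset LC (node A a) g; c] by rewrite /x; mset_ac.
pose p := ctx [mset c] (xtr A a g b); pose q := ctx [mset b] (xtr A a g c).
have xp : walk 3 5 x p by apply: walk_ctx (walk_xtr _ _ _ _) _ _; rewrite sizeE.
have xq : walk 3 5 x q by rewrite xE; apply: walk_ctx (walk_xtr _ _ _ _) _ _; rewrite sizeE.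
have pq : last x p = last x q.
  by rewrite /p last_ctx last_xtr xE /q last_ctx last_xtr; mset_ac.
have pq1 r' : size r' = 1 -> htp F (r' `+` x) (ctx r' p) (ctx r' q).
  move=> r'1; have := small A a b c r' (ltac:(lia)).
  rewrite /p /q -!ctxD /x (msetDA _ [mset c]) (msetDC r' [mset c]).
  by rewrite (msetDC r' [mset b]).
have := htp_compress xp xq pq pq1 (r := r) (ltac:(lia)) (ltac:(lia)).
rewrite /p /q -!ctxD /x (msetDA _ [mset c]) (msetDC r [mset c]) (msetDC r [mset b]) !size_ctx !size_xtr.
by move=> h; apply: htp_weak h _; rewrite leq_add2l; nia.
Qed.

(** [xtr_cat] brings both extractions into a form with three shorter ones, whose carriers are
    exchanged separately. This uses five exchanges in all: one in each use of [xtr_cat] and three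
    between the forms. [9] is the margin 7 plus a context of at most two roots. *)
Lemma swap_cat F g1 d g2 : 9 <= N -> swap_cost F g1 -> swap_cost F g2 ->
  swap_small (5 * F + 2 * (4 * size g2 + (4 * size g1).+1 * (2 * size g2).+1 +
    (2 * size g2).+1)) (g1 ++ d :: g2).
Proof.
move=> N9 H1 H2 A a b c r r1.
have X1 := xtr_cat A a b c d g2 H1 (ltac:(lia) : size r + 7 <= N).
have X2 := xtr_cat A a c b d g2 H1 (ltac:(lia) : size r + 7 <= N).
move: X1 X2 => /=; set E1 := LC (node A a) g1; set E2 := LC a g1; set e := LC d g2 => X1 X2.
have SE : [mset b] `+` r `+` [mset LC (node A a) (g1 ++ d :: g2); c] =
  [mset c] `+` r `+` [mset LC (node A a) (g1 ++ d :: g2); b] by mset_ac.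
rewrite SE in X2.
have m1 := H2 E1 d b c r (ltac:(lia)).
have m2 := H1 A a c b ([mset e] `+` r) (ltac:(rewrite !sizeE; lia)).
have m3 := htp_rv symA (H2 E2 d b c ([mset A] `+` r) (ltac:(rewrite !sizeE; lia))).
have EE : [mset c] `+` (A +` r) `+` [mset LC (node E2 d) g2; b] =
   [mset b] `+` (A +` r) `+` [mset LC (node E2 d) g2; c] by mset_ac.
rewrite {3}EE !rv_ctx last_ctx last_xtr in m3.
have e1 : [mset b] `+` ([mset e] `+` r) = [mset e; b] `+` r by mset_ac.
have e2 : [mset c] `+` ([mset e] `+` r) = [mset e; c] `+` r by mset_ac.
have e3 : [mset c] `+` (A +` r) = A +` ([mset c] `+` r) by mset_ac.
have e4 : [mset b] `+` (A +` r) = A +` ([mset b] `+` r) by mset_ac.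
rewrite e1 e2 in m2; rewrite e3 e4 in m3.
have l1 : [mset e; b] `+` r `+` [mset E1; c] =
    last ([mset c] `+` r `+` [mset LC (node E1 d) g2; b]) (ctx ([mset c] `+` r) (xtr E1 d g2 b)).
  by rewrite last_ctx last_xtr -/e; mset_ac.
have l2 : A +` ([mset c] `+` r) `+` [mset E2; LC d g2; b] =
    last ([mset e; b] `+` r `+` [mset E1; c]) (ctx ([mset e; b] `+` r) (xtr A a g1 c)).
  by rewrite last_ctx last_xtr -/E2 -/e; mset_ac.
rewrite -/E1 l1 in m2; rewrite l2 l1 in m3.
have M := htp_cat_le m1 (htp_cat_le m2 m3 (leqnn _)) (leqnn _).
rewrite foldl_cat -/E1 [LC E1 _]/= in X1 X2 *.
apply: (htp_trans_le X1 (htp_trans_le M (htp_sym X2) (leqnn _))); lia.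
Qed.

(** Halving the spine costs five recursive calls plus a quadratic term from the commutations and a
    linear one, with factor [N], from the compression. Since 5 < 2 ^ 3, a cubic bound survives the
    recursion. *)
Lemma swap_cost_pow k g : 9 <= N -> size g < 2 ^ k ->
  swap_cost (20 * N.+1 * (2 ^ k) ^ 3) g.
Proof.
move=> N9; elim: k g => [|k IHk] g.
  rewrite ltnS leqn0 size_eq0 => /eqP -> A a b c r rN.
  have E : [mset c] `+` r `+` [mset A; a; b] = [mset b] `+` r `+` [mset A; a; c] by mset_ac.
  rewrite /xtr /= !ctx_cons E; apply: htp_weak (htp_refl _ _) _ => //=.
  rewrite andbT (@sadj_split _ node _ _ _ _ A a ([mset c] `+` r `+` [mset b])) ?sizeE//; [mset_ac|mset_ac|lia|lia].
have [-> _|g0 gk] := eqVneq g [::].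
  have := IHk [::]; rewrite expn_gt0 => /(_ isT) H A a b c r rN.
  by apply: htp_weak (H A a b c r rN) _; rewrite leq_mul// leq_exp2r// leq_pexp2l.
have [g1 [d [g2 [-> g1k g2k]]]] : exists g1 d g2,
    [/\ g = g1 ++ d :: g2, size g1 < 2 ^ k & size g2 < 2 ^ k].
  case: g g0 gk => // x g _ gk; pose h := (size (x :: g))./2.
  exists (take h (x :: g)), (nth x (x :: g) h), (drop h.+1 (x :: g)).
  have hs : h < size (x :: g) by rewrite /h /=; lia.
  rewrite -drop_nth// cat_take_drop size_drop size_takel; last exact: ltnW.
  by move: gk; rewrite expnS /h /=; split=> //; lia.
have := swap_small_cost (swap_cat d N9 (IHk _ g1k) (IHk _ g2k)).
move=> H A a b c r rN; apply: htp_weak (H A a b c r rN) _.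
rewrite size_cat /= (expnS 2 k); move: g1k g2k; set u := 2 ^ k; clearbody u => g1k g2k.
rewrite expnMn; have -> : 2 ^ 3 = 8 by [].
have -> : u ^ 3 = u * u * u by rewrite !expnS expn0 muln1 mulnA.
have q1 : size g1 * size g2 <= u * u by apply: leq_mul; lia.
have u1 : u <= u * u by apply: leq_pmulr; lia.
have u2 : u * u <= u * u * u by apply: leq_pmulr; lia.
have u3 : N * u <= N * (u * u * u) by apply: leq_mul; lia.
have u4 : N * size g1 <= N * u by apply: leq_mul; lia.
have u5 : N * size g2 <= N * u by apply: leq_mul; lia.
have u6 : N <= N * u by apply: leq_pmulr; lia.
nia.
Qed.

(* The cost of changing the auxiliary root that carries the spine while the
   bottom of the spine is split; divide and conquer makes it polynomial. *)
Definition swapF n := 20 * N.+1 * (2 * n.+1) ^ 3.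

Lemma swap_costP n g : 9 <= N -> size g <= n -> swap_cost (swapF n) g.
Proof.
move=> N9 gn; have k1 := trunc_log_bounds (isT : 1 < 2) (ltn0Sn n).
move=> A a b c r rN; have := @swap_cost_pow (trunc_log 2 n.+1).+1 g N9.
case/andP: k1 => k1 k2; move=> /(_ (leq_ltn_trans gn (ltnW k2))) H.
apply: htp_weak (H A a b c r rN) _.
by rewrite leq_mul// leq_exp2r// (expnS 2) leq_mul.
Qed.

End Bounds.
End Zipper.

(** * Forests of binary trees *)

Section Tree.
Variable L : countType.

Inductive tree := Leaf of L | Node of tree & tree.

Fixpoint tree_encode t : GenTree.tree L := match t with
  | Leaf l => GenTree.Leaf l
  | Node a b => GenTree.Node 0 [:: tree_encode a; tree_encode b]
  end.
Fixpoint tree_decode (t : GenTree.tree L) : option tree := match t with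
  | GenTree.Leaf l => Some (Leaf l)
  | GenTree.Node _ [:: a; b] =>
      obind (fun a => omap (Node a) (tree_decode b)) (tree_decode a)
  | _ => None
  end.
Lemma tree_encodeK : pcancel tree_encode tree_decode.
Proof. by elim=> [l|a IHa b IHb] //=; rewrite IHa IHb. Qed.

HB.instance Definition _ := Countable.copy tree (pcan_type tree_encodeK).

(* Ordering the children by their codes makes [node] commutative. *)
Definition node a b := if (choice.pickle a <= choice.pickle b)%N then Node a b else Node b a.

Lemma nodeC : commutative node.
Proof.
move=> a b; rewrite /node; case: ltngtP => // /eqP.
by rewrite (inj_eq (pcan_inj (@choice.pickleK _))) => /eqP ->.
Qed.

Lemma nodeE a b : node a b = Node a b \/ node a b = Node b a.
Proof. by rewrite /node; case: ifP; auto. Qed.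

Lemma node_inj a b c d : node a b = node c d -> (a = c /\ b = d) \/ (a = d /\ b = c).
Proof. by case: (nodeE a b) (nodeE c d) => -> [] -> []; auto. Qed.

Fixpoint canon t := if t is Node a b then [&& canon a, canon b & (choice.pickle a <= choice.pickle b)%N] else true.

Lemma canon_node a b : canon (node a b) = canon a && canon b.
Proof.
rewrite /node; case: leqP => //= ab; first by rewrite ab andbT.
by rewrite ltnW// andbT andbC.
Qed.

Lemma canon_ind (P : tree -> Prop) : (forall l, P (Leaf l)) ->
  (forall a b, canon a -> canon b -> P a -> P b -> P (node a b)) ->
  forall t, canon t -> P t.
Proof.
move=> Pl Pn; elim=> [l _|a IHa b IHb /= /and3P[ca cb ab]]; first exact: Pl.
by have := Pn a b ca cb (IHa ca) (IHb cb); rewrite /node ab.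
Qed.

Fixpoint leaves t := if t is Node a b then leaves a ++ leaves b else
  if t is Leaf l then [:: l] else [::].

Lemma leaves_node a b : perm_eq (leaves (node a b)) (leaves a ++ leaves b).
Proof. by case: (nodeE a b) => -> //=; rewrite perm_catC. Qed.

Lemma mem_leaves_node l a b :
  (l \in leaves (node a b)) = (l \in leaves a) || (l \in leaves b).
Proof. by rewrite (perm_mem (leaves_node a b)) mem_cat. Qed.

Lemma leaves_neq0 t : 0 < size (leaves t).
Proof. by elim: t => //= a IHa b _; rewrite size_cat ltn_addr. Qed.

Definition onode o1 o2 := match o1, o2 with
  | Some a, Some b => Some (node a b) | None, o => o | o, None => o end.

Lemma onodeC : commutative onode.
Proof. by case=> [a|] [b|] //=; rewrite nodeC. Qed.

Section Del.
Variable l : L.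

Fixpoint del t := match t with
  | Leaf l' => if l' == l then None else Some (Leaf l')
  | Node a b => onode (del a) (del b) end.

Lemma del_node a b : del (node a b) = onode (del a) (del b).
Proof. by case: (nodeE a b) => -> //=; rewrite onodeC. Qed.

Lemma del_id t : canon t -> l \notin leaves t -> del t = Some t.
Proof.
move: t; apply: canon_ind => [l'|a b ca cb IHa IHb] /=.
  by rewrite inE eq_sym => /negbTE ->.
by rewrite mem_leaves_node negb_or => /andP[/IHa ha /IHb hb]; rewrite del_node ha hb.
Qed.

Lemma leaves_del t :
  perm_eq (oapp leaves [::] (del t)) (seq.filter (predC1 l) (leaves t)).
Proof.
elim: t => [l'|a IHa b IHb] /=; first by case: (l' == l).
rewrite filter_cat; have := perm_cat IHa IHb; apply: perm_trans.
by case: (del a) (del b) => [c|] [d|] //=; rewrite ?cats0// leaves_node.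
Qed.

Lemma canon_del t : canon t -> oapp canon true (del t).
Proof.
move: t; apply: canon_ind => [l'|a b ca cb]; first by rewrite /=; case: eqP.
by rewrite del_node; case: (del a) (del b) => [c|] [d|] //= hc hd; rewrite canon_node hc.
Qed.

Fixpoint spine t := if t is Node a b then
  if l \in leaves a then rcons (spine a) b else rcons (spine b) a else [::].

Lemma spine_node a b : l \in leaves a -> l \notin leaves b ->
  spine (node a b) = rcons (spine a) b.
Proof. by move=> la /negbTE lb; case: (nodeE a b) => -> /=; rewrite ?la ?lb. Qed.

(** As [node] is commutative, a tree with a single leaf [l] is a left comb on [l], whichever side
    [l] lies on at each node. Deleting [l] starts the comb at its first tooth. *)
Lemma spineP t : canon t -> count_mem l (leaves t) = 1 ->
  [/\ t = foldl node (Leaf l) (spine t),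
      del t = (if spine t is a :: g then Some (foldl node a g) else None) &
      size (spine t) < size (leaves t)].
Proof.
move: t; apply: canon_ind => [l'|a b ca cb].
  by rewrite /= addn0; case: eqP => // ->.
wlog la : a b ca cb / l \in leaves a.
  move=> W IHa IHb; have [la|nla] := boolP (l \in leaves a); first exact: W.
  have [lb|nlb] := boolP (l \in leaves b); first by rewrite nodeC; exact: W.
  rewrite (seq.permP (leaves_node a b)) count_cat.
  by rewrite (count_memPn nla) (count_memPn nlb).
move=> IHa _; rewrite (seq.permP (leaves_node a b)) count_cat => ab.
have a0 : 0 < count_mem l (leaves a) by rewrite -has_count has_pred1.
have nlb : l \notin leaves b by apply/count_memPn; lia.
have [aE da sa] := IHa (ltac:(lia)).
rewrite spine_node// foldl_rcons -aE; split=> //; last first.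
  rewrite size_rcons (perm_size (leaves_node a b)) size_cat; by have := leq_add sa (leaves_neq0 b); rewrite addn1.
rewrite del_node da (del_id cb nlb); case: (spine a) => //= c g.
by rewrite foldl_rcons.
Qed.

End Del.

(* Pins the choice structure, which unification would otherwise reach
   through several coercion paths. *)
Local Notation treeC := (ltac:(let t := eval unfold reverse_coercion in
  (tree : choiceType) in exact t)) (only parsing).
Local Notation step := (@step treeC node).
Local Notation state := {mset tree}.
Implicit Types (x y u : state).

Lemma perm_msetD (T : choiceType) (A B : {mset T}) : perm_eq (A `+` B) (A ++ B).
Proof. by apply/allP => z _ /=; rewrite count_cat !count_mem_mset msetE2. Qed.

Definition lv x : seq L := flatten [seq leaves t | t <- x].

Lemma lvD x y : perm_eq (lv (x `+` y)) (lv x ++ lv y).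
Proof.
by rewrite /lv -flatten_cat -map_cat; apply/perm_flatten/perm_map/perm_msetD.
Qed.

Lemma lv1 t : lv [mset t] = leaves t.
Proof. by rewrite /lv enum_msetn /= cats0. Qed.

Lemma lv0 : lv mset0 = [::].
Proof. by rewrite /lv enum_mset0. Qed.

Lemma count_lvD P x y : count P (lv (x `+` y)) = count P (lv x) + count P (lv y).
Proof. by rewrite (seq.permP (lvD x y)) count_cat. Qed.

Lemma count_lv_node P a b : count P (lv [mset node a b]) = count P (leaves a) + count P (leaves b).
Proof. by rewrite lv1 (seq.permP (leaves_node a b)) count_cat. Qed.

Lemma mem_lvD l x y : (l \in lv (x `+` y)) = (l \in lv x) || (l \in lv y).
Proof. by rewrite (perm_mem (lvD x y)) mem_cat. Qed.

Lemma mem_lvP l x : reflect (exists2 t, t \in x & l \in leaves t) (l \in lv x).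
Proof. exact: flatten_mapP. Qed.

Lemma size_lvD x y : size (lv (x `+` y)) = size (lv x) + size (lv y).
Proof. by rewrite (perm_size (lvD x y)) size_cat. Qed.

Definition canons x := all canon x.

Lemma canonsD x y : canons (x `+` y) = canons x && canons y.
Proof. by rewrite /canons (perm_all _ (perm_msetD x y)) all_cat. Qed.

Lemma canons1 t : canons [mset t] = canon t.
Proof. by rewrite /canons enum_msetn /= andbT. Qed.

Lemma step_lv x y : step x y -> perm_eq (lv x) (lv y).
Proof.
have H a b u : perm_eq (lv (a +` (b +` u))) (lv (node a b +` u)).
  apply/seq.permP => P; rewrite !count_lvD count_lv_node !lv1; lia.
by case=> [->//|[a [b [u [-> ->]]]]|[a [b [u [-> ->]]]]]; rewrite // perm_sym.
Qed.

Lemma step_canons x y : step x y -> canons x = canons y.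
Proof.
have H a b u : canons (a +` (b +` u)) = canons (node a b +` u).
  by rewrite !canonsD !canons1 canon_node andbA.
by case=> [->//|[a [b [u [-> ->]]]]|[a [b [u [-> ->]]]]].
Qed.

Definition dels l x : state := seq_mset (pmap (del l) x).

Lemma seq_mset_cat (T : choiceType) (s s' : seq T) :
  seq_mset (s ++ s') = seq_mset s `+` seq_mset s'.
Proof. by apply/msetP => a; rewrite msetE2 !mset_seqE count_cat. Qed.

Lemma delsD l x y : dels l (x `+` y) = dels l x `+` dels l y.
Proof.
rewrite /dels -seq_mset_cat -pmap_cat; apply/eq_seq_msetP.
exact/perm_pmap/perm_msetD.
Qed.

Lemma dels1 l t : dels l [mset t] = if del l t is Some t' then [mset t'] else mset0.
Proof.
rewrite /dels enum_msetn /=; case: (del l t) => [t'|] /=; last first.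
  by apply/msetP => z; rewrite mset_seqE mset0E.
by apply/msetP => z; rewrite mset_seqE msetnE /= addn0 eq_sym; case: eqP.
Qed.

Lemma dels0 l : dels l mset0 = mset0.
Proof. by rewrite /dels enum_mset0; apply/msetP => z; rewrite mset_seqE mset0E. Qed.

Lemma mset_ind (T : choiceType) (P : {mset T} -> Prop) :
  P mset0 -> (forall a A, P A -> P (a +` A)) -> forall A, P A.
Proof.
move=> P0 P1 A; move: {2}(size A) (erefl (size A)) => k.
elim: k A => [|k IHk] A Ak.
  by have -> : A = mset0 by apply/eqP; rewrite -size_mset_eq0 Ak.
have [a [A' AE]] := @mset_neq0_ex T A (ltac:(lia)).
by rewrite AE; apply/P1/IHk; move: Ak; rewrite AE !sizeE => -[].
Qed.

Lemma dels_id l x : canons x -> l \notin lv x -> dels l x = x.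
Proof.
elim/mset_ind: x => [|t x IHx]; first by rewrite dels0.
rewrite canonsD canons1 mem_lvD lv1 negb_or => /andP[ct cx] /andP[lt lx].
by rewrite delsD dels1 del_id// IHx.
Qed.

Lemma canons_dels l x : canons x -> canons (dels l x).
Proof.
elim/mset_ind: x => [|t x IHx]; first by rewrite dels0.
rewrite delsD !canonsD canons1 dels1 => /andP[/(canon_del l) ct /IHx ->].
by case: (del l t) ct => [t'|] /=; rewrite ?canons1 ?andbT// => _; rewrite /canons enum_mset0.
Qed.

Lemma lv_dels l x : perm_eq (lv (dels l x)) (seq.filter (predC1 l) (lv x)).
Proof.
elim/mset_ind: x => [|t x IHx]; first by rewrite dels0 lv0.
rewrite delsD (perm_trans (lvD _ _))//.
rewrite perm_sym (perm_trans (perm_filter _ (lvD _ _)))// filter_cat lv1 perm_sym.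
apply: perm_cat => //; rewrite (perm_trans _ (leaves_del l t))// dels1.
by case: (del l t) => [t'|] /=; rewrite ?lv1 ?lv0.
Qed.

Lemma size_dels l x : size (dels l x) <= size x.
Proof.
elim/mset_ind: x => [|t x IHx]; first by rewrite dels0.
rewrite delsD !sizeE dels1; apply: leq_add IHx; case: (del l t) => [t'|]; rewrite !sizeE//.
Qed.

Lemma size_lv x : size x <= size (lv x).
Proof.
elim/mset_ind: x => [|t x IHx]; first by rewrite sizeE.
rewrite !sizeE size_lvD lv1; have := leaves_neq0 t; lia.
Qed.

(** When one of the two merged roots is [Leaf l], the deletion collapses the merge to an equality;
    the reflexive case of [step] absorbs this. *)
Lemma step_dels l x y : step x y -> step (dels l x) (dels l y).
Proof.
have H a b u : step (dels l (a +` (b +` u))) (dels l (node a b +` u)).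
  rewrite !delsD !dels1 del_node; case: (del l a) (del l b) => [a'|] [b'|] /=.
  - by apply: Or32; exists a', b', (dels l u).
  - by apply: Or31; rewrite mset0D.
  - by apply: Or31; rewrite mset0D.
  - by apply: Or31; rewrite mset0D.
by case=> [->|[a [b [u [-> ->]]]]|[a [b [u [-> ->]]]]]; [exact: Or31|exact: H|exact/step_sym/H].
Qed.

End Tree.

(** * Loops of states are filled polynomially *)

Section Peeling.
Variables (L : countType) (C N : nat).
Local Notation tree := (tree L).
Local Notation state := {mset tree}.
Implicit Types (x y z u : state) (l : L) (t : tree).
Local Notation treeC := (ltac:(let t := eval unfold reverse_coercion in
  (tree : choiceType) in exact t)) (only parsing).
Local Notation node := (@node L).
Local Notation sadj := (@sadj treeC node 3 N).
Local Notation htp := (htp sadj C).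
Local Notation walk := (@walk treeC node).
Local Notation xtr := (@xtr treeC node).
Let symA := @sadj_sym treeC node 3 N.

Definition extract l t b : seq state :=
  if spine l t is a :: g then xtr (Leaf l) a g b else [::].

Lemma walk_extract l t b : canon t -> count_mem l (leaves t) = 1 ->
  walk 2 4 [mset t; b] (extract l t b) /\
  last [mset t; b] (extract l t b) = [mset Leaf l; b] `+` dels l [mset t].
Proof.
move=> ct lt; have [tE dE _] := spineP ct lt; rewrite /extract dels1 dE.
case sp: (spine l t) => [|a g]; rewrite sp /= in tE.
  by rewrite tE /walk !sizeE msetD0.
by rewrite tE walk_xtr last_xtr; split=> //; mset_ac.
Qed.

Lemma size_extract l t b : canon t -> count_mem l (leaves t) = 1 ->
  (size (extract l t b) <= 4 * size (leaves t))%N.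
Proof.
move=> ct lt; have [_ _] := spineP ct lt; rewrite /extract.
case: (spine l t) => //= a g h; rewrite size_xtr; apply: leq_trans (leq_mul (leqnn 4) h).
by set k := size g; slia.
Qed.

(* [p] makes the leaf [l] of [x] a root of its own. *)
Definition peeling l x p := exists t b u,
  [/\ x = u `+` [mset t; b], count_mem l (leaves t) = 1, l \notin lv (u `+` [mset b]) &
      p = ctx u (extract l t b)].

Lemma peeling_ex l x : count_mem l (lv x) = 1 -> 1 < size x ->
  exists p, peeling l x p.
Proof.
move=> lx x1; have /mem_lvP[t tx lt] : l \in lv x by rewrite -has_pred1 has_count lx.
have xE := msetB1K tx; have [|b [u uE]] := @mset_neq0_ex _ (x `\ t).
  by move: x1; rewrite -{1}xE !sizeE.
have tE : x = u `+` [mset t; b] by rewrite -xE uE; mset_ac.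
have lt0 : 0 < count_mem l (leaves t) by rewrite -has_count has_pred1.
have lE : count_mem l (lv x) = count_mem l (lv (u `+` [mset b])) + count_mem l (leaves t).
  by rewrite tE (_ : u `+` _ = u `+` [mset b] `+` [mset t]); [rewrite count_lvD lv1|mset_ac].
exists (ctx u (extract l t b)), t, b, u; split=> //; first by slia.
by apply/count_memPn; slia.
Qed.

Lemma peeling_walk l x p : peeling l x p -> canons x -> 3 <= size x -> size x + 2 <= N ->
  [/\ walk 3 N x p, last x p = Leaf l +` dels l x & (size p <= 4 * size (lv x))%N].
Proof.
move=> [t [b [u [-> lt lub ->]]]] cx x3 xN.
have [cu ct cb] : [/\ canons u, canon t & canon b].
  by move: cx; rewrite !canonsD !canons1 => /and3P[].
have [w lw] := walk_extract b ct lt.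
rewrite !sizeE in x3 xN; split.
- by apply: walk_ctx w _ _; slia.
- rewrite last_ctx lw !delsD [dels l u]dels_id//; last first.
    by move: lub; rewrite mem_lvD negb_or => /andP[].
  rewrite [dels l [mset b]]dels_id ?canons1//; last first.
    by move: lub; rewrite mem_lvD negb_or => /andP[].
  mset_ac.
- rewrite size_ctx; apply: leq_trans (size_extract b ct lt) _.
  by rewrite leq_mul2l /= !size_lvD !lv1 addnA [in leqRHS]addnC addnA leq_addl.
Qed.

Hypotheses (C12 : 12 <= C) (N9 : 9 <= N).

(** The tree that contains [l] is determined by [x], so two peelings can differ only in the carrier,
    and [swap_costP] exchanges it. *)
Lemma peeling_uniq n l x p q : peeling l x p -> peeling l x q ->
  canons x -> 3 <= size x -> size x + 4 <= N -> (size (lv x) <= n)%N ->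
  htp (swapF N n) x p q.
Proof.
move=> + + cx x3 xN xn; have {}xn : (size (lv x) <= n)%N := xn.
move=> xp; have [/andP[_ pP] _ _] := peeling_walk xp cx x3 (ltac:(slia)).
case: xp pP => t [b [u [xE lt lub ->]]] pP [t' [b' [u' [xE' lt' lub' ->]]]].
have tt' : t = t'.
  have : t' \in x by rewrite xE' in_msetD in_mset2 eqxx orbT.
  rewrite xE in_msetD in_mset2 => /or3P[tu|/eqP//|/eqP tb].
  - case/negP: lub; rewrite mem_lvD; apply/orP; left; apply/mem_lvP; exists t' => //.
    by rewrite -has_pred1 has_count lt'.
  - case/negP: lub; rewrite mem_lvD lv1 -tb; apply/orP; right.
    by rewrite -has_pred1 has_count lt'.
rewrite -{}tt' in xE' lt' *; clear t'.
have E : u `+` [mset b] = u' `+` [mset b'].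
  have := xE; rewrite xE' => /msetP H; apply/msetP => z; have := H z; rewrite !msetE2; slia.
have [bb|bb] := eqVneq b b'.
  move: E; rewrite -bb => /(congr1 (msetB^~ [mset b])); rewrite !msetDKBC => <-.
  exact: htp_weak (htp_refl _ pP) _.
have b'u : b' \in u.
  have : b' \in u `+` [mset b] by rewrite E in_msetD in_mset1 eqxx orbT.
  by rewrite in_msetD in_mset1 eq_sym (negbTE bb) orbF.
pose r := u `\ b'; have uE : u = [mset b'] `+` r by rewrite msetB1K.
have u'E : u' = [mset b] `+` r.
  by move/msetP: E => H; apply/msetP => z; have := H z; rewrite uE !msetE2; slia.
have ct : canon t by move: cx; rewrite xE !canonsD !canons1 => /and3P[].
have [tE _ st] := spineP ct lt.
rewrite xE u'E uE in pP *; rewrite /extract in pP *.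
case sp: (spine l t) => [|a g] in tE st pP *; first exact: htp_weak (@htp_refl _ _ C _ [::] isT) _.
rewrite tE; apply: swap_costP => //.
  apply: leq_trans xn; rewrite xE !size_lvD !lv1.
  apply: (@leq_trans (size (leaves t))); first by apply: ltnW; apply: leq_trans st; rewrite ltnS.
  by rewrite addnA [in leqRHS]addnC addnA leq_addl.
by move: xN; rewrite xE uE !sizeE; slia.
Qed.

End Peeling.

(** * Compatibility of extraction with a merge at the top of the spine *)

Section SpineSquare.
Variables (T : choiceType) (node : T -> T -> T) (C N : nat).
Hypotheses (C12 : 12 <= C) (N9 : 9 <= N).
Local Notation state := {mset T}.
Implicit Types (x y z u v : state) (p q : seq state) (a b c d s : T) (g : seq T).
Local Notation sadj := (sadj node 3 N).
Local Notation htp := (htp sadj C).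
Local Notation walk := (walk node).
Local Notation xtr := (xtr node).
Let symA := @sadj_sym _ node 3 N.

Lemma xtr_merge_leaf l s b c v : size v + 5 <= N ->
  htp 2 (v `+` [mset l; s; b; c]) [:: [mset l; s] `+` (v `+` [mset b; c])]
    ((node l s +` (v `+` [mset b; c])) :: ctx (v `+` [mset c]) (xtr l s [::] b)).
Proof.
move=> vN; set X := v `+` [mset l; s; b; c]; set X' := node l s +` _.
have XX' : sadj X X' by apply: (@sadj_merge _ node _ _ _ _ l s (v `+` [mset b; c])); rewrite ?sizeE//; [rewrite /X; mset_ac|lia|lia].
have XX : htp 1 X [:: X'; X] [::] by apply: htp_small => //=; [rewrite XX' symA XX'|lia].
have -> : ctx (v `+` [mset c]) (xtr l s [::] b) = [:: X].
  by rewrite xtr0 /= ctx_cons /X; congr (_ :: _); mset_ac.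
rewrite (_ : [mset l; s] `+` _ = X); last by rewrite /X; mset_ac.
apply: htp_sym (htp_trans XX (htp_small _ _ _ _)) => //=; last by lia.
by rewrite andbT sadjxx//; case/and3P: XX'.
Qed.

Lemma xtr_merge n l a g s b c v : size g <= n -> size v + 10 <= N ->
  let r := foldl node (node l a) g in let R2 := foldl node a g in
  htp (2 * swapF N n + 4 * n + 4) (v `+` [mset r; s; b; c])
    (ctx (v `+` [mset s; c]) (xtr l a g b) ++
      [:: [mset l; node R2 s] `+` (v `+` [mset b; c])])
    ((node r s +` (v `+` [mset b; c])) ::
      ctx (v `+` [mset c]) (xtr l a (rcons g s) b)).
Proof.
move=> gn vN r R2.
set X := v `+` [mset r; s; b; c]; set X' := node r s +` _.
have XX' : sadj X X' by apply: (@sadj_merge _ node _ _ _ _ r s (v `+` [mset b; c])); rewrite ?sizeE//; [rewrite /X; mset_ac|lia|lia].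
have XX : htp 1 X [:: X'; X] [::] by apply: htp_small => //=; [rewrite XX' symA XX'|lia].
set sb := node s b.
set Y := [mset l; node R2 s] `+` _.
pose W := [mset r; sb] `+` (v `+` [mset c]).
pose W2 := [mset l; R2; sb] `+` (v `+` [mset c]).
pose Z := [mset l; R2; s; b] `+` (v `+` [mset c]).
have -> : ctx (v `+` [mset c]) (xtr l a (rcons g s) b) =
    [:: X; W] ++ ctx (v `+` [mset c]) (xtr l a g sb) ++ [:: Z; Y].
  rewrite -cats1 xtr_cat_def /= -/r -/R2 -/sb /rv /= !ctx_cons.
  rewrite ctx_cat !ctx_cons (_ : _ `+` [mset r; s; b] = X); last by rewrite /X; mset_ac.
  rewrite (_ : _ `+` [mset r; sb] = W); last by rewrite /W; mset_ac.
  rewrite (_ : _ `+` (_ `+` [mset R2; s; b]) = Z); last by rewrite /Z; mset_ac.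
  by rewrite (_ : _ `+` (_ `+` [mset node R2 s; b]) = Y)//; rewrite /Y; mset_ac.
pose Vs := xtr l a g sb; pose Vb := xtr l a g b; pose Vc := xtr l a g c.
have SC := @swap_costP _ node C N C12 n g N9 gn.
have s1 := SC l a sb c v (ltac:(lia)).
have s2 := SC l a b c ([mset s] `+` v) (ltac:(rewrite !sizeE; lia)).
rewrite -/Vs -/Vb -/Vc in s1 s2.
have w0 := @walk_xtr _ node l a g c.
have w1 : walk (size v + 2) (size v + 4) (v `+` [mset foldl node (node l a) g; c]) (ctx v Vc).
  by apply: walk_ctx w0 _ _; lia.
have w2 : walk 1 2 [mset s; b] [:: [mset sb]].
  rewrite walkE !sizeE /= andbT.
  by rewrite (@sadj_merge _ node _ _ _ _ s b mset0) ?sizeE// !msetD0.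
have s3 := @htp_comm _ node C 3 N (ltac:(lia)) _ _ _ _ _ _ _ _ w1 w2 (ltac:(lia)) (ltac:(lia)).
rewrite last_ctx last_xtr -!ctxD size_ctx size_xtr muln1 !ctx_cons /= -/r -/R2 in s3.
rewrite -/r in s1 s2.
rewrite (_ : c +` v `+` [mset r; sb] = W) in s1; last by rewrite /W; mset_ac.
rewrite (_ : c +` (s +` v) `+` [mset r; b] = X) in s2; last by rewrite /X; mset_ac.
rewrite (_ : v `+` [mset r; c] `+` [mset s; b] = X) in s3; last by rewrite /X; mset_ac.
rewrite (_ : v `+` [mset r; c] `+` [mset sb] = W) in s3; last by rewrite /W; mset_ac.
rewrite (_ : v `+` [mset l; R2; c] `+` [mset sb] = W2) in s3; last by rewrite /W2; mset_ac.
rewrite (_ : c +` (s +` v) = v `+` [mset s; c]) in s2; last by mset_ac.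
rewrite (_ : b +` (s +` v) = [mset s; b] `+` v) in s2; last by mset_ac.
rewrite (msetDC [mset c] v) in s1.
have [p3 p4 l34] := htp_path s3; have [p1 p2 l12] := htp_path s1.
have lc : last W (ctx (sb +` v) Vc) = W2.
  rewrite (_ : W = sb +` v `+` [mset r; c]); last by rewrite /W; mset_ac.
  by rewrite last_ctx last_xtr /W2 /R2; mset_ac.
have lX : last X (ctx ([mset s; b] `+` v) Vc) = Z.
  rewrite (_ : X = [mset s; b] `+` v `+` [mset r; c]); last by rewrite /X; mset_ac.
  by rewrite last_ctx last_xtr /Z /R2; mset_ac.
have WZ : sadj W2 Z.
  by apply: (@sadj_split _ node _ _ _ _ s b ([mset l; R2] `+` (v `+` [mset c]))); rewrite ?sizeE; [rewrite /W2 /sb; mset_ac|rewrite /Z; mset_ac|clear; lia|clear -vN; lia].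
have ZY : sadj Z Y.
  by apply: (@sadj_merge _ node _ _ _ _ R2 s ([mset l] `+` (v `+` [mset b; c]))); rewrite ?sizeE; [rewrite /Z; mset_ac|rewrite /Y; mset_ac|clear; lia|clear -vN; lia].
have YP : path sadj W2 [:: Z; Y] by rewrite /= WZ ZY.
apply: htp_sym.
apply: (htp_trans_le (m := 1) (n := 2 * swapF N n + (4 * size g).+1 + 1)
  (q := W :: ctx (v `+` [mset c]) Vs ++ [:: Z; Y])); last first.
- by clear -gn; lia.
- apply: (htp_trans_le (m := swapF N n) (n := swapF N n + (4 * size g).+1 + 1)
    (q := (W :: ctx (sb +` v) Vc) ++ [:: Z; Y])); last by clear; lia.
    apply: (htp_catl (p := [:: W]) (r := ctx (v `+` [mset c]) Vs ++ [:: Z; Y]) (s := ctx (sb +` v) Vc ++ [:: Z; Y])); first by move: p4; rewrite /= andbT => /andP[].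
    by apply: htp_catr s1 _; rewrite l12 /= lc.
  apply: (htp_trans_le (m := (4 * size g).+1) (n := swapF N n + 1)
    (q := (ctx ([mset s; b] `+` v) Vc ++ [:: W2]) ++ [:: Z; Y])); last by clear; lia.
    apply: htp_catr (htp_sym s3) _; by rewrite /= lc WZ ZY.
  rewrite -catA addnC; apply: (htp_trans_le (m := 1) (q := ctx ([mset s; b] `+` v) Vc ++ [:: Y])) (leqnn _).
    apply: htp_catl; first by move: p3; rewrite cat_path => /andP[].
    have lz : sadj Z W2 by move: p3; rewrite cat_path lX /= andbT => /andP[].
    by rewrite lX; apply: htp_small => //=; [rewrite lz WZ ZY|rewrite ZY|clear -C12; lia].
  by apply: htp_catr (htp_sym s2) _; rewrite lX /= ZY.
- apply: (htp_catr (p := [:: X'; X]) (q := [::])); first exact: XX.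
  by move: p4 p1; rewrite /= => /andP[-> _]; rewrite cat_path => ->; rewrite l12 lc.
Qed.

End SpineSquare.

Section Square.
Variables (L : countType) (C N : nat).
Hypotheses (C12 : 12 <= C) (N9 : 9 <= N).
Local Notation tree := (tree L).
Local Notation state := {mset tree}.
Implicit Types (x y z u v : state) (l : L) (r s t b : tree).
Local Notation treeC := (ltac:(let t := eval unfold reverse_coercion in
  (tree : choiceType) in exact t)) (only parsing).
Local Notation node := (@node L).
Local Notation sadj := (@sadj treeC node 3 N).
Local Notation htp := (htp sadj C).
Local Notation walk := (@walk treeC node).
Local Notation xtr := (@xtr treeC node).
Let symA := @sadj_sym treeC node 3 N.

Definition squareF n := 4 * swapF N n + 4 * n + 4.

Lemma peeling_count l x p : peeling l x p -> count_mem l (lv x) = 1.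
Proof.
move=> [t [b [u [-> lt lub _]]]].
rewrite (_ : u `+` _ = u `+` [mset b] `+` [mset t]); last by mset_ac.
by rewrite count_lvD lv1 lt (count_memPn lub).
Qed.

Lemma square_aside n l r s t b v : canon t -> count_mem l (leaves t) = 1 ->
  (size (leaves t) <= n)%N -> size v + 8 <= N ->
  htp (4 * n) (v `+` [mset r; s] `+` [mset t; b])
    (ctx (v `+` [mset r; s]) (extract l t b) ++
      [:: [mset Leaf l] `+` dels l [mset t] `+` (v `+` [mset node r s; b])])
    ((v `+` [mset node r s] `+` [mset t; b]) ::
      ctx (v `+` [mset node r s]) (extract l t b)).
Proof.
move=> ct lt tn vN; have [w lw] := walk_extract b ct lt.
have q : walk 1 2 [mset r; s] [:: [mset node r s]].
  rewrite walkE !sizeE /= andbT.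
  by rewrite (@sadj_merge treeC node _ _ _ _ r s mset0) ?sizeE// !msetD0.
have p1 : walk (size v + 2) (size v + 4) (v `+` [mset t; b]) (ctx v (extract l t b)).
  by apply: walk_ctx w _ _; slia.
have := @htp_comm treeC node C 3 N (ltac:(lia)) _ _ _ _ _ _ _ _ p1 q (ltac:(lia)) (ltac:(lia)).
rewrite last_ctx lw -!ctxD size_ctx muln1 !ctx_cons /=.
rewrite (_ : v `+` [mset t; b] `+` [mset r; s] = v `+` [mset r; s] `+` [mset t; b]); last by mset_ac.
rewrite (msetDC [mset r; s]) (msetDC [mset node r s] v).
rewrite (_ : v `+` [mset t; b] `+` [mset node r s] = v `+` [mset node r s] `+` [mset t; b]); last by mset_ac.
rewrite (_ : v `+` _ `+` [mset node r s] = [mset Leaf l] `+` dels l [mset t] `+` (v `+` [mset node r s; b])); last by mset_ac.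
move=> h; apply: htp_weak h _; apply: leq_trans (size_extract b ct lt) _.
by rewrite leq_mul2l.
Qed.

Lemma square_spine n l r s b c v :
  canon r -> canon s -> count_mem l (leaves r) = 1 ->
  l \notin leaves s -> (size (leaves r) <= n)%N -> size v + 10 <= N ->
  htp (2 * swapF N n + 4 * n + 4) (v `+` [mset r; s; b; c])
    (ctx (v `+` [mset s; c]) (extract l r b) ++
      [:: [mset Leaf l] `+` dels l [mset node r s] `+` (v `+` [mset b; c])])
    ((node r s +` (v `+` [mset b; c])) ::
      ctx (v `+` [mset c]) (extract l (node r s) b)).
Proof.
move=> cr cs lr ls rn vN; have [rE dE sr] := spineP cr lr.
have lr' : l \in leaves r by rewrite -has_pred1 has_count lr.
rewrite /extract spine_node// dels1 del_node dE del_id//=.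
case sp: (spine l r) => [|a g] /=; rewrite sp /= in rE sr.
  rewrite rE. apply: htp_weak.
    apply: xtr_merge_leaf => //; first lia. by clear -vN; slia.
rewrite rE; apply: xtr_merge => //.
by apply: leq_trans rn; apply: ltnW; apply: leq_trans sr.
Qed.

(** Peelings are unique up to cost [swapF], so it suffices to fill the square for one convenient
    choice of both; the change of choice adds two terms [swapF] to the two of [square_spine]. *)
Lemma square_core n l r s u p p' (x := r +` (s +` u)) (x' := node r s +` u) :
  peeling l x p -> peeling l x' p' -> canons x -> 3 <= size x' ->
  size x' + 9 <= N -> (size (lv x) <= n)%N ->
  (exists p0 p0', [/\ peeling l x p0, peeling l x' p0' &
     htp (2 * swapF N n + 4 * n + 4) x (p0 ++ [:: Leaf l +` dels l x']) (x' :: p0')]) ->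
  htp (squareF n) x (p ++ [:: Leaf l +` dels l x']) (x' :: p').
Proof.
move=> xp xp' cx s3 sN xn [p0 [p0' [xp0 xp0' h]]].
have st : step node x x' by apply: Or32; exists r, s, u.
have cx' : canons x' by rewrite -(step_canons st).
have x'n : (size (lv x') <= n)%N by rewrite -(perm_size (step_lv st)).
have sx : size x = (size x').+1 by rewrite /x /x' !sizeE; lia.
have u1 := peeling_uniq C12 N9 xp xp0 cx (ltac:(lia)) (ltac:(lia)) xn.
have u2 := peeling_uniq C12 N9 xp0' xp' cx' (ltac:(lia)) (ltac:(lia)) x'n.
have [h1 h2 h3] := htp_path h.
rewrite /squareF (_ : 4 * swapF N n + 4 * n + 4 = swapF N n + (2 * swapF N n + 4 * n + 4 + swapF N n)); last by clear; slia.
apply: (htp_trans (htp_catr u1 _)); last apply: (htp_trans h).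
  have [_ _ ->] := htp_path u1; by move: h1; rewrite cat_path => /andP[].
apply: (htp_catl (p := [:: x'])) => //.
by move: h2; rewrite /= => /andP[->].
Qed.

Lemma square_merge n l r s u p p' (x := r +` (s +` u)) (x' := node r s +` u) :
  peeling l x p -> peeling l x' p' -> canons x -> 3 <= size x' ->
  size x' + 9 <= N -> (size (lv x) <= n)%N ->
  htp (squareF n) x (p ++ [:: Leaf l +` dels l x']) (x' :: p').
Proof.
wlog ls : r s @x @x' / l \notin leaves s.
  move=> W; have [ls|] := boolP (l \in leaves s); last exact: W.
  have [lr|nlr] := boolP (l \in leaves r); last first.
    rewrite /x /x' nodeC (_ : r +` (s +` u) = s +` (r +` u)); last by mset_ac.
    exact: W.
  move=> /peeling_count; rewrite !count_lvD !lv1 => xl.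
  have a1 : 0 < count_mem l (leaves s) by rewrite -has_count has_pred1.
  have a2 : 0 < count_mem l (leaves r) by rewrite -has_count has_pred1.
  by exfalso; clear -xl a1 a2; slia.
move=> xp xp' cx s3 sN xn; have := peeling_count xp.
rewrite !count_lvD !lv1 (count_memPn ls) add0n => xl.
have [cr cs cu] : [/\ canon r, canon s & canons u].
  by move: cx; rewrite !canonsD !canons1 => /and3P[].
(* Three roots in [x'] leave two outside the merge. When [l] lies in [r], [t0] is the carrier and
   [t1] the neutral root that [square_spine] requires. *)
have [|t0 [u1 uE]] := @mset_neq0_ex _ u; first by move: s3; rewrite /x' !sizeE; clear; slia.
have [|t1 [u2 u1E]] := @mset_neq0_ex _ u1; first by move: s3; rewrite /x' uE !sizeE; clear; slia.
have [lr|nlr] := boolP (l \in leaves r).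
- have a1 : 0 < count_mem l (leaves r) by rewrite -has_count has_pred1.
  have lr1 : count_mem l (leaves r) = 1 by clear -xl a1; slia.
  have lu : l \notin lv u by apply/count_memPn; clear -xl a1; slia.
  have lu3 : (l \notin leaves t0) /\ (l \notin leaves t1) /\ (l \notin lv u2).
    by move: lu; rewrite uE u1E !mem_lvD !lv1 !negb_or => /and3P[].
  have {}lu3 := lu3; case: lu3 => lt0 [lt1 lu2].
  apply: square_core => //.
  exists (ctx (u2 `+` [mset s; t1]) (extract l r t0)), (ctx (u2 `+` [mset t1]) (extract l (node r s) t0)); split.
  + exists r, t0, (u2 `+` [mset s; t1]); split=> //.
      by rewrite /x uE u1E; mset_ac.
    by rewrite !mem_lvD !lv1 !negb_or lu2 ls lt1 lt0.
  + exists (node r s), t0, (u2 `+` [mset t1]); split=> //.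
    * by rewrite /x' uE u1E; mset_ac.
    * by rewrite (seq.permP (leaves_node r s)) count_cat lr1 (count_memPn ls).
    by rewrite !mem_lvD !lv1 !negb_or lu2 lt1 lt0.
  + have := @square_spine n l r s t0 t1 u2 cr cs lr1 ls _ _.
    rewrite /x' delsD (@dels_id _ l u)//.
    rewrite (_ : Leaf l +` (_ `+` _) = [mset Leaf l] `+` dels l [mset node r s] `+` (u2 `+` [mset t0; t1])); last by rewrite uE u1E; mset_ac.
    rewrite (_ : r +` (s +` u) = u2 `+` [mset r; s; t0; t1]); last by rewrite uE u1E; mset_ac.
    rewrite (_ : node r s +` u = node r s +` (u2 `+` [mset t0; t1])); last by rewrite uE u1E; mset_ac.
    apply.
      by apply: leq_trans xn; rewrite !size_lvD lv1 leq_addr.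
    by move: sN; rewrite /x' uE u1E !sizeE; clear; slia.
- have lu : count_mem l (lv u) = 1 by rewrite (count_memPn nlr) in xl; clear -xl; slia.
  have [t tu lt] : exists2 t, t \in u & l \in leaves t.
    by apply/mem_lvP; rewrite -has_pred1 has_count lu.
  have uE' := msetB1K tu; set u' := u `\ t in uE'.
  have [|b [v u'E]] := @mset_neq0_ex _ u'; first by move: s3; rewrite /x' -uE' !sizeE; clear; slia.
  have a1 : 0 < count_mem l (leaves t) by rewrite -has_count has_pred1.
  have := lu; rewrite -uE' u'E !count_lvD !lv1 => lu1.
  have lt1 : count_mem l (leaves t) = 1 by clear -lu1 a1; slia.
  have lb : l \notin leaves b by apply/count_memPn; clear -lu1 a1; slia.
  have lvv : l \notin lv v by apply/count_memPn; clear -lu1 a1; slia.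
  have [ct cb cv] : [/\ canon t, canon b & canons v].
    by move: cu; rewrite -uE' u'E !canonsD !canons1 => /and3P[].
  have xE : x = v `+` [mset r; s] `+` [mset t; b] by rewrite /x -uE' u'E; mset_ac.
  have x'E : x' = v `+` [mset node r s] `+` [mset t; b] by rewrite /x' -uE' u'E; mset_ac.
  apply: square_core => //.
  exists (ctx (v `+` [mset r; s]) (extract l t b)), (ctx (v `+` [mset node r s]) (extract l t b)).
  split.
  + exists t, b, (v `+` [mset r; s]); split=> //.
    by rewrite !mem_lvD !lv1 !negb_or lvv nlr ls lb.
  + exists t, b, (v `+` [mset node r s]); split=> //.
    by rewrite !mem_lvD !lv1 mem_leaves_node !negb_or lvv nlr ls lb.
  + rewrite -/x' -/x x'E !delsD (@dels_id _ l v)// (@dels_id _ l [mset b]) ?canons1 ?lv1//.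
    rewrite (@dels_id _ l [mset node r s]) ?canons1 ?lv1 ?canon_node ?cr// ?mem_leaves_node ?negb_or ?nlr//.
    rewrite xE (_ : Leaf l +` _ = [mset Leaf l] `+` dels l [mset t] `+` (v `+` [mset node r s; b])); last by mset_ac.
    apply: htp_weak; first apply: (@square_aside n l r s t b v) => //.
    * apply: leq_trans xn; rewrite -/x xE !size_lvD !lv1.
      by rewrite addnA [X in (_ <= X)%N]addnC addnA leq_addl.
    * by move: sN; rewrite x'E !sizeE; clear; slia.
    * by rewrite -addnA addnCA leq_addr.
Qed.

End Square.

(** * Pushing a loop across the deletion of one leaf *)

Section Loops.
Variables (L : countType) (C N : nat).
Hypotheses (C12 : 12 <= C) (N9 : 9 <= N).
Local Notation tree := (tree L).
Local Notation state := {mset tree}.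
Implicit Types (x y z u v : state) (l : L) (r s t b : tree) (p q : seq state).
Local Notation treeC := (ltac:(let t := eval unfold reverse_coercion in
  (tree : choiceType) in exact t)) (only parsing).
Local Notation node := (@node L).
Local Notation sadj := (@sadj treeC node).
Local Notation htp := (htp (sadj 3 N) C).
Local Notation walk := (@walk treeC node).
Let symA := @sadj_sym treeC node 3 N.

Definition drop_leaf l z : state := Leaf l +` dels l z.

Lemma sadj_le k h k' h' x y : sadj k h x y -> k' <= k -> h <= h' -> sadj k' h' x y.
Proof.
move=> /and3P[xs ys xy] ll hh; apply/and3P; split=> //; clear -xs ys ll hh; slia.
Qed.

Lemma square n M l x x' p p' : sadj 3 M x x' ->
  peeling l x p -> peeling l x' p' -> canons x -> M + 9 <= N ->
  (size (lv x) <= n)%N ->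
  htp (squareF N n + 2) x (p ++ [:: drop_leaf l x']) (x' :: p').
Proof.
move=> xx' xp xp' cx MN xn.
have xx'N : sadj 3 N x x' by apply: sadj_le xx' _ _; slia.
have /and3P[xs x's /asboolP st] := xx'.
have cx' : canons x' by rewrite -(step_canons st).
have x'n : (size (lv x') <= n)%N by rewrite -(perm_size (step_lv st)).
have [x3 x2 x4] : [/\ 3 <= size x, size x + 2 <= N & size x + 4 <= N] by split; slia.
have [x'3 x'2] : 3 <= size x' /\ size x' + 2 <= N by split; slia.
have [/andP[_ wp] lp _] := peeling_walk xp cx x3 x2.
have [w'p lp' _] := peeling_walk xp' cx' x'3 x'2.
have {w'p} /andP[_ wp'] := w'p.
have swapsq : swapF N n <= squareF N n by rewrite /squareF; clear; slia.
case: st => [xE|[r [s [u [xE x'E]]]]|[r [s [u [x'E xE]]]]].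
- rewrite -{}xE in xp' lp' wp' xx'N *.
  have u1 := peeling_uniq C12 N9 xp xp' cx x3 x4 xn.
  apply: (htp_trans_le (m := 1) (n := swapF N n + 1) (q := p)); last by clear -swapsq; slia.
    rewrite -{2}[p]cats0; apply: htp_catl => //; rewrite lp.
    have Yx : sadj 3 N (drop_leaf l x) (drop_leaf l x).
      have [/walk_last + _ _] := peeling_walk xp cx x3 x2.
      by rewrite lp; exact: sadjxx.
    by apply: htp_small => //=; [rewrite Yx|slia].
  apply: htp_trans u1 _; rewrite -cat1s -{1}[p']cat0s; apply: htp_catr => //.
  by apply: htp_small => //=; [rewrite xx'N|slia].
- rewrite xE x'E in xp xp' cx xn xs x's *.
  by apply: htp_weak (square_merge C12 N9 xp xp' cx _ _ xn) _; clear -x's MN; slia.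
(* A split is a merge read backwards: the square of the merge from [x'] to [x] is flanked by
   backtracks along its two horizontal sides, which account for the additional 2. *)
have h : htp (squareF N n) x' (p' ++ [:: drop_leaf l x]) (x :: p).
  rewrite /drop_leaf; rewrite xE x'E in xp xp' cx' x'n xs x's *.
  by apply: (square_merge C12 N9 xp' xp cx' _ _ x'n); clear -xs MN; slia.
have [h1 _ _] := htp_path h.
have YY' : sadj 3 N (drop_leaf l x) (drop_leaf l x').
  have [/walk_last + _ _] := peeling_walk xp cx x3 x2.
  have [/walk_last + _ _] := peeling_walk xp' cx' x'3 x'2.
  rewrite lp lp' sadjE => -> -> /=; apply/asboolP.
  by apply: step_ctx; apply: step_dels; apply: Or33; exists r, s, u.
have Y'Y : sadj 3 N (drop_leaf l x') (drop_leaf l x) by rewrite symA.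
have x'x : sadj 3 N x' x by rewrite symA.
apply: htp_sym; apply: (htp_trans_le (m := 1) (n := squareF N n + 1)
  (q := (x' :: p') ++ [:: drop_leaf l x; drop_leaf l x'])); last by clear; slia.
  rewrite -{1}[x' :: p']cats0; apply: htp_catl; first by rewrite /= xx'N.
  by apply: htp_small => //=; [rewrite lp' Y'Y YY'|slia].
apply: (htp_trans_le (m := squareF N n) (n := 1) (q := [:: x'; x] ++ p ++ [:: drop_leaf l x'])) (leqnn _).
  rewrite -[[:: x'; x] ++ _]/([:: x'] ++ (x :: p) ++ _).
  rewrite (_ : (x' :: p') ++ _ = [:: x'] ++ (p' ++ [:: drop_leaf l x]) ++ [:: drop_leaf l x']); last by rewrite -catA.
  apply: htp_catl; first by rewrite /= xx'N.
  by apply: htp_catr h _; rewrite last_cat /= YY'.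
apply: (htp_catr (q := [::])).
  by apply: htp_small => //=; [rewrite xx'N x'x|slia].
by rewrite /= cat_path wp lp /= YY'.
Qed.

(** Squares are glued along arbitrary intermediate peelings. Only at the far end is the peeling [q']
    prescribed, and [peeling_uniq] matches it at a single cost [swapF]. *)
Lemma annulus n M l x p q q' : path (sadj 3 M) x p ->
  peeling l x q -> peeling l (last x p) q' -> canons x -> 3 <= size x <= M -> M + 9 <= N ->
  (size (lv x) <= n)%N ->
  htp (size p * (squareF N n + 2) + swapF N n) x (p ++ q') (q ++ map (drop_leaf l) p).
Proof.
elim: p x q => [|y p IHp] x q /= + xq yq' cx xs MN xn.
  move=> _; rewrite cats0; apply: htp_sym.
  by apply: peeling_uniq xq yq' cx _ _ xn => //; slia.
move=> /andP[xy yp]; have /and3P[_ ys /asboolP st] := xy.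
have cy : canons y by rewrite -(step_canons st).
have yn : (size (lv y) <= n)%N by rewrite -(perm_size (step_lv st)).
have ly : count_mem l (lv y) = 1.
  by rewrite -(seq.permP (step_lv st)); exact: peeling_count xq.
have y1 : 1 < size y by slia.
have [r yr] := peeling_ex ly y1.
have sq := square xy xq yr cx MN xn.
have IH := IHp y r yp yr yq' cy ys MN yn.
have [_ yr' _] := htp_path sq; have [_ h2 _] := htp_path IH.
apply: (htp_trans_le (m := size p * (squareF N n + 2) + swapF N n) (n := squareF N n + 2)
  (q := (y :: r) ++ map (drop_leaf l) p)); last by rewrite mulSn; clear; slia.
  apply: (htp_catl (p := [:: y])); last exact: IH.
  by move: yr'; rewrite /= => /andP[->].
rewrite -cat_rcons -cats1; apply: htp_catr (htp_sym sq) _.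
by move: h2; rewrite cat_path => /andP[_].
Qed.

(** The same peeling [q] is used at both ends of the annulus, so the loop is conjugated by [q] into
    the loop with [l] set free. The term [8 * n] pays for cancelling [q], of length at most [4 * n],
    twice. *)
Lemma loop_drop_leaf B n M l x p : path (sadj 3 M) x p -> last x p = x ->
  count_mem l (lv x) = 1 -> canons x -> 3 <= size x <= M -> M + 9 <= N ->
  (size (lv x) <= n)%N ->
  htp B (drop_leaf l x) (map (drop_leaf l) p) [::] ->
  htp (B + size p * (squareF N n + 2) + swapF N n + 8 * n) x p [::].
Proof.
move=> xp px lx cx xs MN xn hB.
have [x1 x3 x2] : [/\ 1 < size x, 3 <= size x & size x + 2 <= N] by split; slia.
have [q xq] := peeling_ex lx x1.
have xq' : peeling l (last x p) q by rewrite px.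
have an := annulus xp xq xq' cx xs MN xn.
have [/andP[_ wq] lq sq] := peeling_walk xq cx x3 x2.
have qn : size q <= 4 * n by apply: leq_trans sq _; rewrite leq_mul2l.
have C2 : 2 <= C by slia.
have K := htp_rvK symA C2 wq.
have [xpN _ _] := htp_path an; move: xpN; rewrite cat_path => /andP[xpN _].
have lqP : path (sadj 3 N) (last x q) (rv x q) by apply: rv_path.
apply: (htp_trans_le (m := size q) (n := size p * (squareF N n + 2) + swapF N n + (B + size q)) (q := (p ++ q) ++ rv x q)); last first.
- by clear -qn; slia.
- apply: (htp_trans_le (htp_catr an _) (n := B + size q)) => //; first by rewrite last_cat px.
  rewrite -catA; apply: (htp_trans_le (m := B) (q := q ++ rv x q)) (leqnn _) => //.
  have hB' : htp B (last x q) (map (drop_leaf l) p) [::] by rewrite lq.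
  apply: htp_catl => //; apply: (htp_catr (q := [::]) hB').
  by have [_ _ ->] := htp_path hB'.
- by rewrite -{1}[p]cats0 -catA; apply: htp_catl => //; apply: htp_sym; rewrite px.
Qed.

Lemma constant_loop x p : all (pred1 x) p -> 3 <= size x <= N -> htp (size p) x p [::].
Proof.
move=> + xs; have xx : sadj 3 N x x by apply: sadjxx.
elim: p => [_|y p IHp /= /andP[/eqP -> xp]]; first exact: htp_refl.
apply: (htp_trans_le (m := size p) (n := 1) (q := [:: x])); last by rewrite addn1.
  apply: (htp_catl (p := [:: x]) (s := [::])); first by rewrite /= xx.
  exact: IHp.
by apply: htp_small => //=; [rewrite xx|slia].
Qed.

Lemma walk_dels l a h x p : walk a h x p -> (1 < size (lv x))%N -> uniq (lv x) ->
  walk 1 h (dels l x) (map (dels l) p).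
Proof.
move=> /andP[xs xp] x1 xu.
have H z : perm_eq (lv x) (lv z) -> size z <= h -> 1 <= size (dels l z) <= h.
  move=> xz zh; apply/andP; split; last exact: leq_trans (size_dels l z) zh.
  rewrite lt0n size_mset_eq0; apply/eqP => z0.
  have := perm_size (lv_dels l z); rewrite z0 lv0 size_filter => /esym c0.
  have := count_predC (pred1 l) (lv z); rewrite -(perm_size xz).
  have := count_uniq_mem l xu; rewrite (seq.permP xz) => -> E.
  have {}c0 : count (predC (pred1 l)) (lv z) = 0 := c0.
  by move: x1; rewrite -E c0 addn0; case: (_ \in _).
apply/andP; split; first by apply: H => //; case/andP: xs.
elim: p x xs xp x1 xu H => //= y p IHp x xs /andP[/and3P[_ ys /asboolP st] yp] x1 xu H.
have xy := step_lv st; apply/andP; split.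
  apply/and3P; split; [by apply: H => //; case/andP: xs|by apply: H => //; case/andP: ys|].
  exact/asboolP/step_dels.
apply: IHp => //; first by rewrite -(perm_size xy).
  by rewrite -(perm_uniq xy).
by move=> z yz; apply: H; exact: perm_trans xy yz.
Qed.
End Loops.

(** * Filling a loop by deleting all its leaves *)

Section Fill.
Variables (L : countType) (C N : nat).
Hypotheses (C12 : 12 <= C) (N9 : 9 <= N).
Local Notation tree := (tree L).
Local Notation state := {mset tree}.
Implicit Types (x y z u v : state) (l : L) (a c r s t b : tree) (p q : seq state).
Local Notation treeC := (ltac:(let t := eval unfold reverse_coercion in
  (tree : choiceType) in exact t)) (only parsing).
Local Notation node := (@node L).
Local Notation sadj := (@sadj treeC node).
Local Notation htp := (htp (sadj 3 N) C).
Local Notation walk := (@walk treeC node).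
Let symA := @sadj_sym treeC node 3 N.

Lemma map_drop_leaf l u p : canons u -> l \notin lv u ->
  map (drop_leaf l) (ctx u p) = ctx ([mset Leaf l] `+` u) (map (dels l) p).
Proof.
move=> cu lu; rewrite /ctx -!map_comp; apply: eq_map => y /=.
by rewrite /drop_leaf delsD dels_id//; mset_ac.
Qed.

Lemma lv_drop_leaf l x : uniq (lv x) -> l \in lv x -> perm_eq (lv (drop_leaf l x)) (lv x).
Proof.
move=> ux lx; rewrite perm_sym (perm_trans (perm_to_rem lx))// perm_sym.
rewrite (perm_trans (lvD _ _))// lv1 /= perm_cons rem_filter//.
exact: lv_dels.
Qed.

(** Here [a] is a freed leaf and [c] a root that is constant along the loop. Folding [a] into [c]
    keeps the width from growing with each deletion; the merge commutes with the loop of [y]. *)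
Lemma loop_absorb B h a c c' y p : walk 1 h y p -> last y p = y -> h + 3 <= N ->
  htp B ([mset node a c; c'] `+` y) (ctx [mset node a c; c'] p) [::] ->
  htp (B + size p + 2) ([mset a; c; c'] `+` y) (ctx [mset a; c; c'] p) [::].
Proof.
move=> yp py hN hB.
have q : walk 2 3 [mset a; c; c'] [:: [mset node a c; c']].
  rewrite walkE !sizeE /= andbT.
  by apply: (@sadj_merge treeC node _ _ _ _ a c [mset c']); rewrite ?sizeE//; mset_ac.
have hN' : h + 3 <= N by slia.
have C4 : 4 <= C by slia.
have cm := @htp_comm treeC node C 3 N C4 _ _ _ _ _ _ _ _ yp q isT hN'.
rewrite py !ctx_cons ctx_nil /= muln1 in cm.
rewrite (msetDC y) [y `+` _]msetDC in cm.
set X := [mset a; c; c'] `+` y in cm *; set X1 := [mset node a c; c'] `+` y in cm hB *.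
have XX1 : sadj 3 N X X1.
  have /andP[ys _] := yp.
  apply: (@sadj_merge treeC node _ _ _ _ a c ([mset c'] `+` y)); rewrite ?sizeE//.
  - by rewrite /X; mset_ac.
  - by rewrite /X1; mset_ac.
  - slia.
  - slia.
have X1X : sadj 3 N X1 X by rewrite symA.
have lX : last X (ctx [mset a; c; c'] p) = X by rewrite last_ctx py.
have lX1 : last X1 (ctx [mset node a c; c'] p) = X1 by rewrite last_ctx py.
have [c1 c2 _] := htp_path cm.
apply: (htp_trans_le (m := 1) (n := size p + (B + 1)) (q := (ctx [mset a; c; c'] p ++ [:: X1]) ++ [:: X])); last by clear; lia.
  rewrite -catA -{1}[ctx _ _]cats0; apply: htp_catl.
    by move: c1; rewrite cat_path => /andP[].
  by rewrite lX; apply: htp_small => //=; [rewrite XX1 X1X|slia].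
apply: (htp_trans (htp_catr cm _)); first by rewrite last_cat lX /= X1X.
apply: (htp_trans (q := [:: X1] ++ [::] ++ [:: X])).
  apply: (htp_catl (p := [:: X1]) (r := ctx [mset node a c; c'] p ++ [:: X]) (s := [::] ++ [:: X])); first by rewrite /= XX1.
  by apply: htp_catr hB _; rewrite /= lX1 X1X.
by apply: htp_small => //=; [rewrite XX1 X1X|slia].
Qed.

(** The cost of removing one leaf from a loop of length [k]: [loop_drop_leaf], and then [k + 2] for
    [loop_absorb]. *)
Definition passF n k := k * (squareF N n + 3) + swapF N n + 8 * n + 2.

(** Induction on the leaves of the moving part [y]. The constant roots [c] and [c'] keep the width
    at least 3 however small [y] becomes. The margin 11 is the 9 of [loop_drop_leaf] plus these two
    roots. *)
Lemma loop_two n h m c c' y p : canon c -> canon c' -> canons y ->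
  walk 1 h y p -> last y p = y -> uniq (lv ([mset c; c'] `+` y)) ->
  (size (lv ([mset c; c'] `+` y)) <= n)%N -> size (lv y) = m.+1 -> h + 11 <= N ->
  htp (m.+1 * passF n (size p)) ([mset c; c'] `+` y) (ctx [mset c; c'] p) [::].
Proof.
move=> + cc'; elim: m c y p => [|m IHm] c y p cc cy yp py u n_ ym hN.
  have H z : perm_eq (lv y) (lv z) -> canons z -> 1 <= size z -> exists2 l, lv y = [:: l] & z = [mset Leaf l].
    move=> yz cz z1; have [|t [z' zE]] := @mset_neq0_ex _ z; first by [].
    have zs : size z <= 1 by rewrite -ym (perm_size yz); exact: size_lv.
    have z'0 : z' = mset0.
      by apply/eqP; rewrite -size_mset_eq0; move: zs; rewrite zE sizeE size_mset1; case: (size _).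
    move: yz; rewrite zE z'0 msetD0 lv1; move: ym; case: (lv y) => [|l []]// _.
    case: t {zE} => [l' /perm_mem/(_ l)|t1 t2 /perm_size /=].
      by rewrite !inE eqxx => /esym/eqP <-; exists l.
    rewrite size_cat; have := leaves_neq0 t1; have := leaves_neq0 t2.
    by case: (leaves t1) (leaves t2) => [|? ?] [|? ?]//=; rewrite addnS.
  have /andP[ys pP] := yp.
  have [l lE yE] := H y (perm_refl _) cy (ltac:(by case/andP: ys)).
  (* With a single leaf left, the moving part has only one possible state, so the loop is
     constant. *)
  have allp : all (pred1 y) p.
    elim: p y pP cy ys H lE yE {u n_ ym yp py} => //= z p IHp y /andP[/and3P[_ zs /asboolP st] zp] cy ys H lE yE.
    have yz := step_lv st; have cz : canons z by rewrite -(step_canons st).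
    have [l' lE' zE] := H z yz cz (ltac:(by case/andP: zs)).
    have ll' : l = l' by move: lE'; rewrite lE => -[].
    have zy : z = y by rewrite zE yE ll'.
    by rewrite zy eqxx /=; apply: IHp => //; rewrite -zy.
  rewrite -(size_ctx [mset c; c'] p) mul1n.
  apply: htp_weak; first apply: constant_loop => //.
  - by apply/allP => _ /mapP[z /(allP allp)/eqP -> ->] /=.
  - rewrite !sizeE; slia.
  - by rewrite size_ctx /passF; clear; nia.
have [l ly] : exists l, l \in lv y by move: ym; case: (lv y) => // l s _; exists l; rewrite mem_head.
set x := [mset c; c'] `+` y in u n_ *.
have uy : uniq (lv y) /\ l \notin lv [mset c; c'].
  move: u; rewrite (perm_uniq (lvD _ _)) cat_uniq => /and3P[_ /hasPn + uy].
  by move=> /(_ l ly); split.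
have [{}uy lc] := uy.
have lx : l \in lv x by rewrite mem_lvD ly orbT.
have ccc : canons [mset c; c'] by rewrite canonsD !canons1 cc cc'.
have cx : canons x by rewrite canonsD ccc.
have wx : walk 3 (h + 2) x (ctx [mset c; c'] p).
  by apply: walk_ctx yp _ _; rewrite ?sizeE ?[h + 2]addnC.
have /andP[xs xp] := wx.
have y1 : (1 < size (lv y))%N by rewrite ym.
have dp : walk 1 h (dels l y) (map (dels l) p) := walk_dels l yp y1 uy.
have ldp : last (dels l y) (map (dels l) p) = dels l y by rewrite last_map py.
have dE : drop_leaf l x = [mset Leaf l; c; c'] `+` dels l y.
  by rewrite /drop_leaf /x delsD (@dels_id _ l [mset c; c'])//; mset_ac.
have pc : perm_eq (lv ([mset node (Leaf l) c; c'] `+` dels l y)) (lv x).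
  apply: perm_trans (lv_drop_leaf u lx); rewrite dE.
  by apply/seq.permP => P; rewrite !count_lvD count_lv_node !lv1; clear; slia.
have sdl : size (lv (dels l y)) = m.+1.
  have := perm_size (lv_drop_leaf uy ly); rewrite /drop_leaf size_lvD lv1 ym.
  by rewrite add1n => -[].
have := IHm (node (Leaf l) c) (dels l y) (map (dels l) p).
rewrite canon_node cc (canons_dels l cy) (perm_uniq pc) (perm_size pc) u sdl size_map.
move=> /(_ isT isT dp ldp isT n_ erefl hN) H1.
have hN3 : h + 3 <= N by slia.
have H2 := loop_absorb dp ldp hN3 H1.
have lp : last x (ctx [mset c; c'] p) = x by rewrite last_ctx py.
have lx1 : count_mem l (lv x) = 1 by rewrite count_uniq_mem// lx.
have hN9 : h + 2 + 9 <= N by slia.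
rewrite size_map -[[mset Leaf l; c; c']](_ : [mset Leaf l] `+` [mset c; c'] = _) in H2; last by mset_ac.
rewrite -map_drop_leaf// (_ : _ `+` dels l y = drop_leaf l x) in H2; last by rewrite dE; mset_ac.
have H3 := loop_drop_leaf C12 N9 xp lp lx1 cx xs hN9 n_ H2.
apply: htp_weak H3 _; rewrite size_ctx [in leqRHS]mulSn.
set Q := _ * passF n _; have : size p * (squareF N n + 3) = size p * (squareF N n + 2) + size p.
  by rewrite -mulnSr !addnS.
rewrite {1}/passF; clearbody Q; move: Q (size p * (squareF N n + 3)) (size p * (squareF N n + 2)).
by move: (swapF N n) (size p) => S k Q a b ->; clear; lia.
Qed.

Lemma size_drop_leaf l x : canons x -> count_mem l (lv x) = 1 ->
  size x <= size (drop_leaf l x) <= (size x).+1.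
Proof.
clear C12 N9; move=> cx lx; rewrite /drop_leaf size_msetD size_mset1 add1n ltnS size_dels andbT.
have /mem_lvP[t tx lt] : l \in lv x by rewrite -has_pred1 has_count lx.
have xE := msetB1K tx; rewrite -xE count_lvD lv1 in lx.
have lt0 : 0 < count_mem l (leaves t) by rewrite -has_count has_pred1.
have lx' : l \notin lv (x `\ t) by apply/count_memPn; slia.
have cx' : canons (x `\ t) by move: cx; rewrite -{1}xE canonsD => /andP[].
rewrite -xE delsD (@dels_id _ l (x `\ t))// !size_msetD size_mset1; slia.
Qed.

Lemma walk_drop_leaf k h l x p : walk k h x p -> canons x -> count_mem l (lv x) = 1 ->
  walk k h.+1 (drop_leaf l x) (map (drop_leaf l) p).
Proof.
clear C12 N9; move=> /andP[xs xp] cx lx.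
have H z : k <= size z <= h -> canons z -> count_mem l (lv z) = 1 -> k <= size (drop_leaf l z) <= h.+1.
  move=> zs cz lz; have := size_drop_leaf cz lz; slia.
apply/andP; split; first exact: H.
elim: p x xs xp cx lx => //= y p IHp x xs /andP[/and3P[_ ys /asboolP st] yp] cx lx.
have cy : canons y by rewrite -(step_canons st).
have ly : count_mem l (lv y) = 1 by rewrite -(seq.permP (step_lv st)).
apply/andP; split; last exact: IHp.
by apply/and3P; split; [exact: H|exact: H|exact/asboolP/step_ctx/step_dels].
Qed.

Definition fillF n k := n.+1 * passF n k.

(** Two leaves are freed first; they become the constant roots that start the induction of
    [loop_two]. *)
Theorem loop_fill n M x p : walk 3 M x p -> last x p = x -> canons x ->
  uniq (lv x) -> (size (lv x) <= n)%N -> M + 11 <= N ->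
  htp (fillF n (size p)) x p [::].
Proof.
move=> wx px cx ux xn MN; have /andP[xs xp] := wx.
have x3 : (3 <= size (lv x))%N by apply: leq_trans (size_lv x); case/andP: xs.
have [l [l' [lx l'x ll']]] : exists l l', [/\ l \in lv x, l' \in lv x & l != l'].
  case: (lv x) x3 ux => [|l [|l' s]]// _ /= /andP[]; rewrite !inE negb_or => /andP[? _] _.
  by exists l, l'; rewrite !inE !eqxx orbT.
have l'd : l' \in lv (dels l x) by rewrite (perm_mem (lv_dels l x)) mem_filter /= eq_sym ll'.
have w1 : walk 1 M (dels l x) (map (dels l) p).
  exact: (walk_dels l (walk_le (l' := 1) wx isT (leqnn M)) (leq_trans (isT : (1 < 3)%N) x3) ux).
have u1 := lv_drop_leaf ux lx.
have s1 : size (lv (dels l x)) = (size (lv x)).-1.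
  by rewrite -(perm_size u1) size_lvD lv1.
have ud : uniq (lv (dels l x)) by rewrite (perm_uniq (lv_dels l x)) filter_uniq.
have d1 : (1 < size (lv (dels l x)))%N.
  by rewrite s1; move: x3; case: (size _) => // k; rewrite ltnS.
have w2 : walk 1 M (dels l' (dels l x)) (map (dels l') (map (dels l) p)) := walk_dels l' w1 d1 ud.
have lp1 : last (dels l x) (map (dels l) p) = dels l x by rewrite last_map px.
have lp2 : last (dels l' (dels l x)) (map (dels l') (map (dels l) p)) = dels l' (dels l x).
  by rewrite last_map lp1.
have u2 : uniq (lv (drop_leaf l x)) by rewrite (perm_uniq u1).
have l'x1 : l' \in lv (drop_leaf l x) by rewrite (perm_mem u1).
have u3 := lv_drop_leaf u2 l'x1.
have nl' : l' \notin lv [mset Leaf l] by rewrite lv1 /= inE eq_sym.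
have E2 : drop_leaf l' (drop_leaf l x) = [mset Leaf l'; Leaf l] `+` dels l' (dels l x).
  by rewrite /drop_leaf delsD (@dels_id _ l' [mset Leaf l]) ?canons1//; mset_ac.
have pe : perm_eq (lv ([mset Leaf l'; Leaf l] `+` dels l' (dels l x))) (lv x).
  by rewrite -E2; apply: perm_trans u1.
have [m mE] : exists m, size (lv (dels l' (dels l x))) = m.+1 /\ (m.+3 <= n)%N.
  move: (perm_size pe); rewrite size_lvD size_lvD !lv1 /= => E; move: x3 xn; rewrite -E.
  by case: (size (lv (dels l' _))) => // m; exists m.
have {mE} [mE mn] := mE.
have cdd : canons (dels l' (dels l x)) by do 2!apply: canons_dels.
have := @loop_two n M m (Leaf l') (Leaf l) _ _ isT isT cdd w2 lp2.
rewrite (perm_uniq pe) (perm_size pe) => /(_ ux xn mE MN) H.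
rewrite -E2 -[[mset Leaf l'; _]]/([mset Leaf l'] `+` [mset Leaf l]) -map_drop_leaf ?canons1// in H.
rewrite !size_map in H.
have px1 : map (drop_leaf l) p = ctx [mset Leaf l] (map (dels l) p).
  by rewrite /ctx -map_comp.
have cnt : count_mem l (lv x) = 1 by rewrite count_uniq_mem// lx.
have W1 := walk_drop_leaf wx cx cnt.
have /andP[x1s x1p] := W1.
have lpx1 : last (drop_leaf l x) (map (drop_leaf l) p) = drop_leaf l x by rewrite last_map px.
have cnt' : count_mem l' (lv (drop_leaf l x)) = 1 by rewrite count_uniq_mem// l'x1.
have cx1 : canons (drop_leaf l x) by rewrite canonsD canons1 canons_dels.
have M1N : M.+1 + 9 <= N by slia.
have MN9 : M + 9 <= N by slia.
have x1n : (size (lv (drop_leaf l x)) <= n)%N by rewrite (perm_size u1).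
rewrite -px1 in H.
have H1 := loop_drop_leaf C12 N9 x1p lpx1 cnt' cx1 x1s M1N x1n H.
have H2 := loop_drop_leaf C12 N9 xp px cnt cx xs MN9 xn H1.
apply: htp_weak H2 _; rewrite size_map /fillF.
apply: (@leq_trans (m.+3 * passF n (size p))); last by rewrite leq_mul2r ltnW ?orbT.
rewrite [in leqRHS]mulSn [in leqRHS]mulSn; set Q := m.+1 * _; have : size p * (squareF N n + 3) = size p * (squareF N n + 2) + size p.
  by rewrite -mulnSr !addnS.
rewrite {1 2}/passF; clearbody Q; move: Q (size p * (squareF N n + 3)) (size p * (squareF N n + 2)).
by move: (swapF N n) (size p) => S k Q d e ->; clear; lia.
Qed.

End Fill.

(** * Forests with the same leaves are linked within bounded width *)

Section Connected.
Variables (L : countType) (N : nat).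
Local Notation tree := (tree L).
Local Notation state := {mset tree}.
Implicit Types (x y z u v : state) (l : L) (a c r s t b : tree) (p q : seq state).
Local Notation treeC := (ltac:(let t := eval unfold reverse_coercion in
  (tree : choiceType) in exact t)) (only parsing).
Local Notation node := (@node L).
Local Notation sadj := (@sadj treeC node).
Local Notation walk := (@walk treeC node).
Let symA := @sadj_sym treeC node 3 N.

Definition linked x y := exists p, path (sadj 3 N) x p /\ last x p = y.

Lemma linked_refl x : linked x x. Proof. by exists [::]. Qed.

Lemma linked_trans x y z : linked x y -> linked y z -> linked x z.
Proof.
move=> [p [xp <-]] [q [yq <-]]; exists (p ++ q).
by rewrite cat_path xp last_cat.
Qed.

Lemma linked_sym x y : linked x y -> linked y x.
Proof.
by move=> [p [xp <-]]; exists (rv x p); rewrite last_rv; split=> //; exact: rv_path.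
Qed.

Lemma linked_drop_leaf l x : canons x -> count_mem l (lv x) = 1 ->
  3 <= size x -> size x + 2 <= N -> linked x (drop_leaf l x).
Proof.
move=> cx lx x3 xN; have x1 : 1 < size x by slia.
have [p xp] := peeling_ex lx x1.
by have [/andP[_ w] lp _] := peeling_walk xp cx x3 xN; exists p.
Qed.

Lemma linked_absorb a c c' y : 0 < size y -> size y + 3 <= N ->
  linked ([mset a; c; c'] `+` y) ([mset node a c; c'] `+` y).
Proof.
move=> y0 yN; exists [:: [mset node a c; c'] `+` y]; split=> //=; rewrite andbT.
apply: (@sadj_merge treeC node _ _ _ _ a c ([mset c'] `+` y)); rewrite ?sizeE//;
  first [mset_ac | slia].
Qed.

(** Both forests are dismantled in the same order of leaves, each freed leaf being absorbed by [c],
    so that they meet in the same forest. *)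
Lemma linked_two m c c' y y' : canon c -> canon c' -> canons y -> canons y' ->
  uniq (lv ([mset c; c'] `+` y)) -> perm_eq (lv y) (lv y') ->
  size (lv y) = m.+1 -> 0 < size y -> 0 < size y' -> size y + 4 <= N -> size y' + 4 <= N ->
  linked ([mset c; c'] `+` y) ([mset c; c'] `+` y').
Proof.
move=> + cc'; elim: m c y y' => [|m IHm] c y y' cc cy cy' u yy' ym y0 y'0 yN y'N.
  have H z : perm_eq (lv y) (lv z) -> canons z -> 0 < size z -> exists2 l, lv y = [:: l] & z = [mset Leaf l].
    move=> yz cz z1; have [|t [z' zE]] := @mset_neq0_ex _ z; first by [].
    have zs : size z <= 1 by rewrite -ym (perm_size yz); exact: size_lv.
    have z'0 : z' = mset0.
      by apply/eqP; rewrite -size_mset_eq0; move: zs; rewrite zE sizeE size_mset1; case: (size _).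
    move: yz; rewrite zE z'0 msetD0 lv1; move: ym; case: (lv y) => [|l []]// _.
    case: t {zE} => [l' /perm_mem/(_ l)|t1 t2 /perm_size /=].
      by rewrite !inE eqxx => /esym/eqP <-; exists l.
    rewrite size_cat; have := leaves_neq0 t1; have := leaves_neq0 t2.
    by case: (leaves t1) (leaves t2) => [|? ?] [|? ?]//=; rewrite addnS.
  have [l lE ->] := H _ (perm_refl _) cy y0; have [l' lE' ->] := H _ yy' cy' y'0.
  by move: lE'; rewrite lE => -[->]; exact: linked_refl.
have [l ly] : exists l, l \in lv y by move: ym; case: (lv y) => // l s _; exists l; rewrite mem_head.
have [uy lc] : uniq (lv y) /\ l \notin lv [mset c; c'].
  move: u; rewrite (perm_uniq (lvD _ _)) cat_uniq => /and3P[_ /hasPn + uy].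
  by move=> /(_ l ly); split.
have ccc : canons [mset c; c'] by rewrite canonsD !canons1 cc cc'.
have key z : perm_eq (lv y) (lv z) -> canons z -> 0 < size z -> size z + 4 <= N ->
    linked ([mset c; c'] `+` z) ([mset node (Leaf l) c; c'] `+` dels l z) /\
    (0 < size (dels l z) /\ size (dels l z) + 4 <= N).
  move=> yz cz z0 zN.
  have lz : count_mem l (lv ([mset c; c'] `+` z)) = 1.
    by rewrite count_lvD (count_memPn lc) -(seq.permP yz) count_uniq_mem// ly.
  have dE : drop_leaf l ([mset c; c'] `+` z) = [mset Leaf l; c; c'] `+` dels l z.
    by rewrite /drop_leaf delsD (@dels_id _ l [mset c; c'])//; mset_ac.
  have z1 : count_mem l (lv z) = 1 by rewrite -(seq.permP yz) count_uniq_mem// ly.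
  have sz := size_dels l z.
  have dz : 0 < size (dels l z).
    rewrite lt0n size_mset_eq0; apply/eqP => dz0.
    have := perm_size (lv_dels l z); rewrite dz0 lv0 size_filter => /esym c0.
    have := count_predC (pred1 l) (lv z); rewrite -(perm_size yz) ym.
    have {}c0 : count (predC (pred1 l)) (lv z) = 0 := c0.
    by have {}z1 : count (pred1 l) (lv z) = 1 := z1; rewrite c0 z1.
  split; last by split=> //; slia.
  apply: linked_trans (linked_drop_leaf _ lz _ _) _.
  - by rewrite canonsD ccc.
  - by rewrite !sizeE; slia.
  - by rewrite !sizeE; slia.
  - by rewrite dE; apply: linked_absorb => //; slia.
have [k1 [d1 d2]] := key y (perm_refl _) cy y0 yN.
have [k2 [d1' d2']] := key y' yy' cy' y'0 y'N.
apply: (linked_trans k1 (linked_trans _ (linked_sym k2))).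
apply: IHm => //.
- by rewrite canon_node.
- exact: canons_dels.
- exact: canons_dels.
- rewrite (perm_uniq (_ : perm_eq _ (lv ([mset c; c'] `+` y))))//.
  have lx : l \in lv ([mset c; c'] `+` y) by rewrite mem_lvD ly orbT.
  apply: perm_trans (lv_drop_leaf u lx).
  rewrite /drop_leaf delsD (@dels_id _ l [mset c; c'])//.
  by apply/seq.permP => P; rewrite !count_lvD count_lv_node !lv1; clear; slia.
- apply: perm_trans (lv_dels l y) _; rewrite perm_sym; apply: perm_trans (lv_dels l y') _.
  by rewrite perm_sym; apply: perm_filter.
- have := perm_size (lv_drop_leaf uy ly); rewrite /drop_leaf size_lvD lv1 ym.
  by rewrite add1n => -[].
Qed.

Theorem linked_same_leaves x x' : canons x -> canons x' -> uniq (lv x) ->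
  perm_eq (lv x) (lv x') -> 3 <= size x -> 3 <= size x' ->
  size x + 4 <= N -> size x' + 4 <= N -> linked x x'.
Proof.
move=> cx cx' ux xx' x3 x'3 xN x'N.
have l3 : (3 <= size (lv x))%N by apply: leq_trans (size_lv x).
have [l [l' [lx l'x ll']]] : exists l l', [/\ l \in lv x, l' \in lv x & l != l'].
  case: (lv x) l3 ux => [|l [|l' s]]// _ /= /andP[]; rewrite !inE negb_or => /andP[? _] _.
  by exists l, l'; rewrite !inE !eqxx orbT.
have key z : perm_eq (lv x) (lv z) -> canons z -> 3 <= size z -> size z + 4 <= N ->
    linked z ([mset Leaf l'; Leaf l] `+` dels l' (dels l z)) /\
    [/\ perm_eq (lv ([mset Leaf l'; Leaf l] `+` dels l' (dels l z))) (lv z),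
      canons (dels l' (dels l z)) & size (dels l' (dels l z)) <= size z].
  move=> xz cz z3 zN.
  have uz : uniq (lv z) by rewrite -(perm_uniq xz).
  have lz : l \in lv z by rewrite -(perm_mem xz).
  have l'z : l' \in lv z by rewrite -(perm_mem xz).
  have nl' : l' \notin lv [mset Leaf l] by rewrite lv1 /= inE eq_sym.
  have E2 : drop_leaf l' (drop_leaf l z) = [mset Leaf l'; Leaf l] `+` dels l' (dels l z).
    by rewrite /drop_leaf delsD (@dels_id _ l' [mset Leaf l]) ?canons1//; mset_ac.
  have u1 := lv_drop_leaf uz lz.
  have uz1 : uniq (lv (drop_leaf l z)) by rewrite (perm_uniq u1).
  have l'z1 : l' \in lv (drop_leaf l z) by rewrite (perm_mem u1).
  have cz1 : canons (drop_leaf l z) by rewrite canonsD canons1 canons_dels.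
  have c1 : count_mem l (lv z) = 1 by rewrite count_uniq_mem// lz.
  have c2 : count_mem l' (lv (drop_leaf l z)) = 1 by rewrite count_uniq_mem// l'z1.
  have s1 := size_drop_leaf cz c1.
  have s2 := size_dels l' (dels l z); have s3 := size_dels l z.
  have z2 : size z + 2 <= N by slia.
  have dz3 : 3 <= size (drop_leaf l z) by slia.
  have dz2 : size (drop_leaf l z) + 2 <= N by slia.
  rewrite -E2; split; last split.
  - exact: linked_trans (linked_drop_leaf cz c1 z3 z2) (linked_drop_leaf cz1 c2 dz3 dz2).
  - exact: perm_trans (lv_drop_leaf uz1 l'z1) u1.
  - by do 2!apply: canons_dels.
  - slia.
have [k1 [p1 c1 s1]] := key x (perm_refl _) cx x3 xN.
have [k2 [p2 c2 s2]] := key x' xx' cx' x'3 x'N.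
have pp : perm_eq (lv (dels l' (dels l x))) (lv (dels l' (dels l x'))).
  have := perm_trans (perm_trans p1 xx') (perm_trans (_ : perm_eq (lv x') (lv x')) (ltac:(by rewrite perm_sym; exact: p2))).
  move=> /(_ (perm_refl _)) /seq.permP E; apply/seq.permP => P; have := E P; rewrite !count_lvD; clear; slia.
have sl : exists m, size (lv (dels l' (dels l x))) = m.+1.
  move: (perm_size p1) l3; rewrite !size_lvD !lv1 /= => <-.
  by case: (size (lv (dels l' _))) => // m _; exists m.
have [m mE] := sl.
have pos z : size (lv z) = m.+1 -> 0 < size z.
  by case: (posnP (size z)) => // /eqP; rewrite size_mset_eq0 => /eqP ->; rewrite lv0.
apply: (linked_trans k1 (linked_trans _ (linked_sym k2))).
have mE0 := pos _ mE.
apply: (linked_two (m := m)) => //.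
- by rewrite (perm_uniq p1).

- by apply: pos; rewrite -(perm_size pp).
- slia.
- slia.
Qed.

End Connected.

Local Close Scope mset_scope.
Local Open Scope classical_set_scope.

(** * Families of clopen subsets of the boundary *)

Section Geometry.

Local Notation P := (tend 2).
Local Notation V := (vertex 2).
Local Notation N := (neretin 2).
Local Notation label := (seq 'I_3).
Local Notation labelC := (ltac:(let t := eval unfold reverse_coercion in
  (label : countType) in exact t)) (only parsing).
Local Notation tree := (tree labelC).
Local Notation state := {mset tree}%mset.
Local Notation treeC := (ltac:(let t := eval unfold reverse_coercion in
  (tree : choiceType) in exact t)) (only parsing).
Local Notation node := (@node labelC).
Local Notation step := (@step treeC node).

Section Cylinders.
Implicit Types (u v w : label) (x y : P).

Lemma tend_eq x y : (forall n, x n = y n) -> x = y.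
Proof.
case: x y => [x xP] [y yP] /= /funext xy; move: xP; rewrite xy => xP.
by congr End; exact: Prop_irrelevance.
Qed.

Definition cyl w : set P := [set x | mkseq x (size w) = w].

Lemma mkseq_take (T : Type) (f : nat -> T) m n : m <= n -> take m (mkseq f n) = mkseq f m.
Proof. by move=> mn; rewrite /mkseq -map_take take_iota (minn_idPl mn). Qed.

Lemma cyl_mkseq x n : cyl (mkseq x n) x.
Proof. by rewrite /cyl /= size_mkseq. Qed.

Lemma cyl_prefix u v : prefix u v -> cyl v `<=` cyl u.
Proof.
move=> /prefixP[s ->] x; rewrite /cyl /= size_cat => xus.
by rewrite -(mkseq_take x (leq_addr (size s) (size u))) xus take_size_cat.
Qed.

Lemma cyl_meet u v x : cyl u x -> cyl v x -> prefix u v \/ prefix v u.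
Proof.
rewrite /cyl /= => xu xv; case: (leqP (size u) (size v)) => uv; [left|right].
  by rewrite prefixE -xv mkseq_take// xu.
by rewrite prefixE -xu mkseq_take ?xv// ltnW.
Qed.

Definition nxt (a : 'I_3) (k : nat) : 'I_3 := inord ((a + k) %% 3).

Lemma nxt1_neq a : nxt a 1 != a.
Proof. by apply/eqP => /(congr1 val) /=; rewrite inordK ?ltn_pmod//; case: a => [[|[|[]]]]. Qed.
Lemma nxt2_neq a : nxt a 2 != a.
Proof. by apply/eqP => /(congr1 val) /=; rewrite inordK ?ltn_pmod//; case: a => [[|[|[]]]]. Qed.
Lemma nxt12 a : nxt a 1 != nxt a 2.
Proof. by apply/eqP => /(congr1 val) /=; rewrite !inordK ?ltn_pmod//; case: a => [[|[|[]]]]. Qed.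
Lemma nxtP a b : b != a -> b = nxt a 1 \/ b = nxt a 2.
Proof.
move=> ba; have : (b = nxt a 1 :> nat) \/ (b = nxt a 2 :> nat).
  rewrite !inordK ?ltn_pmod//; move: ba; rewrite -val_eqE /=.
  by case: a b => [[|[|[|]]]//= ?] [[|[|[|]]]//= ?]; auto.
by case=> /val_inj; auto.
Qed.

Definition lst w := last ord0 w.
(* The two children of a nonempty reduced word. *)
Definition c1 w := rcons w (nxt (lst w) 1).
Definition c2 w := rcons w (nxt (lst w) 2).

Lemma reduced_rconsE w i : reduced (rcons w i) = reduced w && ((w == [::]) || (lst w != i)).
Proof.
case/lastP: w => [|w j] //; rewrite reduced_rcons /lst last_rcons.
by case: w.
Qed.

Lemma reduced_c1 w : reduced w -> reduced (c1 w).
Proof. by move=> rw; rewrite reduced_rconsE rw [lst w == _]eq_sym nxt1_neq orbT. Qed.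
Lemma reduced_c2 w : reduced w -> reduced (c2 w).
Proof. by move=> rw; rewrite reduced_rconsE rw [lst w == _]eq_sym nxt2_neq orbT. Qed.

Lemma reduced_prefixP u v : prefix u v -> reduced v -> reduced u.
Proof. by rewrite prefixE => /eqP <- vP; apply: take_sorted. Qed.

Lemma cyl_neq0 w : reduced w -> exists x, cyl w x.
Proof.
move=> rw; pose a := lst w; pose b := nxt a 1.
pose f n := if n < size w then nth ord0 w n else if odd (n - size w) then a else b.
have fP n : f n != f n.+1.
  rewrite /f; have [nw|wn] := ltnP n.+1 (size w).
    rewrite ltnW//; move: rw; rewrite /reduced => /(sortedP ord0) H.
    exact: H.
  have [n1|n1] := ltnP n (size w).
    have wE : size w = n.+1 by apply/eqP; rewrite eqn_leq wn.
    by rewrite wE subnn /= /b /a /lst -nth_last wE /= eq_sym nxt1_neq.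
  by rewrite subSn//=; case: odd; rewrite /= ?nxt1_neq// eq_sym nxt1_neq.
exists (End fP); rewrite /cyl /=; apply: (@eq_from_nth _ ord0); rewrite size_mkseq// => i iw.
by rewrite nth_mkseq// /f iw.
Qed.

(** If [u] were a proper extension of [v], some child of [v] would point away from [u], and the ends
    through it would lie in [cyl v] but not in [cyl u]. *)
Lemma cyl_sub u v : reduced v -> cyl v `<=` cyl u -> prefix u v.
Proof.
move=> rv vu; have [x xv] := cyl_neq0 rv.
case: (cyl_meet xv (vu x xv)) => // /prefixP[[|i s] uE].
  by rewrite uE cats0 prefix_refl.
have [j rj ji] : exists2 j, reduced (rcons v j) & j != i.
  have [E|ne] := eqVneq (nxt (lst v) 1) i.
    by exists (nxt (lst v) 2); [exact: reduced_c2|rewrite -E eq_sym nxt12].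
  by exists (nxt (lst v) 1); first exact: reduced_c1.
have [y yv] := cyl_neq0 rj; have yu : cyl u y.
  by apply: vu; apply: cyl_prefix yv; exact: prefix_rcons.
have yi : cyl (rcons v i) y.
  by apply: cyl_prefix yu; rewrite uE -cat_rcons prefix_prefix.
move: yv yi; rewrite /cyl /= !size_rcons => -> /eqP.
by rewrite eqseq_rcons eqxx (negbTE ji).
Qed.

Lemma prefix_anti u v : prefix u v -> prefix v u -> u = v.
Proof.
move=> /prefixP[s ->] /prefixP[t]; rewrite -catA -{1}[u]cats0.
by move=> /eqP; rewrite eqseq_cat// => /andP[_ /eqP]; case: s => //; rewrite cats0.
Qed.

Lemma cyl_inj u v : reduced u -> reduced v -> cyl u = cyl v -> u = v.
Proof.
move=> ru rv uv; apply: prefix_anti; apply: cyl_sub => //; rewrite uv//.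
Qed.

Lemma cyl_child w i x : cyl (rcons w i) x <-> cyl w x /\ x (size w) = i.
Proof.
rewrite /cyl /= size_rcons mkseqS; split=> [/eqP|[-> ->]]//.
by rewrite eqseq_rcons => /andP[/eqP ? /eqP].
Qed.

Lemma cylE w : w != [::] -> cyl w = cyl (c1 w) `|` cyl (c2 w).
Proof.
move=> w0; apply/seteqP; split=> x; last first.
  by case=> /cyl_child[].
move=> xw; have : x (size w) != lst w.
  have : lst w = x (size w).-1.
    have w1 : (size w).-1 < size w by case: (w) w0.
    by rewrite /lst -nth_last -[in LHS]xw size_mkseq nth_mkseq.
  by case: (w) w0 => // a s _ -> /=; rewrite eq_sym; case: (x) => f /=.
by move=> /nxtP[] xE; [left|right]; apply/cyl_child.
Qed.

Lemma cyl_c12 w x : cyl (c1 w) x -> cyl (c2 w) x -> False.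
Proof. by move=> /cyl_child[_ E1] /cyl_child[_ E2]; have := nxt12 (lst w); rewrite -E1 -E2 eqxx. Qed.

Definition fam w : set (set P) := [set cyl u | u in [set u | reduced u /\ prefix w u]].

Definition fam0 : set (set P) := [set cyl u | u in [set u | reduced u /\ u != [::]]].

Lemma prefix_c12 w u : w != [::] -> reduced u -> prefix w u -> [\/ u = w, prefix (c1 w) u | prefix (c2 w) u].
Proof.
move=> w0 ru /prefixP[[|i s] uE]; first by rewrite uE cats0; apply: Or31.
have : reduced (rcons w i).
  by apply: reduced_prefixP ru; rewrite uE -cat_rcons prefix_prefix.
rewrite reduced_rconsE (negbTE w0) /= => /andP[_]; rewrite eq_sym => /nxtP[] iE.
  by apply: Or32; rewrite uE -cat_rcons iE prefix_prefix.
by apply: Or33; rewrite uE -cat_rcons iE prefix_prefix.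
Qed.

Lemma famE w : reduced w -> w != [::] -> fam w = fam (c1 w) `|` fam (c2 w) `|` [set cyl w].
Proof.
move=> rw w0; apply/seteqP; split=> B.
  move=> [u [ru wu] <-]; case: (prefix_c12 w0 ru wu) => [->|h|h]; [by right|left; left|left; right];
  by exists u.
case=> [[]|->].
- by move=> [u [ru wu] <-]; exists u => //; split=> //; apply: prefix_trans wu; exact: prefix_rcons.
- by move=> [u [ru wu] <-]; exists u => //; split=> //; apply: prefix_trans wu; exact: prefix_rcons.
- by exists w => //; split=> //; exact: prefix_refl.
Qed.

Lemma fam_cyl w : reduced w -> fam w (cyl w).
Proof. by move=> rw; exists w => //; split=> //; exact: prefix_refl. Qed.

Lemma fam_sub w B : fam w B -> B `<=` cyl w.
Proof. by move=> [u [_ wu] <-]; exact: cyl_prefix. Qed.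

Lemma fam_neq0 w B : fam w B -> exists x, B x.
Proof. by move=> [u [ru _] <-]; exact: cyl_neq0. Qed.

End Cylinders.

Section Families.
Implicit Types (w : label) (p : P) (a b t : tree) (x y z u : state)
  (B D : set P) (F : set (set P)).

Fixpoint top t : set P := if t is Node a b then top a `|` top b else
  if t is Leaf w then cyl w else set0.

Fixpoint famt t : set (set P) := match t with
  | Leaf w => fam w
  | Node a b => famt a `|` famt b `|` [set top a `|` top b] end.

Lemma top_node a b : top (node a b) = top a `|` top b.
Proof. by case: (nodeE a b) => -> //=; rewrite setUC. Qed.

Lemma famt_node a b : famt (node a b) = famt a `|` famt b `|` [set top a `|` top b].
Proof. by case: (nodeE a b) => -> //=; rewrite [famt b `|` _]setUC [top b `|` _]setUC. Qed.

Lemma topP t p : top t p <-> exists2 w, w \in leaves t & cyl w p.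
Proof.
elim: t => [w|a IHa b IHb] /=.
  by split=> [pw|[v]]; [exists w; rewrite ?mem_head|rewrite inE => /eqP ->].
split=> [[/IHa|/IHb] [w wa pw]|[w]].
- by exists w => //; rewrite mem_cat wa.
- by exists w => //; rewrite mem_cat wa orbT.
by rewrite mem_cat => /orP[wa|wa] pw; [left; apply/IHa|right; apply/IHb]; exists w.
Qed.

Lemma famt_sub t B : famt t B -> B `<=` top t.
Proof.
elim: t => [w|a IHa b IHb] /=; first exact: fam_sub.
by case=> [[/IHa|/IHb] h p /h|-> //]; [left|right].
Qed.

Lemma famt_neq0 t B : (forall w, w \in leaves t -> reduced w) -> famt t B -> exists p, B p.
Proof.
elim: t B => [w|a IHa b IHb] B H /=; first exact: fam_neq0.
have Ha w : w \in leaves a -> reduced w by move=> wa; apply: H; rewrite /= mem_cat wa.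
have Hb w : w \in leaves b -> reduced w by move=> wb; apply: H; rewrite /= mem_cat wb orbT.
case=> [[/(IHa _ Ha)|/(IHb _ Hb)]|->] //.
elim: (a) Ha {IHa IHb Hb H} => [w|a1 IH1 a2 IH2] H /=.
  by have [|p wp] := @cyl_neq0 w; [apply: H; rewrite /= mem_head|exists p; left].
have [|p []] := IH1; first by move=> w wa; apply: H; rewrite /= mem_cat wa.
  by exists p; left; left.
by exists p; right.
Qed.

Lemma famt_top t : (forall w, w \in leaves t -> reduced w) -> famt t (top t).
Proof.
case: t => [w|a b] H /=; last by right.
by apply: fam_cyl; apply: H; rewrite /= mem_head.
Qed.

(* The cylinders of the words in [s] form a partition of the boundary. *)
Definition cylpart (s : seq label) := [/\ forall w, w \in s -> reduced w /\ w != [::], uniq s,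
  forall w w', w \in s -> w' \in s -> prefix w w' -> w = w' &
  forall p, exists2 w, w \in s & cyl w p].

Lemma cylpart_perm s s' : perm_eq s s' -> cylpart s -> cylpart s'.
Proof.
move=> ss' [H1 H2 H3 H4]; split.
- by move=> w; rewrite -(perm_mem ss'); exact: H1.
- by rewrite -(perm_uniq ss').
- by move=> w w'; rewrite -!(perm_mem ss'); exact: H3.
- by move=> p; have [w ws wp] := H4 p; exists w; rewrite -?(perm_mem ss').
Qed.

Definition valid x := canons x /\ cylpart (lv x).

Lemma valid_step x y : step x y -> valid x -> valid y.
Proof.
move=> st [cx ox]; split; first by rewrite -(step_canons st).
exact: cylpart_perm (step_lv st) ox.
Qed.

Lemma valid_leaves x t w : valid x -> t \in x -> w \in leaves t -> reduced w.
Proof.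
by move=> [_ [H _ _ _]] tx wt; apply: (H w _).1; apply/mem_lvP; exists t.
Qed.

Lemma top_disj a b u p : valid (a +` (b +` u))%mset -> top a p -> top b p -> False.
Proof.
move=> [_ [_ us ac _]] /topP[w wa pw] /topP[v vb pv].
have wl : w \in lv (a +` (b +` u))%mset by rewrite mem_lvD lv1 wa.
have vl : v \in lv (a +` (b +` u))%mset by rewrite !mem_lvD !lv1 vb orbT.
have wv : w = v by case: (cyl_meet pw pv) => /ac => [|->//]; exact.
move: us; rewrite (perm_uniq (lvD _ _)) cat_uniq lv1 => /and3P[_ /hasPn /(_ v) + _].
by rewrite mem_lvD lv1 vb => /(_ isT); rewrite -wv /= wa.
Qed.

Lemma top_uniq x t t' p : valid x -> t \in x -> t' \in x -> top t p -> top t' p -> t = t'.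
Proof.
move=> vx tx t'x tp t'p; apply: contrapT => /eqP ne.
have xE := msetB1K tx; have : t' \in (x `\ t)%mset.
  by move: t'x; rewrite -{1}xE in_msetD in_mset1 eq_sym (negbTE ne).
by move=> /msetB1K x'E; rewrite -xE -x'E in vx; exact: top_disj vx tp t'p.
Qed.

Definition Sfam x : set (set P) := [set B | exists2 t, t \in x & famt t B].

Lemma SfamD x y : Sfam (x `+` y)%mset = Sfam x `|` Sfam y.
Proof.
apply/seteqP; split=> B.
  by move=> [t]; rewrite in_msetD => /orP[tx|tx] tB; [left|right]; exists t.
by case=> -[t tx tB]; exists t; rewrite // in_msetD tx ?orbT.
Qed.

Lemma Sfam1 t : Sfam [mset t]%mset = famt t.
Proof.
apply/seteqP; split=> B; last by exists t => //; rewrite mset11.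
by move=> [t' /mset1P ->].
Qed.

Lemma Sfam_merge a b u :
  Sfam (node a b +` u)%mset = Sfam (a +` (b +` u))%mset `|` [set top a `|` top b].
Proof. by rewrite !SfamD !Sfam1 famt_node setUA setUAC. Qed.

Lemma Sfam_sub x B : Sfam x B -> exists2 t, t \in x & B `<=` top t.
Proof. by move=> [t tx /famt_sub]; exists t. Qed.

Lemma Sfam_neq0 x B : valid x -> Sfam x B -> exists p, B p.
Proof. by move=> vx [t tx]; apply: famt_neq0 => w; exact: valid_leaves tx. Qed.

Lemma Sfam_top x t : valid x -> t \in x -> Sfam x (top t).
Proof. by move=> vx tx; exists t => //; apply: famt_top => w; exact: valid_leaves tx. Qed.

Definition maxel F B := F B /\ forall D, F D -> B `<=` D -> D = B.

(** This recovers the roots of a forest from its family alone, which makes it possible to lift moves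
    of families to moves of forests. *)
Lemma maxel_Sfam x B : valid x -> maxel (Sfam x) B <-> exists2 t, t \in x & B = top t.
Proof.
move=> vx; split.
  move=> [/Sfam_sub[t tx Bt] mB]; exists t => //.
  by apply/esym/mB => //; exact: Sfam_top.
move=> [t tx ->]; split; first exact: Sfam_top.
move=> D /Sfam_sub[t' t'x Dt'] tD; have [p tp] := Sfam_neq0 vx (Sfam_top vx tx).
apply/seteqP; split=> //; rewrite (top_uniq vx tx t'x tp)//.
exact/Dt'/tD.
Qed.

Lemma Sfam_split a b u : valid (node a b +` u)%mset ->
  Sfam (a +` (b +` u))%mset = Sfam (node a b +` u)%mset `\ (top a `|` top b).
Proof.
move=> v; have v' : valid (a +` (b +` u))%mset.
  by apply: valid_step v; apply: Or33; exists a, b, u.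
rewrite Sfam_merge; apply/seteqP; split=> B; last by case=> -[|//].
move=> BF; split; first by left.
move=> BE; have [t tx Bt] := Sfam_sub BF.
have ax : a \in (a +` (b +` u))%mset by rewrite in_msetD mset11.
have bx : b \in (a +` (b +` u))%mset by rewrite !in_msetD mset11 orbT.
have [p ap] := Sfam_neq0 v' (Sfam_top v' ax).
have [q bq] := Sfam_neq0 v' (Sfam_top v' bx).
have at_ : a = t by apply: (top_uniq v' ax tx ap); apply: Bt; rewrite BE; left.
have bt_ : b = t by apply: (top_uniq v' bx tx bq); apply: Bt; rewrite BE; right.
by apply: (top_disj v' ap); rewrite bt_ -at_.
Qed.

(** A merge expressed by inclusion alone, without reference to trees, so that it is visibly
    invariant under the group. *)
Definition merge_fam F F' := exists B D, [/\ maxel F B, maxel F D, B <> D & F' = F `|` [set B `|` D]].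

Lemma merge_fam_Sfam a b u : valid (a +` (b +` u))%mset ->
  merge_fam (Sfam (a +` (b +` u))%mset) (Sfam (node a b +` u)%mset).
Proof.
move=> v; have ax : a \in (a +` (b +` u))%mset by rewrite in_msetD mset11.
have bx : b \in (a +` (b +` u))%mset by rewrite !in_msetD mset11 orbT.
exists (top a), (top b); split.
- by apply/maxel_Sfam => //; exists a.
- by apply/maxel_Sfam => //; exists b.
- move=> ab; have [p ap] := Sfam_neq0 v (Sfam_top v ax).
  by apply: (top_disj v ap); rewrite -ab.
- by rewrite Sfam_merge.
Qed.

Lemma merge_lift x F : valid x -> merge_fam (Sfam x) F ->
  exists a b u, x = (a +` (b +` u))%mset /\ F = Sfam (node a b +` u)%mset.
Proof.
move=> vx [B [D [/maxel_Sfam -/(_ vx)[a ax ->] /maxel_Sfam -/(_ vx)[b bx ->] ab ->]]].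
have xE := msetB1K ax; have bx' : b \in (x `\ a)%mset.
  move: bx; rewrite -{1}xE in_msetD in_mset1 => /orP[/eqP ba|//].
  by case: ab; rewrite ba.
exists a, b, ((x `\ a) `\ b)%mset; rewrite Sfam_merge (msetB1K bx') xE.
by split.
Qed.

Lemma split_lift x F : valid x -> merge_fam F (Sfam x) ->
  exists2 t, t \in x & F = Sfam x `\ (top t).
Proof.
move=> vx [B [D [[FB mB] [FD mD] BD FE]]].
have nF : ~ F (B `|` D).
  move=> FBD; case: BD; rewrite -(mB _ FBD); last by move=> p; left.
  by rewrite (mD _ FBD)// => p; right.
have : maxel (Sfam x) (B `|` D).
  split; first by rewrite FE; right.
  rewrite FE => E [FEE|->//] BDE.
  have EB : E = B by apply: mB => // p Bp; apply: BDE; left.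
  have ED : E = D by apply: mD => // p Dp; apply: BDE; right.
  by case: BD; rewrite -EB.
move=> /maxel_Sfam -/(_ vx)[t tx tE]; exists t => //.
rewrite FE -tE; apply/seteqP; split=> E; last by case=> -[].
by move=> FEE; split; [left|move=> EE; apply: nF; rewrite -EE].
Qed.

End Families.

(** * Refining the leaves of a forest *)

Section Refine.
Implicit Types (u v w : label) (p : P) (a b t : tree) (x y z : state)
  (B D : set P) (F : set (set P)) (th : label -> tree).

Definition act (g : P -> P) F : set (set P) := [set g @` B | B in F].

Lemma act_id F : act id F = F.
Proof.
apply/seteqP; split=> B; first by move=> [C FC <-]; rewrite image_id.
by move=> FB; exists B; rewrite // image_id.
Qed.

Lemma actU g F F' : act g (F `|` F') = act g F `|` act g F'.
Proof. exact: image_setU. Qed.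

Lemma act_set1 g B : act g [set B] = [set g @` B].
Proof. exact: image_set1. Qed.

Fixpoint tbind th t : tree := match t with
  | Leaf w => th w | Node a b => node (tbind th a) (tbind th b) end.

Lemma tbind_node th a b : tbind th (node a b) = node (tbind th a) (tbind th b).
Proof. by case: (nodeE a b) => -> //=; rewrite nodeC. Qed.

Lemma leaves_tbind th t :
  perm_eq (leaves (tbind th t)) (flatten [seq leaves (th w) | w <- leaves t]).
Proof.
elim: t => [w|a IHa b IHb] /=; first by rewrite cats0.
by rewrite map_cat flatten_cat (perm_trans (leaves_node _ _))// perm_cat.
Qed.

Lemma canon_tbind th t : (forall w, w \in leaves t -> canon (th w)) -> canon (tbind th t).
Proof.
elim: t => [w|a IHa b IHb] /= H; first by apply: H; rewrite mem_head.
by rewrite canon_node IHa ?IHb// => w wt; apply: H; rewrite mem_cat wt ?orbT.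
Qed.

Lemma famt_tbind g th t :
  (forall w, w \in leaves t -> top (th w) = g @` cyl w /\ famt (th w) = act g (fam w)) ->
  top (tbind th t) = g @` top t /\ famt (tbind th t) = act g (famt t).
Proof.
elim: t => [w|a IHa b IHb] /= H; first by apply: H; rewrite mem_head.
have [|ta fa] := IHa; first by move=> w wt; apply: H; rewrite mem_cat wt.
have [|tb fb] := IHb; first by move=> w wt; apply: H; rewrite mem_cat wt orbT.
by rewrite top_node famt_node ta fa tb fb !actU act_set1 image_setU.
Qed.

Definition sbind th x : state := seq_mset (map (tbind th) x).

Lemma sbindD th x y : sbind th (x `+` y)%mset = (sbind th x `+` sbind th y)%mset.
Proof.
rewrite /sbind -seq_mset_cat -map_cat; apply/eq_seq_msetP.
exact/perm_map/perm_msetD.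
Qed.

Lemma sbind1 th t : sbind th [mset t]%mset = [mset tbind th t]%mset.
Proof.
rewrite /sbind enum_msetn /=; apply/msetP => s.
by rewrite mset_seqE msetnE /= addn0 eq_sym; case: eqP.
Qed.

Lemma mem_sbind th x t : t \in sbind th x -> exists2 s, s \in x & t = tbind th s.
Proof. by rewrite (perm_mem (perm_eq_seq_mset _)) => /mapP. Qed.

Lemma sbind_mem th x t : t \in x -> tbind th t \in sbind th x.
Proof. by move=> tx; rewrite (perm_mem (perm_eq_seq_mset _)) map_f. Qed.

Lemma size_sbind th x : size (sbind th x) = size x.
Proof. by rewrite (perm_size (perm_eq_seq_mset _)) size_map. Qed.

Lemma lv_sbind th x :
  perm_eq (lv (sbind th x)) (flatten [seq leaves (th w) | w <- lv x]).
Proof.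
rewrite (perm_trans (perm_flatten (perm_map _ (perm_eq_seq_mset _))))//.
rewrite /lv; elim: (x : seq tree) => //= t s IHs.
by rewrite map_cat flatten_cat perm_cat// leaves_tbind.
Qed.

Lemma step_sbind th x y : step x y -> step (sbind th x) (sbind th y).
Proof.
have H a b (u : state) : step (sbind th (a +` (b +` u))%mset) (sbind th (node a b +` u)%mset).
  rewrite !sbindD !sbind1 tbind_node; apply: Or32.
  by exists (tbind th a), (tbind th b), (sbind th u).
by case=> [->|[a [b [u [-> ->]]]]|[a [b [u [-> ->]]]]]; [exact: Or31|exact: H|exact/step_sym/H].
Qed.

Lemma canons_sbind th x : (forall w, w \in lv x -> canon (th w)) -> canons (sbind th x).
Proof.
move=> H; apply/allP => _ /mem_sbind[t tx ->].
by apply: canon_tbind => w wt; apply: H; apply/mem_lvP; exists t.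
Qed.

Lemma Sfam_sbind g th x :
  (forall w, w \in lv x -> top (th w) = g @` cyl w /\ famt (th w) = act g (fam w)) ->
  Sfam (sbind th x) = act g (Sfam x).
Proof.
move=> H; have Ht t : t \in x -> famt (tbind th t) = act g (famt t).
  by move=> tx; apply: (famt_tbind _).2 => w wt; apply: H; apply/mem_lvP; exists t.
apply/seteqP; split=> B.
  move=> [_ /mem_sbind[t tx ->]]; rewrite Ht// => -[D tD <-].
  by exists D => //; exists t.
move=> [D [t tx tD] <-]; exists (tbind th t); first exact: sbind_mem.
by rewrite Ht//; exists D.
Qed.

Definition splits (f : label -> seq label) w := [/\ forall u, u \in f w -> reduced u /\ prefix w u,
  uniq (f w), forall u v, u \in f w -> v \in f w -> prefix u v -> u = v &
  forall p, cyl w p -> exists2 u, u \in f w & cyl u p].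

Lemma uniq_flatten (f : label -> seq label) s : uniq s -> (forall w, w \in s -> uniq (f w)) ->
  (forall w w' u, w \in s -> w' \in s -> u \in f w -> u \in f w' -> w = w') ->
  uniq (flatten [seq f w | w <- s]).
Proof.
elim: s => //= w s IHs /andP[ws us] uf disj; rewrite cat_uniq uf ?mem_head//=.
apply/andP; split.
  apply/hasPn => u /flatten_mapP[w' w's uw']; apply/negP => uw.
  move: ws; rewrite (disj w w' u) ?w's// ?mem_head//.
  by rewrite inE w's orbT.
apply: IHs => // [w' w's|w1 w2 u s1 s2]; first by apply: uf; rewrite inE w's orbT.
by apply: disj; rewrite inE ?s1 ?s2 orbT.
Qed.

Lemma cylpart_flatten f s : cylpart s -> (forall w, w \in s -> splits f w) ->
  cylpart (flatten [seq f w | w <- s]).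
Proof.
move=> [H1 us H3 H4] fs.
have cmp w w' u u' : w \in s -> w' \in s -> u \in f w -> u' \in f w' ->
    prefix u u' -> w = w'.
  move=> ws w's uw u'w' uu'; have [/(_ u uw)[_ wu] _ _ _] := fs w ws.
  have [/(_ u' u'w')[ru' w'u'] _ _ _] := fs w' w's.
  have [p pu] := cyl_neq0 ru'.
  have wp : cyl w p by apply: cyl_prefix pu; exact: prefix_trans uu'.
  have w'p : cyl w' p by apply: cyl_prefix pu.
  by case: (cyl_meet wp w'p) => /H3 => [|->//]; exact.
split.
- move=> u /flatten_mapP[w ws uw]; have [/(_ u uw)[ru wu] _ _ _] := fs w ws.
  split=> //; have [_] := H1 w ws; apply: contra => /eqP u0.
  by move: wu; rewrite u0; case: (w).
- apply: uniq_flatten => // [w /fs[]//|w w' u ws w's uw uw'].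
  exact: cmp uw uw' (prefix_refl u).
- move=> u u' /flatten_mapP[w ws uw] /flatten_mapP[w' w's uw'] uu'.
  have E := cmp _ _ _ _ ws w's uw uw' uu'.
  by have [_ _ H _] := fs w ws; apply: H => //; rewrite E.
- move=> p; have [w ws wp] := H4 p; have [_ _ _ /(_ p wp)[u uw up]] := fs w ws.
  by exists u => //; apply/flatten_mapP; exists w.
Qed.

Lemma valid_sbind th x : valid x -> (forall w, w \in lv x -> canon (th w)) ->
  (forall w, w \in lv x -> splits (fun w => leaves (th w)) w) -> valid (sbind th x).
Proof.
move=> [cx ox] ct st; split; first exact: canons_sbind.
apply: cylpart_perm (cylpart_flatten ox st); rewrite perm_sym; exact: lv_sbind.
Qed.

Fixpoint full w m : tree := if m is m'.+1 then node (full (c1 w) m') (full (c2 w) m') else Leaf w.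

Lemma canon_full w m : canon (full w m).
Proof. by elim: m w => //= m IHm w; rewrite canon_node !IHm. Qed.

Lemma c1_neq0 w : c1 w != [::]. Proof. by rewrite -size_eq0 size_rcons. Qed.
Lemma c2_neq0 w : c2 w != [::]. Proof. by rewrite -size_eq0 size_rcons. Qed.

Lemma famt_full w m : reduced w -> w != [::] ->
  top (full w m) = cyl w /\ famt (full w m) = fam w.
Proof.
elim: m w => //= m IHm w rw w0.
have [t1 f1] := IHm _ (reduced_c1 rw) (c1_neq0 w).
have [t2 f2] := IHm _ (reduced_c2 rw) (c2_neq0 w).
by rewrite top_node famt_node t1 t2 f1 f2 -cylE// -famE.
Qed.

Lemma size_full w m u : u \in leaves (full w m) -> size u = size w + m.
Proof.
elim: m w => [|m IHm] w /=; first by rewrite inE addn0 => /eqP ->.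
by rewrite mem_leaves_node => /orP[] /IHm ->; rewrite size_rcons addSnnS.
Qed.

Lemma full_below w m u : reduced w -> w != [::] -> u \in leaves (full w m) ->
  reduced u /\ prefix w u.
Proof.
elim: m w => [|m IHm] w rw w0 /=.
  by rewrite inE => /eqP ->; split=> //; exact: prefix_refl.
rewrite mem_leaves_node => /orP[] /IHm[]; rewrite ?c1_neq0 ?c2_neq0 ?reduced_c1 ?reduced_c2// => ru wu;
by split=> //; apply: prefix_trans wu; exact: prefix_rcons.
Qed.

Lemma uniq_full w m : reduced w -> w != [::] -> uniq (leaves (full w m)).
Proof.
elim: m w => [|m IHm] w rw w0 //=.
rewrite (perm_uniq (leaves_node _ _)) cat_uniq.
rewrite !IHm ?c1_neq0 ?c2_neq0 ?reduced_c1 ?reduced_c2 ?andbT//=.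
apply/hasPn => u /(full_below (reduced_c2 rw) (c2_neq0 w))[ru u2].
apply/negP => /(full_below (reduced_c1 rw) (c1_neq0 w))[_ u1].
have [p pu] := cyl_neq0 ru; exact: cyl_c12 (cyl_prefix u1 pu) (cyl_prefix u2 pu).
Qed.

Lemma splits_full (n : label -> nat) w : reduced w -> w != [::] ->
  splits (fun w => leaves (full w (n w))) w.
Proof.
move=> rw w0; split=> [u|||p pw].
- exact: full_below.
- exact: uniq_full.
- move=> u v /size_full su /size_full sv; rewrite prefixE => /eqP <-.
  by rewrite take_oversize// su sv.
- by apply/topP; rewrite (famt_full (n w) rw w0).1.
Qed.

Lemma cylpart_neq0 x w : valid x -> w \in lv x -> reduced w /\ w != [::].
Proof. by move=> [_ [H _ _ _]]; exact: H. Qed.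

(** A leaf already contributes all the cylinders below it, so expanding leaves into full trees
    changes the forest but not its family. *)
Lemma refine_valid (n : label -> nat) x : valid x ->
  valid (sbind (fun w => full w (n w)) x) /\ Sfam (sbind (fun w => full w (n w)) x) = Sfam x.
Proof.
move=> vx; split.
  apply: valid_sbind => // w wx; first exact: canon_full.
  by have [rw w0] := cylpart_neq0 vx wx; exact: splits_full.
rewrite -[RHS]act_id; apply: Sfam_sbind => w wx.
have [rw w0] := cylpart_neq0 vx wx; have [-> ->] := famt_full (n w) rw w0.
by rewrite image_id act_id.
Qed.

Definition split_leaf w0 : label -> nat := fun w => w == w0.

Lemma size_split_leaf w0 x : uniq (lv x) ->
  (size (lv (sbind (fun w => full w (split_leaf w0 w)) x)) <= (size (lv x)).+1)%N.
Proof.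
rewrite (perm_size (lv_sbind _ _)) size_flatten /shape -map_comp => ux.
rewrite sumnE big_map; under eq_bigr do rewrite /=.
have E w : size (leaves (full w (split_leaf w0 w))) = 1 + (w == w0).
  rewrite /split_leaf; case: eqP => //= _.
  by rewrite (perm_size (leaves_node _ _)).
under eq_bigr do rewrite E; rewrite big_split /= sum1_size -(addn1 (size (lv x))) leq_add2l.
have -> : \sum_(i <- lv x) (i == w0) = count_mem w0 (lv x).
  by elim: (lv x) => [|v s IHs]; rewrite ?big_nil// big_cons IHs.
by rewrite count_uniq_mem//; case: (_ \in _).
Qed.

End Refine.

(** * Lifting paths of families to paths of forests *)

Section Lift.
Implicit Types (u v w : label) (p : P) (a b t : tree) (x y z : state)
  (B D : set P) (F : set (set P)).

Lemma leaf_or_node t : canon t -> (exists w, t = Leaf w) \/ exists a b, t = node a b.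
Proof. by move: t; apply: canon_ind => [w|a b _ _ _ _]; [left; exists w|right; exists a, b]. Qed.

Lemma step_split a b (u : state) : step (node a b +` u)%mset (a +` (b +` u))%mset.
Proof. by apply: Or33; exists a, b, u. Qed.

Lemma step_merge a b (u : state) : step (a +` (b +` u))%mset (node a b +` u)%mset.
Proof. by apply: Or32; exists a, b, u. Qed.

(** The root of [y] with the same top cannot be a single leaf [w]: since the leaves are shared and
    prefix-free, every leaf of [a] and of [b] would equal [w], although [a] and [b] are disjoint. *)
Lemma root_match x y a b (u : state) : x = (node a b +` u)%mset -> valid x -> valid y ->
  perm_eq (lv x) (lv y) -> Sfam x = Sfam y ->
  exists a' b' (u' : state), y = (node a' b' +` u')%mset /\
    top a `|` top b = top a' `|` top b'.
Proof.
move=> xE vx vy xy fxy.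
have tx : node a b \in x by rewrite xE in_msetD mset11.
have : maxel (Sfam y) (top (node a b)).
  by rewrite -fxy; apply/maxel_Sfam => //; exists (node a b).
move=> /maxel_Sfam -/(_ vy)[t ty tE]; have ct : canon t by move: vy => [/allP/(_ _ ty)].
have [[w tw]|[a' [b' tab]]] := leaf_or_node ct; last first.
  exists a', b', (y `\ t)%mset; rewrite -tab (msetB1K ty) -top_node tE tab top_node.
  by split.
have wx : w \in lv x by rewrite (perm_mem xy); apply/mem_lvP; exists t => //; rewrite tw mem_seq1.
have [_ [H _ ac _]] := vx.
have key c : (forall v, v \in leaves c -> v \in leaves (node a b)) -> exists2 p, top c p & cyl w p.
  move=> cab; have [v vc] : exists v, v \in leaves c.
    by have := leaves_neq0 c; case: (leaves c) => // v s _; exists v; rewrite mem_head.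
  have vx' : v \in lv x by apply/mem_lvP; exists (node a b) => //; exact: cab.
  have [rv _] := H v vx'; have wv : prefix w v.
    apply: cyl_sub => // p pv; have : top (node a b) p by apply/topP; exists v => //; exact: cab.
    by rewrite tE tw.
  have E : w = v by exact: ac.
  have [p pv] := cyl_neq0 rv; exists p; last by rewrite E.
  by apply/topP; exists v.
have v' : valid (a +` (b +` u))%mset by apply: valid_step vx; rewrite xE; exact: step_split.
have [p pa pw] := key a (ltac:(by move=> v va; rewrite mem_leaves_node va)).
have [va vaP pva] : exists2 v, v \in leaves a & cyl v p by apply/topP.
have [q qb qw] := key b (ltac:(by move=> v vb; rewrite mem_leaves_node vb orbT)).
have [vb vbP qvb] : exists2 v, v \in leaves b & cyl v q by apply/topP.
have wE v r : v \in leaves (node a b) -> cyl v r -> cyl w r -> v = w.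
  move=> vab vr wr; have vx' : v \in lv x by apply/mem_lvP; exists (node a b).
  by case: (cyl_meet vr wr) => /ac; [exact|move=> /(_ wx vx') ->].
have Ea := wE va p (ltac:(by rewrite mem_leaves_node vaP)) pva pw.
have Eb := wE vb q (ltac:(by rewrite mem_leaves_node vbP orbT)) qvb qw.
by exfalso; apply: (top_disj v' pa); apply/topP; exists vb => //; rewrite Eb.
Qed.

Lemma top_split_mem a b a' b' (u u' : state) : valid (a +` (b +` u))%mset ->
  (a +` (b +` u))%mset = (a' +` (b' +` u'))%mset ->
  top a `|` top b = top a' `|` top b' -> node a b = node a' b'.
Proof.
move=> v E T; have v' := v; rewrite E in v'.
have mem c : c \in (a' +` (b' +` u'))%mset -> top c `<=` top a `|` top b -> c = a \/ c = b.
  move=> c' cab; have [p pc] := Sfam_neq0 v' (Sfam_top v' c').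
  rewrite -E in c'.
  by case: (cab p pc) => pp; [left|right]; apply: top_uniq v c' _ pc pp;
    rewrite !in_msetD mset11 ?orbT.
have a'm : a' \in (a' +` (b' +` u'))%mset by rewrite in_msetD mset11.
have b'm : b' \in (a' +` (b' +` u'))%mset by rewrite !in_msetD mset11 orbT.
have ne : a' <> b'.
  move=> ab; have [p pa] := Sfam_neq0 v' (Sfam_top v' a'm).
  by apply: (top_disj v' pa); rewrite -ab.
have := mem a' a'm; have := mem b' b'm; rewrite T => /(_ (@subsetUr _ _ _)) hb /(_ (@subsetUl _ _ _)) ha.
by case: ha ne => ->; case: hb => -> // _; rewrite nodeC.
Qed.

Lemma all_leaves x : (forall t, t \in x -> exists w, t = Leaf w) ->
  x = seq_mset [seq (Leaf w : tree) | w <- lv x].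
Proof.
move=> H; rewrite -[LHS]seq_mset_id /lv.
have {H} : forall t, t \in (x : seq tree) -> exists w, t = Leaf w by move=> t tx; exact: H.
elim: (x : seq tree) => [|t s IHs] //= H.
rewrite map_cat seq_mset_cat -IHs; last by move=> t' t's; apply: H; rewrite inE t's orbT.
have [w ->] := H t (mem_head _ _); rewrite mset_cons /=.
by apply/msetP => s'; rewrite !msetDE !mset_seqE msetnE /= addn0 eq_sym; case: eqP.
Qed.

(** Induction on [size (lv x) - size x], the number of inner nodes: matching roots are split in both
    forests. It is what closes the lift of a closed path of families. *)
Lemma Sfam_inj x y : valid x -> valid y -> perm_eq (lv x) (lv y) ->
  Sfam x = Sfam y -> x = y.
Proof.
move: {2}(size (lv x) - size x).+1 (ltnSn (size (lv x) - size x)) => k.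
elim: k x y => [|k IHk] x y xk vx vy xy fxy; first by [].
have [[a [b [u xE]]]|nx] := pselect (exists a b (u : state), x = (node a b +` u)%mset).
  have [a' [b' [u' [yE T]]]] := root_match xE vx vy xy fxy.
  have st1 := step_split a b u; have st2 := step_split a' b' u'.
  have v1 : valid (a +` (b +` u))%mset by apply: valid_step vx; rewrite xE.
  have v2 : valid (a' +` (b' +` u'))%mset by apply: valid_step vy; rewrite yE.
  have p12 : perm_eq (lv (a +` (b +` u))%mset) (lv (a' +` (b' +` u'))%mset).
    rewrite -(permPl (step_lv st1)) -(permPr (step_lv st2)).
    by rewrite -xE -yE.
  have E : (a +` (b +` u))%mset = (a' +` (b' +` u'))%mset.
    apply: IHk => //; last by rewrite !Sfam_split -?xE -?yE// fxy T.
    have := size_lv (a +` (b +` u))%mset; move: xk.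
    rewrite -(perm_size (step_lv st1)) -xE.
    have -> : size x = (size u).+1 by rewrite xE !sizeE.
    by rewrite !sizeE; move: (size (lv x)) (size u) => m n; clear; lia.
  have nE := top_split_mem v1 E T.
  rewrite xE yE nE; congr (_ `+` _)%mset; apply/msetP => t.
  have := congr1 (fun s : state => s t) E; rewrite !msetDE.
  by case: (node_inj nE) => -[-> ->]; move: (_ t) (_ t) (u t) (u' t); clear; lia.
have Lx t : t \in x -> exists w, t = Leaf w.
  move=> tx; have ct : canon t by move: vx => [/allP/(_ _ tx)].
  have [//|[a [b tE]]] := leaf_or_node ct.
  by case: nx; exists a, b, (x `\ t)%mset; rewrite -tE msetB1K.
have Ly t : t \in y -> exists w, t = Leaf w.
  move=> ty; have ct : canon t by move: vy => [/allP/(_ _ ty)].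
  have [//|[a [b tE]]] := leaf_or_node ct.
  have yE : y = (node a b +` (y `\ t))%mset by rewrite -tE msetB1K.
  have yx : perm_eq (lv y) (lv x) by rewrite perm_sym.
  have [a' [b' [u' [xE _]]]] := root_match yE vy vx yx (esym fxy).
  by case: nx; exists a', b', u'.
rewrite (all_leaves Lx) (all_leaves Ly); apply/eq_seq_msetP; exact: perm_map.
Qed.

Definition fam_move (m n : nat * set (set P)) : bool :=
  `[< [\/ m = n, m.1 = n.1.+1 /\ merge_fam m.2 n.2 | n.1 = m.1.+1 /\ merge_fam n.2 m.2] >].

Definition stepb : rel state := fun x y => `[< step x y >].

Definition sized x := (size x, Sfam x).

(** A refinement applied uniformly to all states with the leaves of [x], compatible with moves. [k]
    bounds the leaves it adds, so along a lifted path the leaves grow at most linearly. *)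
Definition refiner x k (r : state -> state) := [/\ forall y z, step y z -> step (r y) (r z),
  forall y, size (r y) = size y &
  forall y, valid y -> perm_eq (lv x) (lv y) ->
    [/\ valid (r y), Sfam (r y) = Sfam y, perm_eq (lv (r x)) (lv (r y)) &
      (size (lv (r y)) <= size (lv y) + k)%N]].

(* A move may split a root that is a single leaf; that leaf is then refined in
   all the states met before. *)
Lemma lift_path fs x : valid x -> path fam_move (sized x) fs ->
  exists r (p : seq state), [/\ refiner x (size fs) r, path stepb (r x) p & map sized p = fs].
Proof.
elim: fs x => [|[n F] fs IHfs] x vx /=.
  by move=> _; exists id, [::]; split=> //; split=> // y vy xy; split=> //; rewrite addn0.
move=> /andP[/asboolP xF fsP].
(* [r0] is the refinement demanded by the first move and [r] the one demanded by the rest of the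
   path; the first move is pushed through [r], and the refinement of the start is their
   composite. *)
have cons y (r0 : state -> state) k0 : valid y -> refiner x k0 r0 -> (k0 <= 1)%N ->
    step (r0 x) y -> sized y = (n, F) ->
    exists r (p : seq state), [/\ refiner x (size fs).+1 r, path stepb (r x) p & map sized p = (n, F) :: fs].
  move=> vy [R1 R2 R3] k01 st yF; rewrite -yF in fsP.
  have [r [p [[R1' R2' R3'] rp pE]]] := IHfs y vy fsP.
  exists (r \o r0), (r y :: p); split.
  - split=> [z z' zz'|z|z vz xz] /=; first exact/R1'/R1.
      by rewrite R2' R2.
    have [v1 s1 e1 l1] := R3 z vz xz; have [v0 s0 e0 l0] := R3 x vx (perm_refl _).
    have [|_ _ e3 _] := R3' (r0 x) v0; first by rewrite -(permPl (step_lv st)).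
    have [|v2 s2 e2 l2] := R3' (r0 z) v1; first by rewrite -(permPl (step_lv st)).
    split=> //; [by rewrite s2|by rewrite -(permPl e3)|by apply: leq_trans l2 _; apply: leq_trans (leq_add l1 (leqnn _)) _; rewrite -addnA leq_add2l; clear -k01; lia].
  - rewrite /= rp andbT; apply/asboolP; exact: R1'.
  - rewrite /= pE; congr (_ :: _); rewrite -yF /sized R2'.
    by have [_ -> _ _] := R3' y vy (perm_refl _).
have R0 : refiner x 0 id by split=> // y vy xy; split=> //; rewrite addn0.
case: xF => [xE|[/= nE mF]|[/= nE mF]].
- by apply: (cons x id 0 vx R0 isT) => //; exact: Or31.
- have [a [b [u [xE FE]]]] := merge_lift vx mF.
  have st : step x (node a b +` u)%mset by rewrite xE; exact: step_merge.
  have v1 := valid_step st vx; apply: (cons _ id 0 v1 R0 isT st).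
  rewrite /sized FE; congr pair; move: nE; rewrite xE !sizeE.
  by move: (size u) => m; clear; lia.
- have [t tx FE] := split_lift vx mF.
  have ct : canon t by move: vx => [/allP/(_ _ tx)].
  have xE := msetB1K tx.
  have [[w tE]|[a [b tE]]] := leaf_or_node ct; last first.
    have st : step x (a +` (b +` (x `\ t)))%mset by rewrite -{1}xE tE; exact: step_split.
    have v1 := valid_step st vx; apply: (cons _ id 0 v1 R0 isT st).
    have vN : valid (node a b +` (x `\ t))%mset by rewrite -tE xE.
    rewrite /sized (Sfam_split vN) -tE xE -top_node -tE FE; congr pair.
    move: nE; rewrite -[in size x]xE !sizeE.
    by move: (size (x `\ t)%mset) => m; clear; lia.
  pose r0 := sbind (fun w' => full w' (split_leaf w w')).
  have r0E : r0 x = (node (Leaf (c1 w)) (Leaf (c2 w)) +` r0 (x `\ t))%mset.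
    rewrite -{1}xE /r0 sbindD sbind1 tE /= /split_leaf eqxx//.
  have [vr sr] := refine_valid (split_leaf w) vx.
  have st : step (r0 x) (Leaf (c1 w) +` (Leaf (c2 w) +` r0 (x `\ t)))%mset.
    by rewrite r0E; exact: step_split.
  have v1 := valid_step st vr; apply: (cons _ r0 1 v1 _ isT st).
  - split=> [y z yz|y|y vy xy]; [exact: step_sbind|exact: size_sbind|].
    have [? ?] := refine_valid (split_leaf w) vy; split=> //.
      rewrite (permPl (lv_sbind _ _)) (permPr (lv_sbind _ _)).
      exact/perm_flatten/perm_map.
    by rewrite addn1; apply: size_split_leaf; case: vy => _ [].
  - have vN : valid (node (Leaf (c1 w)) (Leaf (c2 w)) +` r0 (x `\ t))%mset by rewrite -r0E.
    rewrite /sized (Sfam_split vN) -r0E sr FE.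
    have -> : top (Leaf (c1 w)) `|` top (Leaf (c2 w)) = top t.
      rewrite tE /= -cylE//.
      by apply: (cylpart_neq0 vx (w := w) _).2; apply/mem_lvP; exists t => //; rewrite tE mem_seq1.
    congr pair; move: nE; rewrite -[in size x]xE !sizeE size_sbind.
    by move: (size (x `\ t)%mset) => m; clear; lia.
Qed.

End Lift.

(** * Elements of Neretin's group *)

Section Elements.
Implicit Types (u v w : V) (x y : P) (A B : set V) (f : V -> V).

Lemma nested_cyl (s : nat -> V) :
  (forall i, exists j, s i.+1 = rcons (s i) j :> seq _) ->
  exists x, forall i, cyl (s i) x.
Proof.
move=> sS; have ss i : size (s i) = size (s 0) + i.
  by elim: i => [|i IHi]; rewrite ?addn0//; have [j ->] := sS i; rewrite size_rcons IHi addnS.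
have pre i k : prefix (s i) (s (i + k)).
  elim: k => [|k IHk]; first by rewrite addn0 prefix_refl.
  by rewrite addnS; have [j ->] := sS (i + k); apply: prefix_trans IHk (prefix_rcons _ _).
have nthE i k n : n < size (s i) -> nth ord0 (s (i + k)) n = nth ord0 (s i) n.
  by move=> ni; have /prefixP[t ->] := pre i k; rewrite nth_cat ni.
have nE n m : n < size (s m) -> nth ord0 (s n.+1) n = nth ord0 (s m) n.
  move=> nm; have nn : n < size (s n.+1) by rewrite ss; lia.
  have [mn|nm'] := leqP m n.+1; first by rewrite -(subnKC mn) nthE.
  by rewrite -[in RHS](subnKC (ltnW nm')) nthE.
pose r n := nth ord0 (s n.+1) n.
have rP n : r n != r n.+1.
  have n2 : n.+1 < size (s n.+2) by rewrite ss; lia.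
  rewrite /r (nE n n.+2); last by rewrite ss; lia.
  by have := valP (s n.+2); rewrite /reduced => /(sortedP ord0); apply.
exists (End rP) => i; rewrite /cyl /=; apply: (@eq_from_nth _ ord0); rewrite size_mkseq// => n ni.
by rewrite nth_mkseq// /r (nE n i).
Qed.

Lemma reducedV u : reduced u. Proof. exact: valP u. Qed.

Lemma cyl_trunc x n : cyl (trunc x n) x.
Proof. exact: cyl_mkseq. Qed.

Lemma trunc_prefix x m n : m <= n -> prefix (trunc x m) (trunc x n).
Proof. by move=> mn; rewrite prefixE /= size_mkseq mkseq_take. Qed.

Lemma ballP k u : Defs.ball k u -> size u <= k. Proof. by []. Qed.

Lemma truncE u x : cyl u x -> trunc x (size u) = u.
Proof. by move=> ux; apply/val_inj. Qed.

Definition up_closed A := forall u v, ~ A u -> prefix u v -> ~ A v.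
Definition child_map A f := forall u v i, ~ A u -> v = rcons u i :> seq _ ->
  exists j, f v = rcons (f u) j :> seq _.

Lemma child_map_prefix A f u v : up_closed A -> child_map A f -> ~ A u -> prefix u v ->
  prefix (f u) (f v) /\ size (f v) + size u = size (f u) + size v.
Proof.
move=> Aup Af Au /prefixP[s]; elim/last_ind: s v => [|s i IHs] v vE.
  by rewrite (_ : v = u) ?prefix_refl//; apply/val_inj; rewrite /= vE cats0.
have rv : reduced (u ++ s).
  by apply: reduced_prefixP (reducedV v); rewrite vE -rcons_cat prefix_rcons.
have [|pw sw] := IHs (Vertex rv); first by [].
have [||j ->] := Af (Vertex rv) v i; first by apply: Aup Au _; rewrite prefix_prefix.
  by rewrite vE /= rcons_cat.
split; first exact: prefix_trans pw (prefix_rcons _ _).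
rewrite size_rcons; move: sw; rewrite vE /= size_cat size_cat size_rcons.
by move: (size (f u)) (size (f _)) => a b; lia.
Qed.

(** The words [f (trunc x n)] are nested and their lengths grow by one at each step; this yields the
    image of an end and also continuity. *)
Lemma ray_map A f : finite_set A -> up_closed A -> child_map A f ->
  exists2 g : P -> P, continuous g & forall x u, ~ A u -> cyl u x -> cyl (f u) (g x).
Proof.
move=> /finite_sub_ball[k Ak] Aup Af.
have nA x n : ~ A (trunc x (k.+1 + n)).
  by move=> /Ak/ballP; rewrite size_trunc; lia.
have /choice[g gP] x : exists y, forall i, cyl (f (trunc x (k.+1 + i))) y.
  apply: (nested_cyl (s := fun i => f (trunc x (k.+1 + i)))) => i.
  by apply: Af (nA x i) _; rewrite addnS /= mkseqS.
have cP x u : ~ A u -> cyl u x -> cyl (f u) (g x).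
  move=> Au ux; apply: cyl_prefix (gP x (size u)).
  apply: (child_map_prefix Aup Af Au _).1.
  by rewrite prefixE /= mkseq_take ?ux//; lia.
exists g => //; apply/continuousP => U oU; rewrite -[open _]/(tend_open _) => x Ux.
have [n nU] := oU _ Ux; exists (k.+1 + n) => y xy.
apply: nU; have H z : trunc z (k.+1 + n) = trunc x (k.+1 + n) ->
    trunc (g z) (size (f (trunc x (k.+1 + n)))) = f (trunc x (k.+1 + n)).
  by move=> zx; apply: truncE; apply: cP (nA x n) _; rewrite -zx; exact: cyl_trunc.
have [_ sE] : prefix (f (trunc x k.+1)) (f (trunc x (k.+1 + n))) /\
    size (f (trunc x (k.+1 + n))) + size (trunc x k.+1) =
    size (f (trunc x k.+1)) + size (trunc x (k.+1 + n)).
  apply: (child_map_prefix Aup Af); first by have := nA x 0; rewrite addn0.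
  by apply: trunc_prefix; lia.
apply: (@trunc_le 2 (g x) (g y) n (size (f (trunc x (k.+1 + n))))).
  by move: sE; rewrite !size_trunc; lia.
by rewrite !H.
Qed.

Lemma adj_child u v : adj u v -> (exists i, v = rcons u i :> seq _) \/ (exists i, u = rcons v i :> seq _).
Proof. by case/adjP => i [] E; [left|right]; exists i. Qed.

(** The exceptional sets are only finite and closed under prefixes; [forest_iso_refine] supplies the
    complete subtrees demanded of an almost automorphism. *)
Lemma mk_neretin A B f f' : finite_set A -> finite_set B -> up_closed A -> up_closed B ->
  child_map A f -> child_map B f' ->
  (forall u, ~ A u -> ~ B (f u) /\ f' (f u) = u) ->
  (forall u, ~ B u -> ~ A (f' u) /\ f (f' u) = u) ->
  exists g : neretin 2, forall u, ~ A u -> g @` cyl u = cyl (f u) /\ act g (fam u) = fam (f u).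
Proof.
move=> fA fB Aup Bup Af Bf fK f'K.
have [g gc gP] := ray_map fA Aup Af; have [h hc hP] := ray_map fB Bup Bf.
have tail C (x y : P) : finite_set C -> (forall u, ~ C u -> cyl u x -> cyl u y) -> y = x.
  move=> /finite_sub_ball[k Ck] H; apply: tend_eq => n.
  have : cyl (trunc x (maxn k.+1 n.+1)) y.
    apply: H (cyl_trunc _ _) => /Ck/ballP; rewrite size_trunc.
    by rewrite leqNgt leq_max ltnSn.
  rewrite /cyl /= size_mkseq => /(congr1 (fun s => nth ord0 s n)).
  by rewrite !nth_mkseq// leq_max ltnSn orbT.
have gK : cancel g h.
  move=> x; apply: (tail A) => // u Au ux; have [nB <-] := fK u Au.
  exact/hP/gP.
have hK : cancel h g.
  move=> x; apply: (tail B) => // u Bu ux; have [nA <-] := f'K u Bu.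
  exact/gP/hP.
have iso : forest_iso A B f.
  split; first split.
  - by move=> u /fK[].
  - by move=> u v; rewrite !in_setE => /fK[_ uE] /fK[_ vE] E; rewrite -uE -vE E.
  - by move=> u /f'K[? ?]; exists (f' u).
  have dir C e u v : child_map C e -> ~ C u -> ~ C v -> adj u v -> adj (e u) (e v).
    by move=> Ce Cu Cv /adj_child[] [i] /Ce => [/(_ Cu)|/(_ Cv)] [j E]; apply/adjP; exists j; [left|right].
  move=> u v Au Av; apply/idP/idP; last exact: (dir A f).
  have [Bu uE] := fK u Au; have [Bv vE] := fK v Av.
  by rewrite -{2}uE -{2}vE; exact: (dir B f').
have [F [F' [cF cF' Fiso]]] := forest_iso_refine fA fB iso.
have gn : almost_automorphism g.
  split; first by split=> //; exists h; split.
  exists F, F', f; split=> // x; have [k Ak] := finite_sub_ball fA.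
  exists k.+1 => // n /= kn; exists (size (f (trunc x n))); apply/esym/truncE.
  by apply: gP (cyl_trunc _ _) => /Ak/ballP; rewrite size_trunc leqNgt kn.
have gE u : ~ A u -> g @` cyl u = cyl (f u).
  move=> Au; apply/seteqP; split=> [_ [x ux <-]|y yu]; first exact: gP.
  have [nB uE] := fK u Au; exists (h y); last exact: hK.
  by rewrite -uE; exact: hP nB yu.
exists (Neretin gn) => u Au; split; first exact: gE.
apply/seteqP; split=> [_ [_ [v [rv uv] <-] <-]|_ [v [rv uv] <-]].
  have Av : ~ A (Vertex rv) by exact: Aup Au _.
  rewrite /= (gE (Vertex rv) Av); exists (f (Vertex rv)) => //; split; first exact: reducedV.
  by have [] := child_map_prefix (v := Vertex rv) Aup Af Au uv.
have [nB uE] := fK u Au; have nBv : ~ B (Vertex rv) by exact: Bup nB _.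
have [nA vE] := f'K _ nBv; exists (cyl (f' (Vertex rv))); last by rewrite /= gE// vE.
exists (f' (Vertex rv)) => //; split; first exact: reducedV.
by have [] := child_map_prefix (v := Vertex rv) Bup Bf nB uv; rewrite uE.
Qed.

Implicit Types (a b t : label) (l : seq (label * label)).

(** Replaces the prefix [a] of [t] by [b]. The transposition carries the letters allowed after [a]
    to those allowed after [b], so the result stays reduced. *)
Definition pr a b t : label := b ++ map (tperm (lst a) (lst b)) (drop (size a) t).

Definition outside (s : seq label) : set V := [set u | forall a, a \in s -> ~~ prefix a u].

Lemma outside_up s : up_closed (outside s).
Proof.
move=> u v Au uv Av; apply: Au => a sa; apply/negP => au.
by have /negP := Av a sa; apply; exact: prefix_trans uv.
Qed.

Lemma insideP s u : ~ outside s u -> exists2 a, a \in s & prefix a u.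
Proof.
move=> H; apply: contrapT => nE; apply: H => a sa; apply/negP => au.
by apply: nE; exists a.
Qed.

Lemma finite_outside s : cylpart s -> finite_set (outside s).
Proof.
move=> [_ _ _ cov]; apply: (@sub_finite_set _ _ (Defs.ball (\max_(a <- s) size a))); last exact: finite_ball.
move=> u Au; have [x ux] := cyl_neq0 (reducedV u); have [a sa ax] := cov x.
have au : prefix u a.
  by case: (cyl_meet ux ax) => // au; have := Au a sa; rewrite au.
apply: leq_trans (size_prefix au) _; exact: (@leq_bigmax_seq _ _ xpredT size).
Qed.

Lemma reduced_pr a b t : reduced b -> a != [::] -> b != [::] -> reduced t ->
  prefix a t -> reduced (pr a b t).
Proof.
move=> rb a0 b0 rt /prefixP[s tE]; move: rt; rewrite /pr {}tE drop_size_cat//.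
case: a a0 => // i a _; case: b b0 rb => // j b _ rb.
rewrite /reduced /= !cat_path => /andP[_]; rewrite -[path _ j b]/(reduced (j :: b)) rb /= -/(lst (i :: a)) -/(lst (j :: b)).
set sg := tperm _ _; have -> : last j b = sg (last i a) by rewrite /sg tpermL.
by rewrite path_map; apply: sub_path => k m; rewrite /relpre /= (inj_eq perm_inj).
Qed.

Lemma uniq_pair l a b b' : uniq (unzip1 l) -> (a, b) \in l -> (a, b') \in l -> b = b'.
Proof.
elim: l => // -[a1 b1] l IHl /= /andP[al ul]; rewrite !inE.
have nl c : (a1, c) \in l -> False by move=> /(map_f fst); rewrite (negbTE al).
case/orP=> [/eqP[-> ->]|ab]; case/orP=> [/eqP[]|ab'].
- by [].
- by move/nl: ab'.
- by move=> E _; move: ab; rewrite E => /nl.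
- exact: IHl ab ab'.
Qed.

Lemma pr_map l : cylpart (unzip1 l) -> cylpart (unzip2 l) ->
  exists2 f : V -> V, child_map (outside (unzip1 l)) f &
    forall a b u, (a, b) \in l -> prefix a u -> f u = pr a b u :> label.
Proof.
move=> [R1 u1 ac1 _] [R2 _ _ _].
have sel u a b a' b' : (a, b) \in l -> (a', b') \in l -> prefix a u -> prefix a' u ->
    a = a' /\ b = b'.
  move=> ab ab' au au'; have [x ux] := cyl_neq0 (reducedV u).
  have al : a \in unzip1 l by exact: (map_f fst ab).
  have al' : a' \in unzip1 l by exact: (map_f fst ab').
  have E : a = a'.
    by case: (cyl_meet (cyl_prefix au ux) (cyl_prefix au' ux)) => /ac1 => [|->//]; exact.
  by split=> //; move: ab'; rewrite -E; exact: uniq_pair u1 ab.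
have /choice[f fP] u : exists u' : V, forall a b, (a, b) \in l -> prefix a u -> u' = pr a b u :> label.
  have [[[a b] /= [ab au]]|nab] := pselect (exists c, c \in l /\ prefix c.1 u); last first.
    by exists u => a b ab au; case: nab; exists (a, b).
  have [ra a0] := R1 a (map_f fst ab); have [rb b0] := R2 b (map_f snd ab).
  exists (Vertex (reduced_pr rb a0 b0 (reducedV u) au)) => a' b' ab' au' /=.
  by have [-> ->] := sel _ _ _ _ _ ab ab' au au'.
exists f; last by move=> a b u; exact: fP.
move=> u v i /insideP[a /mapP[[a' b] ab /= ->] au] vE.
exists (tperm (lst a') (lst b) i); rewrite (fP u _ _ ab au) (fP v _ _ ab); last first.
  by rewrite vE; exact: prefix_trans au (prefix_rcons _ _).
by rewrite vE /pr drop_rcons ?size_prefix// map_rcons rcons_cat.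
Qed.

Lemma prefix_map l : cylpart (unzip1 l) -> cylpart (unzip2 l) -> exists g : neretin 2,
  forall a b, (a, b) \in l -> g @` cyl a = cyl b /\ act g (fam a) = fam b.
Proof.
move=> o1 o2; have [f cf fE] := pr_map o1 o2.
pose l' := [seq (c.2, c.1) | c <- l].
have E1 : unzip1 l' = unzip2 l by rewrite /unzip1 -map_comp.
have E2 : unzip2 l' = unzip1 l by rewrite /unzip2 -map_comp.
have [f' cf' f'E] : exists2 f' : V -> V, child_map (outside (unzip1 l')) f' &
    forall a b u, (a, b) \in l' -> prefix a u -> f' u = pr a b u :> label.
  by apply: pr_map; rewrite ?E1 ?E2.
rewrite E1 in cf'.
have memS a b : (a, b) \in l -> (b, a) \in l' by move=> ab; apply/mapP; exists (a, b).
have memS' a b : (a, b) \in l' -> (b, a) \in l by case/mapP => -[c d] cd [-> ->].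
have prK a b u : prefix a u -> pr b a (pr a b u) = u.
  move=> /prefixP[s ->]; rewrite /pr !drop_size_cat// -map_comp tpermC; congr (_ ++ _).
  by rewrite (eq_map (g := id)) ?map_id// => i /=; rewrite tpermK.
have [g gP] : exists g : neretin 2, forall u, ~ outside (unzip1 l) u ->
    g @` cyl u = cyl (f u) /\ act g (fam u) = fam (f u).
  apply: (mk_neretin (B := outside (unzip2 l)) (f' := f')) => //; try exact: finite_outside; try exact: outside_up.
  - move=> u /insideP[_ /mapP[[a b] ab /= ->] au]; have fuE := fE _ _ _ ab au.
    have bu : prefix b (f u) by rewrite fuE prefix_prefix.
    split; first by move=> /(_ b (map_f snd ab)); rewrite bu.
    by apply/val_inj => /=; rewrite (f'E _ _ _ (memS _ _ ab) bu) fuE prK.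
  - move=> u /insideP[_ /mapP[[a b] ab /= ->] bu]; have fuE := f'E _ _ _ (memS _ _ ab) bu.
    have au : prefix a (f' u) by rewrite fuE prefix_prefix.
    split; first by move=> /(_ a (map_f fst ab)); rewrite au.
    by apply/val_inj => /=; rewrite (fE _ _ _ ab au) fuE prK.
exists g => a b ab; have [_ _ _ _] := o1; have [R1 _ _ _] := o1.
have [ra _] := R1 a (map_f fst ab).
have := gP (Vertex ra); rewrite (fE _ _ (Vertex ra) ab (prefix_refl _)) /= /pr drop_size cats0.
by apply; move=> /(_ a (map_f fst ab)); rewrite prefix_refl.
Qed.

End Elements.

(** * Transitivity on families with a given number of pieces *)

Section Realize.
Implicit Types (u v w : label) (p : P) (a b t : tree) (x y z : state)
  (B D : set P) (F : set (set P)) (s : seq label) (g h : neretin 2).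

Definition lstate s : state := seq_mset [seq (Leaf w : tree) | w <- s].

Lemma mem_lstate s t : t \in lstate s = (t \in [seq (Leaf w : tree) | w <- s]).
Proof. exact: perm_mem (perm_eq_seq_mset _) _. Qed.

Lemma lv_lstate s : perm_eq (lv (lstate s)) s.
Proof.
rewrite (perm_trans (perm_flatten (perm_map _ (perm_eq_seq_mset _))))//.
by rewrite -map_comp; elim: s => //= w s; rewrite perm_cons.
Qed.

Lemma size_lstate s : size (lstate s) = size s.
Proof. by rewrite (perm_size (perm_eq_seq_mset _)) size_map. Qed.

Lemma valid_lstate s : cylpart s -> valid (lstate s).
Proof.
move=> os; split; last by apply: cylpart_perm os; rewrite perm_sym; exact: lv_lstate.
by apply/allP => t; rewrite mem_lstate => /mapP[w _ ->].
Qed.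

Definition Std s := Sfam (lstate s).

Lemma StdP s B : Std s B <-> exists2 w, w \in s & fam w B.
Proof.
split=> [[t]|[w ws wB]]; first by rewrite mem_lstate => /mapP[w ws ->]; exists w.
by exists (Leaf w) => //; rewrite mem_lstate map_f.
Qed.

Lemma maxel_Std s B : cylpart s -> maxel (Std s) B <-> exists2 w, w \in s & B = cyl w.
Proof.
move=> os; split=> [/(maxel_Sfam _ (valid_lstate os))[t]|[w ws ->]].
  by rewrite mem_lstate => /mapP[w ws ->] ->; exists w.
by apply/(maxel_Sfam _ (valid_lstate os)); exists (Leaf w) => //; rewrite mem_lstate map_f.
Qed.

(* [Std (srt n)] is the standard family with n + 3 maximal elements. *)
Definition refine_head s := if s is w :: s' then c1 w :: c2 w :: s' else [::].
Fixpoint srt n : seq label := if n is n'.+1 then refine_head (srt n') else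
  [seq [:: i] | i <- enum 'I_3].

Lemma size_srt n : size (srt n) = n + 3.
Proof.
elim: n => [|n] /=; first by rewrite size_map size_enum_ord.
by case: (srt n) => [|w s] //=; [rewrite addnS|move=> ->].
Qed.

Lemma cylpart_refine_head s : cylpart s -> cylpart (refine_head s).
Proof.
case: s => // w s os; have [H us _ _] := os.
have : cylpart (flatten [seq leaves (full v (split_leaf w v)) | v <- w :: s]).
  by apply: cylpart_flatten => // v /H[rv v0]; exact: splits_full.
apply: cylpart_perm; rewrite /= /split_leaf eqxx /= -[c1 w :: _]/([:: c1 w; c2 w] ++ s) perm_cat//.
  exact: leaves_node.
case/andP: us => ws _; elim: s ws {os H} => //= v s IHs; rewrite inE => /norP[wv /IHs].
by rewrite [v == w]eq_sym (negbTE wv) /= perm_cons.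
Qed.

Lemma cylpart_srt n : cylpart (srt n).
Proof.
elim: n => [|n IHn]; last exact: cylpart_refine_head.
split=> /=.
- by move=> w /mapP[i _ ->].
- by rewrite map_inj_uniq ?enum_uniq// => i j [].
- by move=> _ _ /mapP[i _ ->] /mapP[j _ ->] /=; rewrite andbT => /eqP ->.
- by move=> p; exists [:: p 0]; [rewrite map_f ?mem_enum|].
Qed.

(** Copies the shape of [t] below the word [v] and pairs each leaf of the copy with the
    corresponding leaf of [t]. *)
Fixpoint pairs t v : seq (label * label) := match t with
  | Leaf w => [:: (v, w)]
  | Node a b => pairs a (c1 v) ++ pairs b (c2 v) end.

Lemma unzip2_pairs t v : unzip2 (pairs t v) = leaves t.
Proof. by elim: t v => //= a IHa b IHb v; rewrite /unzip2 map_cat -!/(unzip2 _) IHa IHb. Qed.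

Lemma pairs_below t v u : reduced v -> v != [::] -> u \in unzip1 (pairs t v) ->
  reduced u /\ prefix v u.
Proof.
elim: t v => [w|a IHa b IHb] v rv v0 /=.
  by rewrite inE => /eqP ->; rewrite prefix_refl.
rewrite /unzip1 map_cat mem_cat => /orP[/IHa|/IHb];
  rewrite ?c1_neq0 ?c2_neq0 ?reduced_c1 ?reduced_c2// => /(_ isT isT)[ru vu];
  by split=> //; apply: prefix_trans vu; exact: prefix_rcons.
Qed.

Lemma splits_pairs t v : reduced v -> v != [::] -> splits (fun v => unzip1 (pairs t v)) v.
Proof.
elim: t v => [w|a IHa b IHb] v rv v0.
  split=> //= [u|u u'|p vp].
  - by rewrite inE => /eqP ->; rewrite prefix_refl.
  - by rewrite !inE => /eqP -> /eqP ->.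
  - by exists v; rewrite ?mem_head.
have r1 := reduced_c1 rv; have r2 := reduced_c2 rv.
have [_ ua aca cova] := IHa _ r1 (c1_neq0 v); have [_ ub acb covb] := IHb _ r2 (c2_neq0 v).
have disj u u' p : prefix (c1 v) u -> prefix (c2 v) u' -> cyl u p -> cyl u' p -> False.
  by move=> h1 h2 /(cyl_prefix h1) q1 /(cyl_prefix h2) q2; exact: cyl_c12 q1 q2.
have Ha u := @pairs_below a _ u r1 (c1_neq0 v); have Hb u := @pairs_below b _ u r2 (c2_neq0 v).
split=> [u|||p vp].
- exact: pairs_below.
- rewrite /= /unzip1 map_cat cat_uniq ua ub andbT /=; apply/hasPn => u /Hb[ru h2].
  by apply/negP => /Ha[_ h1]; have [p pu] := cyl_neq0 ru; exact: (disj u u p).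
- move=> u u'; rewrite /= /unzip1 map_cat !mem_cat => /orP[ha|ha] /orP[hb|hb] uu'.
  + exact: aca.
  + have [_ h1] := Ha _ ha; have [ru h2] := Hb _ hb; have [p pu] := cyl_neq0 ru.
    by case: (disj _ _ p h1 h2 (cyl_prefix uu' pu) pu).
  + have [_ h1] := Hb _ ha; have [ru h2] := Ha _ hb; have [p pu] := cyl_neq0 ru.
    by case: (disj _ _ p h2 h1 pu (cyl_prefix uu' pu)).
  + exact: acb.
- move: vp; rewrite cylE// => -[/cova|/covb] [u up pu]; exists u => //;
  by rewrite /= /unzip1 map_cat mem_cat up ?orbT.
Qed.

Lemma map_nth_index (T T' : eqType) (d : T') (q : seq T) (r : seq T') : uniq q -> size r = size q ->
  [seq nth d r (index k q) | k <- q] = r.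
Proof.
elim: q r => [|k q IHq] [|e r] //= /andP[kq uq] [rq]; rewrite eqxx /=; congr (_ :: _).
rewrite -[RHS](IHq r uq rq); apply/eq_in_map => m mq.
by case: eqP => // E; rewrite E mq in kq.
Qed.

(** Each piece of the standard partition is subdivided in the shape of one root of [x]. Both
    partitions into cylinders then correspond leaf by leaf, and [prefix_map] gives the element. *)
Lemma realize x n : valid x -> size x = n + 3 ->
  exists g, act g (Std (srt n)) = Sfam x.
Proof.
move=> vx sx; have on := cylpart_srt n; have [H1 un _ _] := on.
pose tr v := nth (Leaf [::]) x (index v (srt n)).
have xE : [seq tr v | v <- srt n] = x by apply: map_nth_index => //; rewrite size_srt.
pose l := flatten [seq pairs (tr v) v | v <- srt n].
have l2 : unzip2 l = lv x.
  rewrite /l /unzip2 map_flatten -map_comp /lv -[in RHS]xE -map_comp; congr flatten.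
  by apply: eq_map => v /=; rewrite -/(unzip2 _) unzip2_pairs.
have l1 : unzip1 l = flatten [seq unzip1 (pairs (tr v) v) | v <- srt n].
  by rewrite /l /unzip1 map_flatten -map_comp.
have [g gP] : exists g, forall v w, (v, w) \in l -> g @` cyl v = cyl w /\ act g (fam v) = fam w.
  apply: prefix_map; last by rewrite l2; case: vx.
  by rewrite l1; apply: cylpart_flatten => // v /H1[rv v0]; exact: (splits_pairs (tr v)).
have key t v : reduced v -> v != [::] -> {subset pairs t v <= l} ->
    g @` cyl v = top t /\ act g (fam v) = famt t.
  elim: t v => [w|a IHa b IHb] v rv v0 sub /=.
    by apply: gP; apply: sub; rewrite mem_head.
  have [|ta fa] := IHa (c1 v) (reduced_c1 rv) (c1_neq0 v).
    by move=> c ca; apply: sub; rewrite mem_cat ca.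
  have [|tb fb] := IHb (c2 v) (reduced_c2 rv) (c2_neq0 v).
    by move=> c ca; apply: sub; rewrite mem_cat ca orbT.
  by rewrite famE// !actU act_set1 cylE// image_setU ta tb fa fb.
have {}key v : v \in srt n -> act g (fam v) = famt (tr v).
  move=> vs; have [rv v0] := H1 v vs; apply: (key _ _ rv v0 _).2 => c cv.
  by apply/flatten_mapP; exists v.
have trm v : v \in srt n -> tr v \in (x : seq tree).
  by move=> vs; have := map_f tr vs; rewrite [map tr _]xE.
have trP t : t \in (x : seq tree) -> exists2 v, v \in srt n & t = tr v.
  by rewrite -[X in t \in X]xE => /mapP.
exists g; apply/seteqP; split=> B.
  move=> [D /StdP[v vs vD] <-]; exists (tr v); first exact: trm.
  by rewrite -key//; exists D.
move=> [t /trP[v vs tE] tB]; move: tB; rewrite tE -key// => -[D vD <-].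
by exists D => //; apply/StdP; exists v.
Qed.

End Realize.

(** * Topology *)

Section Stabilizers.
Implicit Types (u v w : V) (x y : P) (A : set V) (F : set (set P)) (g h : N) (f : V -> V).

Lemma imM g h (B : set P) : (g * h)%g @` B = g @` (h @` B).
Proof. by rewrite image_comp. Qed.

Lemma actM g h F : act (g * h)%g F = act g (act h F).
Proof.
rewrite /act image_comp; apply: eq_imagel => B _ /=; exact: imM.
Qed.

Lemma act1 F : act (1%g : N) F = F.
Proof. exact: act_id. Qed.

Lemma actK g F : act (g^-1)%g (act g F) = F.
Proof. by rewrite -actM mulVg act1. Qed.

Lemma actKV g F : act g (act (g^-1)%g F) = F.
Proof. by rewrite -actM mulgV act1. Qed.

Lemma imK g (B : set P) : (g^-1)%g @` (g @` B) = B.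
Proof. by rewrite -imM mulVg image_id. Qed.

Lemma imKV g (B : set P) : g @` ((g^-1)%g @` B) = B.
Proof. by rewrite -imM mulgV image_id. Qed.

Lemma im_inj g (B D : set P) : g @` B = g @` D -> B = D.
Proof. by move=> E; rewrite -(imK g B) E imK. Qed.

(* [K] is the stabiliser of the base vertex of the tree in its automorphism
   group, and the [U k] form a basis of neighbourhoods of 1. *)
Definition K : set N := [set g | act g fam0 = fam0].
Definition fixes A : set N := [set g | K g /\ forall v, A v -> g @` cyl v = cyl v].
Definition U k := fixes (Defs.ball k).

Lemma fixes1 A : fixes A 1%g.
Proof. by split; [exact: act1|move=> v _; exact: image_id]. Qed.

Lemma fixesM A g h : fixes A g -> fixes A h -> fixes A (g * h)%g.
Proof.
move=> [Kg fg] [Kh fh]; split; first by rewrite /K /= actM Kh Kg.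
by move=> v Av; rewrite imM fh// fg.
Qed.

Lemma fixesV A g : fixes A g -> fixes A (g^-1)%g.
Proof.
move=> [Kg fg]; split; first by rewrite /K /= -{1}Kg actK.
by move=> v Av; rewrite -{1}(fg v Av) imK.
Qed.

Lemma fixes_sub A A' : A `<=` A' -> fixes A' `<=` fixes A.
Proof. by move=> AA' g [Kg fg]; split=> // v /AA'/fg. Qed.

Lemma U_sub j k : (j <= k)%N -> U k `<=` U j.
Proof. by move=> jk; apply: fixes_sub => v /ballP vj; exact: leq_trans vj jk. Qed.

Lemma fixesK A g : fixes A g -> K g. Proof. by case. Qed.

Lemma KM g h : K g -> K h -> K (g * h)%g.
Proof. by move=> Kg Kh; rewrite /K /= actM Kh Kg. Qed.

Lemma KV g : K g -> K (g^-1)%g.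
Proof. by move=> Kg; rewrite /K /= -{1}Kg actK. Qed.

Lemma U0E : U 0 = K.
Proof.
apply/seteqP; split=> [g [] //|g Kg]; split=> // v /ballP; rewrite leqn0 size_eq0 => /eqP vE.
have -> : cyl v = setT by rewrite vE; apply/seteqP.
apply/seteqP; split=> // x _; exists ((g^-1)%g x) => //.
exact: (neretin_invK g).2.
Qed.

Definition root : V := @Vertex 2 [::] isT.

Lemma cyl_root : cyl (root : label) = setT. Proof. exact/seteqP. Qed.

Lemma cylV_inj u v : cyl u = cyl v -> u = v.
Proof. by move/(cyl_inj (reducedV u) (reducedV v))/val_inj. Qed.

Lemma im_setT g : g @` setT = setT.
Proof.
apply/seteqP; split=> // x _; exists ((g^-1)%g x) => //.
exact: (neretin_invK g).2.
Qed.

Lemma fam0P B : fam0 B <-> exists2 v : V, v != root & B = cyl v.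
Proof.
split=> [[u [ru u0] <-]|[v v0 ->]]; first by exists (Vertex ru).
exists v => //; split; first exact: reducedV.
by move: v0; rewrite -val_eqE.
Qed.

Lemma K_map g : K g -> exists f f', [/\ cancel f f', cancel f' f &
  forall v, g @` cyl v = cyl (f v)].
Proof.
have key h : K h -> exists f, forall v, h @` cyl v = cyl (f v).
  move=> Kh; have /choice[f fP] v : exists w : V, h @` cyl v = cyl w.
    have [->|v0] := eqVneq v root; first by exists root; rewrite cyl_root im_setT.
    have : fam0 (h @` cyl v) by rewrite -Kh; exists (cyl v) => //; apply/fam0P; exists v.
    by move=> /fam0P[w _ wE]; exists w.
  by exists f.
move=> Kg; have [f fP] := key g Kg; have [f' f'P] := key _ (KV Kg).
exists f, f'; split=> // v; apply: cylV_inj.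
  by rewrite -f'P -fP imK.
by rewrite -fP -f'P imKV.
Qed.

Definition prefix_preserving f := forall u v, prefix (f u) (f v) = prefix u v.

Lemma cyl_subE u v : prefix u v <-> cyl v `<=` cyl u.
Proof. by split=> [|/cyl_sub]; [exact: cyl_prefix|apply; exact: reducedV]. Qed.

Lemma image_sub g (B D : set P) : g @` B `<=` g @` D <-> B `<=` D.
Proof.
split=> BD; last exact: image_subset.
by rewrite -(imK g B) -(imK g D); exact: image_subset.
Qed.

Lemma iso_prefix g f : (forall v, g @` cyl v = cyl (f v)) -> prefix_preserving f.
Proof.
move=> fP u v; apply/idP/idP; last by move=> /cyl_subE uv; apply/cyl_subE; rewrite -!fP; exact/image_sub.
by move=> /cyl_subE uv; apply/cyl_subE; move: uv; rewrite -!fP => /image_sub.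
Qed.

Lemma prefix_child u v i : v = rcons u i :> label -> forall w, prefix u w -> prefix w v ->
  w = u \/ w = v.
Proof.
move=> vE w uw wv; have := size_prefix wv; have := size_prefix uw.
rewrite vE size_rcons => h1 h2.
have [E|ne] := eqVneq (size w) (size u); [left|right]; apply/val_inj => /=.
  by move: uw; rewrite prefixE -E take_size => /eqP.
have E : size w = size v by rewrite vE size_rcons; apply/eqP; rewrite eqn_leq h2 ltn_neqAle eq_sym ne.
by move: wv; rewrite prefixE E take_size => /eqP ->.
Qed.

(** Being a child is expressible by the prefix order: no word lies strictly between a word and its
    child. *)
Lemma iso_child f f' : cancel f f' -> cancel f' f -> prefix_preserving f -> child_map set0 f.
Proof.
move=> fK f'K fb u v i _ vE; have uv : prefix u v by rewrite vE prefix_rcons.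
have := uv; rewrite -fb => /prefixP[[|j s] fvE].
  have E : v = u by apply: (can_inj fK); apply/val_inj; rewrite /= fvE cats0.
  by move: vE; rewrite E => /(congr1 size); rewrite size_rcons => /eqP; rewrite ltn_eqF.
have rw : reduced (rcons (f u) j).
  by apply: reduced_prefixP (reducedV (f v)); rewrite fvE -cat_rcons prefix_prefix.
pose w : V := Vertex rw; have wE : w = f (f' w) by rewrite f'K.
have uw : prefix u (f' w) by rewrite -fb -wE prefix_rcons.
have wv : prefix (f' w) v by rewrite -fb -wE fvE /= -cat_rcons prefix_prefix.
case: (prefix_child vE uw wv) => E.
  move: wE; rewrite E => /(congr1 (fun z : V => size z)) /=.
  by rewrite size_rcons => /esym/eqP; rewrite ltn_eqF.
by exists j; rewrite -E -wE.
Qed.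

Lemma iso_root f f' : cancel f' f -> prefix_preserving f -> f root = root.
Proof.
move=> f'K fb; have : prefix (f root) (f (f' root)) by rewrite fb prefix0s.
by rewrite f'K prefixs0 => /eqP h; exact/val_inj.
Qed.

Lemma child_size f v : child_map set0 f -> f root = root -> size (f v) = size v.
Proof.
move=> cf f0; have up : up_closed set0 by [].
have n0 : ~ (set0 : set V) root by [].
have [_] := @child_map_prefix set0 f root v up cf n0 (prefix0s v).
by rewrite f0 /= addn0.
Qed.

Lemma K_child g : K g -> exists f f', [/\ cancel f f', cancel f' f, child_map set0 f &
  f root = root /\ forall v, g @` cyl v = cyl (f v)].
Proof.
move=> Kg; have [f [f' [fK f'K fP]]] := K_map Kg; have fb := iso_prefix fP.
exists f, f'; split=> //; [exact: iso_child fb|split=> //; exact: iso_root fb].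
Qed.

Lemma K_size g v : K g -> exists2 w : V, size w = size v & g @` cyl v = cyl w.
Proof.
move=> Kg; have [f [f' [fK f'K cf [f0 fP]]]] := K_child Kg.
by exists (f v) => //; exact: child_size.
Qed.

Lemma fixes_stab A : fixes A `<=` stabilizer A.
Proof.
move=> g [Kg gA]; have [f [f' [fK f'K cf [f0 fP]]]] := K_child Kg.
have cf' : child_map set0 f'.
  apply: (iso_child f'K fK) => u v; have := iso_prefix fP (f' u) (f' v).
  by rewrite !f'K.
have dir e u v : child_map set0 e -> Defs.adj u v -> Defs.adj (e u) (e v).
  move=> ce /adj_child[] [i E]; apply/adjP.
    by have [//|j ?] := ce _ _ i _ E; exists j; left.
  by have [//|j ?] := ce _ _ i _ E; exists j; right.
exists f; split.
- split; first by exists f'.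
  by move=> u v; apply/idP/idP; [rewrite -{2}(fK u) -{2}(fK v)|]; exact: dir.
- by move=> v /gA gv; apply: cylV_inj; rewrite -fP.
- move=> x; exists 0 => // n _; exists (size (f (trunc x n))); apply/esym/truncE.
  by rewrite -fP; exists x => //; exact: cyl_trunc.
Qed.

Lemma aut_child f : tree_automorphism f -> f root = root -> child_map set0 f.
Proof.
move=> [[f' fK f'K] fadj] f0.
have adjf u v i : v = rcons u i :> label -> Defs.adj (f u) (f v).
  by move=> vE; rewrite fadj; apply/adjP; exists i; left.
suff H n : forall u v i, (size v <= n)%N -> v = rcons u i :> label ->
    size (f u) = size u /\ exists j, f v = rcons (f u) j :> label.
  by move=> u v i _ vE; have [] := H (size v) u v i (leqnn _) vE.
elim: n => [|n IHn] u v i; first by rewrite leqn0 size_eq0 => /eqP -> /(congr1 size); rewrite size_rcons.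
move=> vn vE; have [s0] : exists s, letters u = s by exists (letters u).
case/lastP: s0 => [|s k] uE.
  have u0 : u = root by apply/val_inj; exact: uE.
  have := adjf _ _ _ vE; rewrite u0 f0 => a0; split=> //; move: a0 => /adj_child[//|[j /(congr1 size)]]; by rewrite size_rcons.
have rs : reduced s by apply: reduced_prefixP (reducedV u); rewrite uE prefix_rcons.
have [|su [j fuE]] := IHn (Vertex rs) u k _ uE.
  by move: vn; rewrite vE size_rcons.
split; first by rewrite fuE size_rcons su uE size_rcons.
case/adj_child: (adjf _ _ _ vE) => // -[m fuE'].
have E : f v = f (Vertex rs).
  by apply/val_inj => /=; move: fuE'; rewrite fuE => /rcons_inj[].
move/(can_inj fK): E => /(congr1 (fun z : V => size z)) /=.
by rewrite vE uE !size_rcons => E; exfalso; lia.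
Qed.

Lemma stab_fixes A g : A root -> stabilizer A g -> fixes A g.
Proof.
move=> A0 [f [fa fA fg]]; have f0 := fA _ A0; have cf := aut_child fa f0.
have [[f' fK f'K] _] := fa.
have gP x v : cyl v x -> cyl (f v) (g x).
  move=> vx; have [n _ nP] := fg x.
  have [|m mE] := nP (maxn n (size v)); first exact: leq_maxl.
  apply: cyl_prefix (cyl_trunc (g x) m); rewrite -mE.
  apply: (child_map_prefix _ cf _ _).1 => //.
  by rewrite -{1}(truncE vx); apply: trunc_prefix; exact: leq_maxr.
have gE v : g @` cyl v = cyl (f v).
  apply/seteqP; split=> [_ [x vx <-]|y yv]; first exact: gP.
  have yE : g ((g^-1)%g y) = y by exact: (neretin_invK g).2.
  exists ((g^-1)%g y) => //; set x := (g^-1)%g y in yE *.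
  have := gP x _ (cyl_trunc x (size v)); rewrite yE => h.
  suff <- : trunc x (size v) = v by exact: cyl_trunc.
  apply: (can_inj fK); apply/val_inj; move: h yv; rewrite /cyl /=.
  by rewrite !child_size// size_trunc => -> ->.
split; last by move=> v Av; rewrite gE fA.
rewrite /K /=; apply/seteqP; split=> B.
  move=> [_ /fam0P[v v0 ->] <-]; rewrite gE; apply/fam0P; exists (f v) => //.
  by apply: contra v0 => /eqP E; apply/eqP/(can_inj fK); rewrite E.
move=> /fam0P[v v0 ->]; exists (cyl (f' v)); last by rewrite gE f'K.
apply/fam0P; exists (f' v) => //; apply: contra v0 => /eqP E.
by rewrite -(f'K v) E f0.
Qed.

(** For a set containing the root, [stabilizer] and [fixes] coincide by [fixes_stab] and
    [stab_fixes], and every finite set of vertices lies in a ball. *)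
Lemma openP (O : set N) : open O <-> forall g, O g -> exists k, forall h, U k h -> O (g * h)%g.
Proof.
split=> [oO g Og|H].
  have [A /finite_sub_ball[k Ak] AO] := oO g Og.
  by exists k => u /(fixes_sub Ak)/fixes_stab/AO.
move=> g Og; have [k kO] := H g Og; exists (Defs.ball k); first exact: finite_ball.
by move=> h hs; apply: kO; exact: stab_fixes hs.
Qed.

Lemma nbhsU g k : nbhs g [set h | U k (g^-1 * h)%g].
Proof.
rewrite nbhsE; exists [set h | U k (g^-1 * h)%g]; last by [].
split; last by rewrite /= mulVg; exact: fixes1.
by apply/openP => h hU; exists k => h' h'U; rewrite /= mulgA; exact: fixesM.
Qed.

Lemma nbhsP g (O : set N) : nbhs g O -> exists k, forall h, U k h -> O (g * h)%g.
Proof.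
rewrite nbhsE; case=> O1 [/openP oO1 O1g] O1O; have [k kO] := oO1 g O1g.
by exists k => h hk; apply/O1O/kO.
Qed.

End Stabilizers.

(** * Deep cylinders and continuity of conjugation *)

Section Almost.
Implicit Types (u v w : V) (x y : P) (A : set V) (F : set (set P)) (g h : N) (f : V -> V) (B : set P).

Lemma parent v : v != root -> exists u i, v = rcons u i :> label.
Proof.
case: v => v vP; rewrite -val_eqE /=; case/lastP: v vP => // s i sP _.
by exists (Vertex (reduced_prefix sP)), i.
Qed.

Lemma prefix_rconsP u v i w : w = rcons v i :> label -> prefix u w -> u = w \/ prefix u v.
Proof.
move=> wE uw; have := size_prefix uw; rewrite wE size_rcons leq_eqVlt => /orP[/eqP E|E].
  left; apply/val_inj => /=; move: uw; rewrite prefixE => /eqP <-.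
  by rewrite take_oversize// E wE size_rcons.
right; move: uw; rewrite !prefixE wE -cats1 takel_cat//.
Qed.

Lemma down_closed_set k : up_closed [set u : V | (size u < k)%N].
Proof. by move=> u v uk /size_prefix uv vk; apply: uk; exact: leq_ltn_trans uv vk. Qed.

(** A forest isomorphism only respects adjacency. Below a sufficient depth it must also respect the
    direction away from the root, and hence carry cylinders to cylinders with their families. *)
Lemma almost g : exists k f, forall u, (k <= size u)%N ->
  [/\ f u != root, g @` cyl u = cyl (f u) & act g (fam u) = fam (f u)].
Proof.
have [_ [F [F' [f [[fF _ _] _ fiso fg]]]]] := nfunP g.
have [k0 Fk] := finite_sub_ball fF; have [[_ finj _] fadj] := fiso.
have nF u : (k0 < size u)%N -> ~ F u by move=> ku /Fk/ballP; rewrite leqNgt ku.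
have inj u v : (k0 < size u)%N -> (k0 < size v)%N -> f u = f v -> u = v.
  by move=> /nF nu /nF nv; apply: finj; rewrite in_setE.
(* Outside [F] the map [f] takes the root as a value at most once, so words deep enough have
   nonempty images, and only those have a parent. *)
have [k [kk0 nroot]] : exists k, (k0.+1 < k)%N /\ forall u, (k <= size u)%N -> f u != root.
  have [[v [vF v0]]|nv] := pselect (exists v, ~ F v /\ f v = root).
    exists (maxn k0.+2 (size v).+1); split; first exact: leq_maxl.
    move=> u; rewrite geq_max => /andP[ku vu]; apply/eqP => u0.
    have E : u = v by apply: finj; rewrite ?in_setE ?v0//; apply: nF; exact: ltnW.
    by rewrite E ltnn in vu.
  exists k0.+2; split=> // u ku; apply/eqP => u0; case: nv; exists u; split=> //.
  by apply: nF; exact: ltnW.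
have nbrf u : (k <= size u)%N -> forall w, Defs.adj (f u) w -> exists2 v, Defs.adj u v & w = f v.
  move=> ku; apply: (forest_iso_nbr fiso) => [|v /adj_size uv]; apply: nF; lia.
pose A := [set u : V | (size u < k)%N].
have AP u : ~ A u <-> (k <= size u)%N by rewrite leqNgt; split=> /negP.
have cf : child_map A f.
  move=> u v i /AP ku vE.
  (* For [w] below [v], the parent of [f w] is [f x] with [x] a neighbour of [w]. As long as [x]
     stays below [v], the length of the image drops; so the descent must stop, and it can only stop
     with [w = v] and [x = u]. *)
  suff H n : forall w, prefix v w -> (size (f w) <= n)%N -> exists j, f v = rcons (f u) j :> label.
    exact: (H (size (f v)) v (prefix_refl _)).
  have vk : (k < size v)%N by rewrite vE size_rcons.
  elim: n => [|n IHn] w vw; have kw : (k < size w)%N := leq_trans vk (size_prefix vw).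
    rewrite leqn0 size_eq0 => /eqP w0.
    by have := nroot w (ltnW kw); rewrite -val_eqE /= w0.
  have [q [j qE]] := parent (nroot w (ltnW kw)).
  have [|x wx xE] := nbrf w (ltnW kw) q; first by apply/adjP; exists j; right.
  rewrite qE size_rcons ltnS xE => xn.
  case: (adj_child wx) => -[m mE].
    by apply: IHn xn; apply: prefix_trans vw _; rewrite mE prefix_rcons.
  case: (prefix_rconsP mE vw) => [vwE|/IHn]; last exact.
  have xu : x = u by apply/val_inj => /=; move: mE; rewrite -vwE vE => /rcons_inj[].
  by exists j; rewrite vwE qE xE xu.
have Aup : up_closed A := @down_closed_set k.
have surj u : (k < size u)%N -> forall w, prefix (f u) w -> exists2 v : V, prefix u v & w = f v.
  move=> ku w /prefixP[s]; elim/last_ind: s w => [|s i IHs] w wE.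
    by exists u; [exact: prefix_refl|apply/val_inj; rewrite /= wE cats0].
  have rw : reduced (f u ++ s).
    by apply: reduced_prefixP (reducedV w); rewrite wE -rcons_cat prefix_rcons.
  have [//|v0 uv0 v0E] := IHs (Vertex rw); have kv := leq_trans ku (size_prefix uv0).
  have wE' : w = rcons (f v0) i :> label by rewrite -v0E /= wE rcons_cat.
  have [|x v0x xE] := nbrf v0 (ltnW kv) w; first by apply/adjP; exists i; left.
  case: (adj_child v0x) => -[m mE].
    by exists x => //; apply: prefix_trans uv0 _; rewrite mE prefix_rcons.
  have kx : ~ A x by apply/AP; move: kv; rewrite mE size_rcons.
  have [j] := cf x v0 m kx mE; rewrite -xE wE' => /(congr1 size).
  by rewrite !size_rcons => E; exfalso; move: (size (f v0)) E => n; lia.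
have gP x u : (k <= size u)%N -> cyl u x -> cyl (f u) (g x).
  move=> ku ux; have [n _ nP] := fg x.
  have [|m mE] := nP (maxn n (size u)); first exact: leq_maxl.
  apply: cyl_prefix (cyl_trunc (g x) m); rewrite -mE.
  apply: (child_map_prefix Aup cf _ _).1; first exact/AP.
  by rewrite -{1}(truncE ux); apply: trunc_prefix; exact: leq_maxr.
have gE u : (k < size u)%N -> g @` cyl u = cyl (f u).
  move=> ku; apply/seteqP; split=> [_ [x ux <-]|y yu]; first exact: gP (ltnW ku) ux.
  have yE : g ((g^-1)%g y) = y by exact: (neretin_invK g).2.
  exists ((g^-1)%g y) => //; set x := (g^-1)%g y in yE *.
  pose u' := trunc x (size u); have su : size u' = size u by rewrite size_trunc.
  have := gP x u' _ (cyl_trunc x (size u)); rewrite yE su => /(_ (ltnW ku)) yu'.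
  suff <- : u' = u by exact: cyl_trunc.
  have same v v' : size v = size v' -> (k < size v)%N -> prefix (f v) (f v') -> v' = v.
    move=> vv' kv /(surj v kv)[z vz zE]; have vk := kv.
    have E : v' = z.
      have k0v := ltn_trans (ltnW kk0) kv.
      by apply: inj zE; [rewrite -vv'|exact: leq_trans k0v (size_prefix vz)].
    apply/val_inj => /=; move: vz; rewrite -E prefixE vv' take_size => /eqP.
    by move=> ->.
  by case: (cyl_meet yu yu') => [/same -> //|/same ->//]; rewrite su.
exists k.+1, f => u ku; split; [exact/nroot/ltnW|exact: gE|].
apply/seteqP; split=> [_ [_ [v [rv uv] <-] <-]|_ [v [rv uv] <-]].
  exists (f (Vertex rv)); last by rewrite /= (gE (Vertex rv))//; exact: leq_trans ku (size_prefix uv).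
  split; first exact: reducedV.
  by apply: (child_map_prefix (v := Vertex rv) Aup cf _ uv).1; apply/AP; exact: ltnW.
have [z uz zE] := surj u ku (Vertex rv) uv.
exists (cyl z); last by rewrite gE -?zE//; exact: leq_trans ku (size_prefix uz).
by exists z => //; split=> //; exact: reducedV.
Qed.

Lemma fam_sub0 (w : V) : w != root -> fam w `<=` fam0.
Proof.
move=> w0 _ [u [ru wu] <-]; exists u => //; split=> //; apply: contra w0 => /eqP u0.
by move: wu; rewrite u0 prefixs0 => /eqP E; apply/eqP/val_inj.
Qed.

Lemma act_fam_fixed h (w : V) : w != root -> K h -> h @` cyl w = cyl w -> act h (fam w) `<=` fam w.
Proof.
move=> w0 Kh hw _ [B wB <-].
have : fam0 (h @` B) by rewrite -Kh; exists B => //; exact: fam_sub0 wB.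
move=> /fam0P[v v0 vE]; exists v; last by rewrite vE.
split; first exact: reducedV.
by apply/cyl_subE; rewrite -vE -hw; apply: image_subset; exact: fam_sub.
Qed.

(** Continuity of conjugation at 1. At a deep level [k], [g] carries cylinders to cylinders with
    their families, and [h] fixes all the finitely many images; shorter cylinders are unions of
    those of level [k]. *)
Lemma conjU g j : exists i, forall h, U i h -> U j (g^-1 * h * g)%g.
Proof.
(* [j.+1] ensures that level [k] lies below the ball of radius [j], and that [k] is positive, so
   that words of length [k] differ from the root. *)
have [k0 [f fP]] := almost g; pose k := maxn k0 j.+1.
have [i iP] : exists i, forall v, size v = k -> (size (f v) <= i)%N.
  have : finite_set (f @` Defs.ball k) by apply: finite_image; exact: finite_ball.
  move=> /finite_sub_ball[i fi]; exists i => v vk; apply: fi; exists v => //.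
  by rewrite /Defs.ball /= vk.
exists i.
suff H h : U i h -> act (g^-1 * h * g)%g fam0 `<=` fam0 /\
    forall v, Defs.ball j v -> (g^-1 * h * g)%g @` cyl v = cyl v.
  move=> h hU; have [h1 h2] := H h hU; split=> //; apply/seteqP; split=> //.
  have [h3 _] := H _ (fixesV hU); rewrite -[X in X `<=` _](actKV (g^-1 * h * g)%g).
  by apply: image_subset; move: h3; rewrite !invgM invgK mulgA.
move=> hU; have [Kh hfix] := hU; set h' := (_ * _)%g.
have key v : size v = k -> h' @` cyl v = cyl v /\ act h' (fam v) `<=` fam v.
  move=> vk; have [|fv0 gv gfv] := fP v; first by rewrite vk leq_maxl.
  have hfv : h @` cyl (f v) = cyl (f v) by apply: hfix; exact: iP.
  rewrite /h' !actM !imM gv gfv hfv -gv imK; split=> //.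
  by rewrite -[X in _ `<=` X](actK g (fam v)) gfv; apply: image_subset; exact: act_fam_fixed.
have small v : (size v <= k)%N -> h' @` cyl v = cyl v.
  move=> vk; have sub x : cyl v x -> cyl (trunc x k) `<=` cyl v.
    by move=> vx; apply: cyl_prefix; rewrite -[in X in prefix X _](truncE vx); exact: trunc_prefix.
  apply/seteqP; split=> [_ [x vx <-]|x vx].
    apply: (sub x vx); rewrite -(key _ (size_trunc x k)).1.
    by exists x => //; exact: cyl_trunc.
  have : (h' @` cyl (trunc x k)) x by rewrite (key _ (size_trunc x k)).1; exact: cyl_trunc.
  by case=> y yx <-; exists y => //; exact: sub yx.
split; last by move=> v /ballP vj; apply: small; apply: leq_trans vj _; rewrite leq_max leqnSn orbT.
move=> _ [_ /fam0P[v v0 ->] <-]; have [vk|kv] := leqP (size v) k.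
  by rewrite small//; apply/fam0P; exists v.
have sk : size (vtake k v) = k by rewrite /= size_take kv.
have k0' : vtake k v != root.
  by apply/eqP => /(congr1 (fun z : V => size z)); rewrite sk /= /k; case: maxn (leq_maxr k0 j.+1).
apply: (fam_sub0 k0'); apply: (key _ sk).2; exists (cyl v) => //; exists v => //; split; first exact: reducedV.
by rewrite prefixE /= size_take kv.
Qed.

End Almost.

(** * Completeness, and ideals of subsets of the group *)

Section Limits.
Implicit Types (u v w : V) (x y : P) (A : set V) (F : set (set P)) (g h : N) (f : V -> V) (B : set P).

Lemma prefix_rcons_ex u v : prefix u v -> size v = (size u).+1 -> exists j, v = rcons u j :> label.
Proof.
move=> /prefixP[[|j [|k s]] ->]; rewrite size_cat /=.
- by move: (size _) => m; lia.
- by exists j; rewrite cats1.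
- by move: (size u) (size s) => m n; lia.
Qed.

(** The elements [(s 0)^-1 * s n] lie in [K]. On each cylinder they, and likewise their inverses,
    are eventually constant; the eventual values give a map of words and its inverse, hence an
    element. *)
Lemma limit (s : nat -> N) : (forall n, U n ((s n)^-1 * s n.+1)%g) ->
  exists g, forall n, U n ((s n)^-1 * g)%g.
Proof.
move=> sU; pose h n := ((s 0)^-1 * s n)%g.
have hU n k : U n ((h n)^-1 * h (n + k))%g.
  elim: k => [|k IHk]; first by rewrite addn0 mulVg; exact: fixes1.
  have := fixesM IHk (U_sub (leq_addr k n) (sU (n + k))); rewrite addnS.
  by rewrite /h !invgM !invgK !mulgA !mulgK.
have hK n : K (h n).
  have h0 : h 0 = 1%g by rewrite /h mulVg.
  by have := fixesK (hU 0 n); rewrite add0n h0 invg1 mul1g.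
have stab v m : (size v <= m)%N -> h m @` cyl v = h (size v) @` cyl v.
  move=> /subnKC <-; have [_ /(_ v (leqnn _)) E] := hU (size v) (m - size v).
  by rewrite -{2}E -imM mulVKg.
have stab' v m : (size v <= m)%N -> (h m)^-1%g @` cyl v = (h (size v))^-1%g @` cyl v.
  move=> /subnKC vm; have [w wv wE] := K_size v (KV (hK (size v))).
  have [_ /(_ w) E] := fixesV (hU (size v) (m - size v)); rewrite wE.
  move: E; rewrite invgM invgK vm imM /Defs.ball /= wv leqnn => /(_ isT) <-.
  by rewrite -wE imKV.
have /choice[f fP] v : exists w : V, size w = size v /\ h (size v) @` cyl v = cyl w.
  by have [w ? ?] := K_size v (hK (size v)); exists w.
have /choice[f' f'P] v : exists w : V, size w = size v /\ (h (size v))^-1%g @` cyl v = cyl w.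
  by have [w ? ?] := K_size v (KV (hK (size v))); exists w.
have fK : cancel f f'.
  move=> v; have [s1 E1] := fP v; have [s2 E2] := f'P (f v).
  by apply: cylV_inj; rewrite -E2 s1 -E1 imK.
have f'K : cancel f' f.
  move=> v; have [s1 E1] := f'P v; have [s2 E2] := fP (f' v).
  by apply: cylV_inj; rewrite -E2 s1 -E1 imKV.
have cf : child_map set0 f.
  move=> u v i _ vE; have sv : size v = (size u).+1 by rewrite vE size_rcons.
  have [s1 E1] := fP u; have [s2 E2] := fP v; apply: prefix_rcons_ex; last by rewrite s1 s2.
  apply/cyl_subE; rewrite -E1 -E2 -(stab u (size v)) ?sv ?leqnSn//.
  by apply: image_subset; apply: cyl_prefix; rewrite vE prefix_rcons.
have cf' : child_map set0 f'.
  move=> u v i _ vE; have sv : size v = (size u).+1 by rewrite vE size_rcons.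
  have [s1 E1] := f'P u; have [s2 E2] := f'P v; apply: prefix_rcons_ex; last by rewrite s1 s2.
  apply/cyl_subE; rewrite -E1 -E2 -(stab' u (size v)) ?sv ?leqnSn//.
  by apply: image_subset; apply: cyl_prefix; rewrite vE prefix_rcons.
have up : up_closed (set0 : set V) by [].
have [g gP] : exists g : N, forall u, ~ set0 u -> g @` cyl u = cyl (f u) /\ act g (fam u) = fam (f u).
  by apply: (mk_neretin (B := set0) (f' := f')).
have {}gP v : g @` cyl v = cyl (f v) by have [|] := gP v.
have Kg : K g.
  have rE w : (w == root) = (size w == 0) by rewrite -val_eqE /= size_eq0.
  apply/seteqP; split=> B.
    move=> [_ /fam0P[v v0 ->] <-]; rewrite gP; apply/fam0P; exists (f v) => //.
    by move: v0; rewrite !rE (fP v).1.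
  move=> /fam0P[v v0 ->]; exists (cyl (f' v)); last by rewrite gP f'K.
  by apply/fam0P; exists (f' v) => //; move: v0; rewrite !rE (f'P v).1.
exists (s 0 * g)%g => n; have -> : ((s n)^-1 * (s 0 * g) = (h n)^-1 * g)%g.
  by rewrite /h invgM invgK mulgA.
split; first by apply: KM Kg; exact: KV.
by move=> v /ballP vn; rewrite imM gP -(fP v).2 -(stab v n)// imK.
Qed.

(** An ideal of subsets. It is used twice: for sets of bounded word length in [W_finite_orbit], and
    for sets on which a covering property holds along a filter in [compact_finite_orbit]. *)
Variable Good : set N -> Prop.
Hypothesis Good0 : Good set0.
Hypothesis GoodS : forall E E', E `<=` E' -> Good E' -> Good E.
Hypothesis GoodU : forall E E', Good E -> Good E' -> Good (E `|` E').

Lemma good_fibers (T : Type) (c : N -> T) E : finite_set (c @` E) ->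
  (forall h, E h -> Good (E `&` [set h' | c h' = c h])) -> Good E.
Proof.
move=> cE H.
suff key (D : set T) : finite_set D -> Good (E `&` [set h | (c @` E `&` D) (c h)]).
  by apply: GoodS (key _ cE) => h Eh; split=> //; split; exists h.
move=> /finite_setP[n]; elim: n D => [|n IHn] D.
  rewrite II0 card_eq0 => /eqP ->; apply: GoodS Good0 => h [_ []]//.
move=> /eq_cardSP[t Dt /IHn GD].
have [[h Eh ht]|nt] := pselect ((c @` E) t); last first.
  apply: GoodS GD => h [Eh [cEh Dh]]; split=> //; split=> //; split=> // E'.
  by apply: nt; rewrite -E'.
apply: GoodS (GoodU (H h Eh) GD) => h' [Eh' [cEh' Dh']].
have [E'|ne] := pselect (c h' = t); [left|right]; first by split=> //=; rewrite E'.
by split=> //; split=> //; split.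
Qed.

Lemma good_fixes (s : seq V) g E : (forall h, E h -> K (g^-1 * h)%g) ->
  (forall h, E h -> Good (E `&` [set h' | forall v, v \in s -> h' @` cyl v = h @` cyl v])) -> Good E.
Proof.
elim: s E => [|v s IHs] E EK H.
  have [[h Eh]|nE] := pselect (exists h, E h); last first.
    by apply: GoodS Good0 => h Eh; case: nE; exists h.
  by apply: GoodS (H h Eh) => h' Eh'.
apply: (good_fibers (c := fun h : N => h @` cyl v)) => [|h Eh].
  have : finite_set ((fun w : V => g @` cyl w) @` Defs.ball (size v)).
    by apply: finite_image; exact: finite_ball.
  apply: sub_finite_set => _ [h Eh <-]; have [w wv wE] := K_size v (EK h Eh).
  by exists w; [rewrite /Defs.ball /= wv|rewrite -wE imM imKV].
apply: IHs => [h' [Eh' _]|h' [Eh' hv]]; first exact: EK.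
apply: GoodS (H h' Eh') => h2 [[Eh2 h2v] h2s]; split=> // w.
by rewrite inE => /orP[/eqP ->|/h2s//]; rewrite h2v.
Qed.

(* Koenig's lemma along the chain of subgroups [U n]. *)
Lemma finite_orbit_good E : (forall g, exists j, Good [set h | U j (g^-1 * h)%g]) ->
  finite_set ((fun h => act h fam0) @` E) -> Good E.
Proof.
move=> HG fE; apply: good_fibers fE _ => g _.
apply: (@GoodS _ [set h | U 0 (g^-1 * h)%g]).
  by move=> h [_ /= hg]; rewrite /= U0E /K /= actM hg actK.
apply: contrapT => nG.
have /choice[nx nxP] (q : nat * N) : exists h, ~ Good [set h | U q.1 (q.2^-1 * h)%g] ->
    U q.1 (q.2^-1 * h)%g /\ ~ Good [set h' | U q.1.+1 (h^-1 * h')%g].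
  apply: contrapT => nex; case: q nex => n g0 /= nex.
  case: (nex); exists g0 => nG0; case: nG0.
  have [s sE] : exists s : seq V, Defs.ball n.+1 = [set` s].
    by apply/finite_seqP; exact: finite_ball.
  apply: (@good_fixes s g0) => [h [] //|h hU].
  apply: contrapT => nGh; apply: nex; exists h => _; split=> // Gh; apply: nGh.
  apply: GoodS Gh => h' [h'U h'h]; split.
    have := KM (KV (fixesK hU)) (fixesK h'U).
    by rewrite invgM invgK -mulgA mulVKg.
  by move=> v vb; rewrite imM h'h ?imK//; move: vb; rewrite sE.
pose s := fix s n := if n is n'.+1 then nx (n', s n') else g.
have sG n : ~ Good [set h | U n ((s n)^-1 * h)%g].
  by elim: n => [|n IHn] //=; have [] := nxP (n, s n) IHn.
have [n|g' g'P] := @limit s; first by have [] := nxP (n, s n) (sG n).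
have [j Gj] := HG g'; apply: (sG j); apply: GoodS Gj => h hj.
have := fixesM (fixesV (g'P j)) hj.
by rewrite /= invgM invgK -mulgA mulVKg.
Qed.

End Limits.

(** * Words *)

Section Words.
Variables (G : groupType) (S : set G).
Local Notation word := (word S).
Implicit Types (u v w r : word) (m k : nat).
Local Open Scope group_scope.

Lemma eval_nil : Defs.eval ([::] : word) = 1. Proof. exact: big_nil. Qed.

Lemma eval_cat u v : Defs.eval (u ++ v) = Defs.eval u * Defs.eval v.
Proof. exact: big_cat. Qed.

Lemma eval1 (l : S * bool) : Defs.eval [:: l] = if l.2 then (val l.1)^-1 else val l.1.
Proof. exact: big_seq1. Qed.

Lemma word_inv_cat u v : word_inv (u ++ v) = word_inv v ++ word_inv u.
Proof. by rewrite /word_inv map_cat rev_cat. Qed.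

Lemma word_invK : involutive (@word_inv G S).
Proof.
move=> w; rewrite /word_inv map_rev revK -map_comp (eq_map (g := id)) ?map_id//.
by case=> s b /=; rewrite negbK.
Qed.

Lemma size_word_inv w : size (word_inv w) = size w.
Proof. by rewrite size_rev size_map. Qed.

Lemma eval_inv w : Defs.eval (word_inv w) = (Defs.eval w)^-1.
Proof.
elim: w => [|[s b] w IHw]; first by rewrite eval_nil invg1.
rewrite -cat1s word_inv_cat !eval_cat invgM IHw; congr (_ * _).
by rewrite !eval1 /=; case: b; rewrite ?invgK.
Qed.

Local Notation feq := (@free_eq G S).

Lemma feq_catl w u v : feq u v -> feq (w ++ u) (w ++ v).
Proof.
elim=> [||u1 v1 w1 _ h1 _ h2|u1 v1 s b]; [by move=> ?; exact: free_refl|by move=> ? ? _ /free_sym|exact: free_trans h1 h2|].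
by rewrite !catA; exact: free_cancel.
Qed.

Lemma feq_catr w u v : feq u v -> feq (u ++ w) (v ++ w).
Proof.
elim=> [||u1 v1 w1 _ h1 _ h2|u1 v1 s b]; [by move=> ?; exact: free_refl|by move=> ? ? _ /free_sym|exact: free_trans h1 h2|].
by rewrite -!catA; exact: free_cancel.
Qed.

Lemma feq_mulV w : feq (w ++ word_inv w) [::].
Proof.
elim/last_ind: w => [|w [s b] IHw]; first exact: free_refl.
rewrite -cats1 word_inv_cat -catA; exact: free_trans (free_cancel w (word_inv w) s b) IHw.
Qed.

Lemma feq_Vmul w : feq (word_inv w ++ w) [::].
Proof. by have := feq_mulV (word_inv w); rewrite word_invK. Qed.

Definition conj_prod (c : seq (word * word)) : word :=
  flatten [seq p.1 ++ p.2 ++ word_inv p.1 | p <- c].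

Lemma conj_prod_cat c d : conj_prod (c ++ d) = conj_prod c ++ conj_prod d.
Proof. by rewrite /conj_prod map_cat flatten_cat. Qed.

(** Equality modulo at most [k] conjugates of relators, all gathered on the left. Unlike
    [conj_product] it compares two words, so that it composes along paths. *)
Definition weq m k u v := exists2 j, (j <= k)%N &
  exists c, [/\ size c = j, forall p, p \in c -> relator m p.2 \/ relator m (word_inv p.2) &
    feq u (conj_prod c ++ v)].

Lemma weq_refl m u : weq m 0 u u.
Proof. by exists 0 => //; exists [::]; split=> //; exact: free_refl. Qed.

Lemma weq_feq m u v : feq u v -> weq m 0 u v.
Proof. by move=> uv; exists 0 => //; exists [::]. Qed.

Lemma weq_le m k k' u v : (k <= k')%N -> weq m k u v -> weq m k' u v.
Proof. by move=> kk' [j jk H]; exists j => //; exact: leq_trans jk kk'. Qed.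

Lemma weq_trans m k k' u v w : weq m k u v -> weq m k' v w -> weq m (k + k') u w.
Proof.
move=> [j jk [c [sc rc uc]]] [j' jk' [d [sd rd vd]]]; exists (j + j')%N; first exact: leq_add.
exists (c ++ d); split; first by rewrite size_cat sc sd.
  by move=> p; rewrite mem_cat => /orP[/rc|/rd].
by rewrite conj_prod_cat -catA; exact: free_trans uc (feq_catl _ vd).
Qed.

Lemma conj_prod_conj w c : feq (w ++ conj_prod c ++ word_inv w)
  (conj_prod [seq (w ++ p.1, p.2) | p <- c]).
Proof.
elim: c => [|p c IHc]; first exact: feq_mulV.
rewrite /conj_prod /= -!/(conj_prod _) word_inv_cat.
have -> : ((w ++ p.1) ++ p.2 ++ word_inv p.1 ++ word_inv w) ++ conj_prod [seq (w ++ p0.1, p0.2) | p0 <- c] =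
   (w ++ (p.1 ++ p.2 ++ word_inv p.1)) ++ (word_inv w ++ conj_prod [seq (w ++ p0.1, p0.2) | p0 <- c]).
  by rewrite -!catA.
have -> : w ++ ((p.1 ++ p.2 ++ word_inv p.1) ++ conj_prod c) ++ word_inv w =
   (w ++ (p.1 ++ p.2 ++ word_inv p.1)) ++ (conj_prod c ++ word_inv w).
  by rewrite -!catA.
apply/feq_catl/(free_trans _ (feq_catl _ IHc)).
by rewrite catA -[X in feq X](cat0s (conj_prod c ++ _)); apply/feq_catr/free_sym/feq_Vmul.
Qed.

Lemma conj_prod_inv c : word_inv (conj_prod c) = conj_prod [seq (p.1, word_inv p.2) | p <- rev c].
Proof.
elim: c => [|p c IHc] //.
rewrite rev_cons map_rcons -cats1 conj_prod_cat -IHc /conj_prod /= -/(conj_prod c).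
by rewrite word_inv_cat cats0; congr (_ ++ _); rewrite !word_inv_cat word_invK -!catA.
Qed.

Lemma weq_sym m k u v : weq m k u v -> weq m k v u.
Proof.
move=> [j jk [c [sc rc uc]]]; exists j => //.
exists [seq (p.1, word_inv p.2) | p <- rev c]; split; first by rewrite size_map size_rev.
  by move=> _ /mapP[p + ->] /=; rewrite mem_rev word_invK => /rc[]; [right|left].
rewrite -conj_prod_inv; apply: free_sym; apply: free_trans (feq_catl _ uc) _.
by rewrite catA -[X in feq _ X]cat0s; apply/feq_catr/feq_Vmul.
Qed.

Lemma weq_catr m k w u v : weq m k u v -> weq m k (u ++ w) (v ++ w).
Proof.
move=> [j jk [c [sc rc uc]]]; exists j => //; exists c; split=> //.
by rewrite catA; exact: feq_catr.
Qed.

Lemma weq_catl m k w u v : weq m k u v -> weq m k (w ++ u) (w ++ v).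
Proof.
move=> [j jk [c [sc rc uc]]]; exists j => //; exists [seq (w ++ p.1, p.2) | p <- c]; split=> //.
- by rewrite size_map.
- by move=> _ /mapP[p /rc + ->].
apply: free_trans (feq_catl w uc) _.
apply: free_trans (feq_catr (w ++ v) (conj_prod_conj w c)).
rewrite -!catA; apply/feq_catl/feq_catl; rewrite catA -[X in feq X]cat0s.
exact/feq_catr/free_sym/feq_Vmul.
Qed.

Lemma weq_cat m k k' u u' v v' : weq m k u u' -> weq m k' v v' -> weq m (k + k') (u ++ v) (u' ++ v').
Proof. by move=> uu' vv'; apply: weq_trans (weq_catr v uu') (weq_catl u' vv'). Qed.

Lemma weq_rel m u v : Defs.eval u = Defs.eval v -> (size u + size v <= m)%N -> weq m 1 u v.
Proof.
move=> uv sm; exists 1%N => //; exists [:: ([::], u ++ word_inv v)]; split=> //.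
  move=> p; rewrite inE => /eqP -> /=; left; split; last by rewrite size_cat size_word_inv.
  by rewrite /relation /= eval_cat eval_inv uv mulgV.
rewrite /conj_prod /= !cats0 -catA -[X in feq X]cats0; apply/feq_catl/free_sym/feq_Vmul.
Qed.

(* The empty word is a relator, so the number of factors can be padded. *)
Lemma weq_conj_product m k u : weq m k u [::] -> conj_product m k u.
Proof.
move=> [j jk [c [sc rc uc]]]; exists (c ++ nseq (k - j) ([::], [::])); split.
- by rewrite size_cat size_nseq sc subnKC.
- move=> p; rewrite mem_cat => /orP[/rc//|]; rewrite mem_nseq => /andP[_ /eqP ->].
  by left; split=> //; exact: eval_nil.
- rewrite -/(conj_prod _) conj_prod_cat; have -> : conj_prod (nseq (k - j) ([::], [::])) = [::].
    by elim: (k - j)%N => [|n IHn] //=; rewrite /conj_prod /= -/(conj_prod _) IHn.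
  exact: uc.
Qed.

End Words.

(** * Word length with respect to a compact generating set *)

Section Baire.
Variable S : set N.
Hypothesis cS : compact S.
Implicit Types (g h : N).

Lemma compact_bound (Q : nat -> N -> Prop) : (forall i j g, (i <= j)%N -> Q i g -> Q j g) ->
  (forall s, S s -> exists i k, forall h, U k h -> Q i (s * h)%g) ->
  exists i, forall s, S s -> Q i s.
Proof.
move=> Qm H; have /compact_near_coveringP cov := cS.
have [|n _ nP] := @cov nat (nbhs (\oo : set_system nat)) Q _; last by exists n => s Ss; exact: (nP n (leqnn n)).
move=> s Ss; have [i [k iP]] := H s Ss.
exists ([set h | U k (s^-1 * h)%g], [set n | (i <= n)%N]) => /=.
  by split; [exact: nbhsU|exists i].
move=> [h n] /= [hk ni]; apply: Qm ni _.
by have := iP _ hk; rewrite mulVKg.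
Qed.

Definition W k : set N := [set g | exists2 w : word S, Defs.eval w = g & (size w <= k)%N].

Lemma W_mono j k : (j <= k)%N -> W j `<=` W k.
Proof. by move=> jk g [w wg wj]; exists w => //; exact: leq_trans wj jk. Qed.

Lemma W1 : W 0 1%g.
Proof. by exists [::] => //; exact: eval_nil. Qed.

Lemma WM j k g h : W j g -> W k h -> W (j + k) (g * h)%g.
Proof.
move=> [w <- wj] [v <- vk]; exists (w ++ v); first exact: eval_cat.
by rewrite size_cat leq_add.
Qed.

Lemma WV k g : W k g -> W k (g^-1)%g.
Proof. by move=> [w <- wk]; exists (word_inv w); rewrite ?eval_inv ?size_word_inv. Qed.

Lemma W_last n g : W n.+1 g -> W n g \/ exists2 s, S s & W n (g * s^-1)%g \/ W n (g * s)%g.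
Proof.
move=> [w <-]; case/lastP: w => [_|w [s b]]; first by left; exists [::].
rewrite size_rcons ltnS => wn; right; exists (val s); first exact: set_valP.
by case: b; [right|left]; exists w => //; rewrite -cats1 eval_cat eval1 /= ?mulgK ?mulgVK.
Qed.

Lemma U_meet (j : nat) (R : N -> Prop) g : (exists k, forall h, U k h -> R (g * h)%g) ->
  exists2 k, (j <= k)%N & forall h, U k h -> R (g * h)%g.
Proof.
move=> [k kP]; exists (maxn j k); first exact: leq_maxl.
by move=> h /(U_sub (leq_maxr j k))/kP.
Qed.

(** The balls [W n] are closed, as Baire's argument requires. The last letter of a word is removed;
    compactness of [S] makes the estimate uniform in that letter, and [conjU] moves the small factor
    past it. *)
Lemma W_closed n g : ~ W n g -> exists k, forall h, U k h -> ~ W n (g * h)%g.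
Proof.
elim: n g => [|n IHn] g nW.
  have g1 : g <> 1%g by move=> g1; apply: nW; rewrite g1; exact: W1.
  apply: contrapT => nk; apply: g1; apply: neretin_eq => x.
  have H k : exists2 h, U k h & (g * h = 1)%g.
    apply: contrapT => nh; apply: nk; exists k => h hU [w wE]; rewrite leqn0 size_eq0 => /eqP w0.
    by apply: nh; exists h => //; rewrite -wE w0 eval_nil.
  apply: tend_eq => k; have [h hU gh] := H k.+1.
  have [_ fh] := fixesV hU; have bx : Defs.ball k.+1 (trunc x k.+1).
    by apply: (eq_leq (size_trunc x k.+1)).
  have hx := fh _ bx.
  have gE : g = (h^-1)%g by rewrite -[LHS]mulg1 -(mulgV h) mulgA gh mul1g.
  have : cyl (trunc x k.+1) (g x).
    by rewrite gE -hx; exists x => //; exact: cyl_trunc.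
  move=> /truncE; rewrite size_trunc => E.
  have : nth ord0 (mkseq (g x) k.+1) k = nth ord0 (mkseq x k.+1) k.
    exact: (congr1 (fun v : vertex 2 => nth ord0 v k) E).
  by rewrite !nth_mkseq.
pose Q i s := forall u, U i u -> ~ W n (g * u * s^-1)%g /\ ~ W n (g * u * s)%g.
have [|s Ss|i iP] := @compact_bound Q.
- by move=> i j s ij H u uj; apply: H; exact: U_sub uj.
- have n1 : ~ W n (g * s^-1)%g.
    move=> [w wE wn]; apply: nW; exists (rcons w (exist _ s (mem_set Ss), false)); last by rewrite size_rcons.
    by rewrite -cats1 eval_cat eval1 /= wE mulgVK.
  have n2 : ~ W n (g * s)%g.
    move=> [w wE wn]; apply: nW; exists (rcons w (exist _ s (mem_set Ss), true)); last by rewrite size_rcons.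
    by rewrite -cats1 eval_cat eval1 /= wE mulgK.
  have [j1 j1P] := IHn _ n1; have [j2 j2P] := IHn _ n2.
  have [i1 i1P] := conjU (s^-1)%g j1; have [i2 i2P] := conjU s j2.
  pose k := maxn (maxn j1 j2) (maxn i1 i2).
  exists k, k => h hk u uk; split.
    have -> : (g * u * (s * h)^-1 = g * s^-1 * ((s^-1)^-1 * (u * h^-1) * s^-1))%g.
      by rewrite invgM invgK !mulgA mulgVK.
    apply: j1P; apply: i1P; apply: fixesM; first by apply: U_sub uk; rewrite /k; lia.
    by apply: fixesV; apply: U_sub hk; rewrite /k; lia.
  have -> : (g * u * (s * h) = g * s * ((s^-1 * u * s) * h))%g.
    by rewrite !mulgA mulgK.
  apply: j2P; apply: fixesM; last by apply: U_sub hk; rewrite /k; lia.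
  by apply: i2P; apply: U_sub uk; rewrite /k; lia.
- have [j jP] : exists k, forall h, U k h -> ~ W n (g * h)%g.
    by apply: IHn => /(W_mono (leqnSn n)).
  exists (maxn i j) => h hk; case/W_last; first by apply: jP; apply: U_sub hk; exact: leq_maxr.
  move=> [s Ss]; have [|? ?] := iP s Ss h; first by apply: U_sub hk; exact: leq_maxl.
  by case.
Qed.

Hypothesis gS : generating S.

Lemma gen_W g : exists n, W n g.
Proof. by have [w wg] := gS g; exists (size w), w. Qed.

(* The Baire category argument, with nested cosets of the [U k]. *)
Lemma W_U : exists n k, U k `<=` W n.
Proof.
suff [n [g [k H]]] : exists n g k, forall h, U k h -> W n (g * h)%g.
  have [a ga] := gen_W g; exists (a + n)%N, k => h /H gh.
  by rewrite -[h](mulKg g); exact: WM (WV ga) gh.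
apply: contrapT => nH.
have /choice[nx nxP] (q : nat * (N * nat)) : exists r : N * nat,
    [/\ U q.2.2 (q.2.1^-1 * r.1)%g, (q.1 < r.2)%N, (q.2.2 <= r.2)%N &
       forall h, U r.2 h -> ~ W q.1 (r.1 * h)%g].
  case: q => n [g k] /=.
  have [h hk nW] : exists2 h, U k h & ~ W n (g * h)%g.
    apply: contrapT => nh; apply: nH; exists n, g, k => h hk.
    by apply: contrapT => nW; apply: nh; exists h.
  (* Taking the new index above [n] makes the nested cosets shrink, which is what [limit]
     requires. *)
  have [j jn jP] := @U_meet (maxn n.+1 k) (fun z => ~ W n z) _ (W_closed nW).
  by exists (g * h, j)%g; rewrite /= mulKg; split=> //; move: jn; rewrite geq_max => /andP[].
pose s := fix s n := if n is n'.+1 then nx (n', s n') else (1%g : N, 0).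
have sS n : [/\ U (s n).2 ((s n).1^-1 * (s n.+1).1)%g, (n < (s n.+1).2)%N, ((s n).2 <= (s n.+1).2)%N &
       forall h, U (s n.+1).2 h -> ~ W n ((s n.+1).1 * h)%g] by exact: nxP (n, s n).
have sn n : (n <= (s n).2)%N by case: n => // n; have [] := sS n.
have smono n k : ((s n).2 <= (s (n + k)).2)%N.
  elim: k => [|k IHk]; rewrite ?addn0// addnS; apply: leq_trans IHk _.
  by have [] := sS (n + k).
have sU n k : U (s n).2 ((s n).1^-1 * (s (n + k)).1)%g.
  elim: k => [|k IHk]; first by rewrite addn0 mulVg; exact: fixes1.
  have [h _ _ _] := sS (n + k); have := fixesM IHk (U_sub (smono n k) h).
  by rewrite addnS !mulgA mulgK.
have [n|g gP] := @limit (fun n => (s n).1); first by have [h _ _ _] := sS n; exact: U_sub h.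
have {}gP n : U (s n).2 ((s n).1^-1 * g)%g.
  pose k := (s n).2; have := gP (n + k); have := sU n k => h1 h2.
  have := fixesM h1 (U_sub (leq_addl n k) h2); by rewrite !mulgA mulgK.
have [n gn] := gen_W g; have [_ _ _ /(_ _ (gP n.+1))] := sS n.
by rewrite mulVKg.
Qed.

Lemma W_finite_orbit (E : set N) : finite_set ((fun h => act h fam0) @` E) ->
  exists k, E `<=` W k.
Proof.
apply: (finite_orbit_good (Good := fun E => exists k, E `<=` W k)).
- by exists 0.
- by move=> E1 E2 E12 [k kP]; exists k => g /E12/kP.
- move=> E1 E2 [k1 k1P] [k2 k2P]; exists (maxn k1 k2) => g [/k1P|/k2P]; apply: W_mono;
  [exact: leq_maxl|exact: leq_maxr].
- move=> g; have [n [k kP]] := W_U; have [a ga] := gen_W g.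
  by exists k, (a + n)%N => h /kP gh; rewrite -[h](mulVKg g); exact: WM ga gh.
Qed.

End Baire.

(** Compactness in its near-covering form is a statement that a set is good for an ideal. Invariance
    under [K] makes [E] closed, which settles the points [g] outside [E]. *)
Lemma compact_finite_orbit (E : set (neretin 2)) : (forall g h, E g -> K h -> E (g * h)%g) ->
  finite_set ((fun h => act h fam0) @` E) -> compact E.
Proof.
move=> EK fE; apply/compact_near_coveringP => I F Q FF H.
have H2 : \near F, (E `&` E `<=` Q F)%classic; last by apply: filterS H2 => i iP g Eg; exact: iP.
apply: (finite_orbit_good (Good := fun A => \near F, (E `&` A `<=` Q F)%classic)) fE.
- by apply: filterE => i g [].
- by move=> A B AB; apply: filterS => i iP g [Eg /AB Bg]; exact: iP.
- move=> A B; apply: filterS2 => i Ai Bi g [Eg [Ag|Bg]]; [exact: Ai|exact: Bi].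
- move=> g; have [Eg|nE] := pselect (E g); last first.
    exists 0; apply: filterE => i h [Eh /= hU]; case: nE; rewrite -[g](mulVKg h).
    apply: EK Eh _; rewrite -U0E; have := fixesV hU; by rewrite invgM invgK.
  have [[A B] /= [/nbhsP[k kA] FB] AB] := H g Eg.
  exists k; apply: filterS FB => i Bi h [Eh /= /kA]; rewrite mulVKg => Ah.
  exact: (AB (h, i)).
Qed.

(** * Finiteness of transitions and connectedness of the states *)

Section Edges.
Implicit Types (u v w : label) (p : P) (a b t : tree) (x y z : state)
  (B D : set P) (F : set (set P)) (s : seq label) (g h : neretin 2).

Lemma finite_range (T : finType) (T' : Type) (f : T -> T') : finite_set (range f).
Proof.
apply: finite_image; apply/finite_seqP; exists (enum T).
by apply/seteqP; split=> i //= _; rewrite mem_enum.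
Qed.

Definition union_of s (A : {set 'I_(size s)}) : set P :=
  [set p | exists2 i, i \in A & cyl (nth [::] s i) p].
Definition unions s := range (@union_of s).

Lemma unions_cyl s w : w \in s -> unions s (cyl w).
Proof.
move=> ws; have iw : (index w s < size s)%N by rewrite index_mem.
exists [set Ordinal iw]%SET => //; apply/seteqP; split=> p.
  by move=> [i]; rewrite !finset.inE => /eqP -> /=; rewrite nth_index.
by move=> pw; exists (Ordinal iw); rewrite ?finset.inE//= nth_index.
Qed.

Lemma unionsU s B D : unions s B -> unions s D -> unions s (B `|` D).
Proof.
move=> [A _ <-] [A' _ <-]; exists (A :|: A')%SET => //; apply/seteqP; split=> p.
  move=> [i]; rewrite finset.inE => /orP[iA|iA] ip; [left|right]; by exists i.
by move=> [[i iA ip]|[i iA ip]]; exists i; rewrite // finset.inE iA ?orbT.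
Qed.

Lemma unions_big s (r : seq label) (f : label -> set P) : (forall w, w \in r -> unions s (f w)) ->
  unions s [set p | exists2 w, w \in r & f w p].
Proof.
elim: r => [|w r IHr] H.
  exists finset.set0 => //; apply/seteqP; split=> p; first by move=> [i]; rewrite finset.inE.
  by case.
have -> : [set p | exists2 v, v \in w :: r & f v p] = f w `|` [set p | exists2 v, v \in r & f v p].
  apply/seteqP; split=> p; first by move=> [v]; rewrite inE => /orP[/eqP ->|vr] vp; [left|right; exists v].
  by case=> [wp|[v vr vp]]; [exists w; rewrite ?mem_head|exists v; rewrite // inE vr orbT].
apply: unionsU; first exact/H/mem_head.
by apply: IHr => v vr; apply: H; rewrite inE vr orbT.
Qed.

(** Families that exceed the standard one only by unions of its pieces. There are finitely many
    pieces, hence finitely many unions and finitely many such families. *)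
Definition near_std n : set (set (set P)) := [set F | Std (srt n) `<=` F /\
  F `<=` Std (srt n) `|` unions (srt n)].

Lemma finite_near n : finite_set (near_std n).
Proof.
apply: sub_finite_set (finite_range (fun AA : {set {set 'I_(size (srt n))}} =>
  Std (srt n) `|` [set union_of A | A in [set` AA]])) => F [F1 F2].
exists [set A | `[< F (union_of A) >]]%SET => //; apply/seteqP; split=> B.
  by case=> [/F1//|[A /=]]; rewrite finset.inE => /asboolP FA <-.
move=> FB; case: (F2 B FB) => [|[A _ AB]]; [by left|right].
by exists A => //=; rewrite finset.inE AB; apply/asboolP.
Qed.

Lemma Std0 : Std (srt 0) = fam0.
Proof.
apply/seteqP; split=> B.
  move=> /StdP[_ /mapP[i _ ->] [u [ru iu] <-]]; exists u => //; split=> //.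
  by case: (u) iu.
move=> [[|i u] [ru u0] <-] //; apply/StdP; exists [:: i]; first by rewrite map_f ?mem_enum.
by exists (i :: u) => //; split=> //=; rewrite eqxx prefix0s.
Qed.

Lemma fam0_split s : cylpart s -> fam0 `<=` Std s `|` unions s /\ Std s `<=` fam0.
Proof.
move=> [H1 us ac cov]; split=> B; last first.
  move=> /StdP[w ws [u [ru wu] <-]]; exists u => //; split=> //.
  have [_] := H1 w ws; apply: contra => /eqP u0; move: wu; rewrite u0 prefixs0//.
move=> [z [rz z0] <-]; have [[w ws wz]|nw] := pselect (exists2 w, w \in s & prefix w z).
  by left; apply/StdP; exists w => //; exists z.
right; suff -> : cyl z = [set p | exists2 w, w \in [seq w <- s | prefix z w] & cyl w p].
  by apply: unions_big => w; rewrite mem_filter => /andP[_ ws]; exact: unions_cyl.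
apply/seteqP; split=> p.
  move=> zp; have [w ws wp] := cov p; exists w => //; rewrite mem_filter ws andbT.
  by case: (cyl_meet zp wp) => // wz; case: nw; exists w.
by move=> [w]; rewrite mem_filter => /andP[zw _] /(cyl_prefix zw).
Qed.

Lemma maxel_act g F B : maxel F B -> maxel (act g F) (g @` B).
Proof.
move=> [FB mB]; split; first by exists B.
move=> _ [D FD <-] /image_sub BD; congr (_ @` _); exact: mB.
Qed.

Lemma merge_fam_act g F F' : merge_fam F F' -> merge_fam (act g F) (act g F').
Proof.
move=> [B [D [mB mD BD ->]]]; exists (g @` B), (g @` D); split; try exact: maxel_act.
  by move=> /im_inj.
by rewrite actU act_set1 image_setU.
Qed.

(* Hence transition elements lie in finitely many left cosets of [K]. *)
Lemma near_merge n a b (u : state) g g' : valid (a +` (b +` u))%mset ->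
  act g (Std (srt n.+1)) = Sfam (a +` (b +` u))%mset ->
  act g' (Std (srt n)) = Sfam (node a b +` u)%mset ->
  near_std n.+1 (act (g^-1 * g')%g fam0).
Proof.
move=> v gE g'E; pose h := (g^-1 * g')%g.
have v' : valid (node a b +` u)%mset by apply: valid_step v; exact: step_merge.
have topcyl t : t \in (a +` (b +` u))%mset -> exists2 w, w \in srt n.+1 & (g^-1)%g @` top t = cyl w.
  move=> tx; have : maxel (act (g^-1)%g (Sfam (a +` (b +` u))%mset)) ((g^-1)%g @` top t).
    by apply: maxel_act; apply/maxel_Sfam => //; exists t.
  by rewrite -gE actK => /(maxel_Std _ (cylpart_srt _)).
have un t : t \in (a +` (b +` u))%mset -> unions (srt n.+1) ((g^-1)%g @` top t).
  by move=> /topcyl[w ws ->]; exact: unions_cyl.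
have ax : a \in (a +` (b +` u))%mset by rewrite in_msetD mset11.
have bx : b \in (a +` (b +` u))%mset by rewrite !in_msetD mset11 orbT.
have hStd : act h (Std (srt n)) = Std (srt n.+1) `|` [set (g^-1)%g @` top a `|` (g^-1)%g @` top b].
  by rewrite /h actM g'E Sfam_merge actU -gE actK act_set1 image_setU.
have hcyl w : w \in srt n -> unions (srt n.+1) (h @` cyl w).
  move=> ws; have : maxel (act g' (Std (srt n))) (g' @` cyl w).
    by apply: maxel_act; apply/maxel_Std; [exact: cylpart_srt|exists w].
  rewrite g'E => /(maxel_Sfam _ v')[t tx tE]; rewrite /h imM tE.
  move: tx; rewrite in_msetD in_mset1 => /orP[/eqP ->|tu].
    by rewrite top_node image_setU; apply: unionsU; exact: un.
  by apply: un; rewrite !in_msetD tu !orbT.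
(* [fam0] exceeds [Std (srt n)] only by unions of its pieces, and by [hcyl] these are carried by [h]
   to unions of pieces of [Std (srt n.+1)]. *)
have [f1 _] := fam0_split (cylpart_srt n); have [_ f2] := fam0_split (cylpart_srt n).
split=> [B SB|_ [B /f1 SB <-]].
  have : act h (Std (srt n)) B by rewrite hStd; left.
  by move=> [D SD <-]; exists D => //; exact: f2.
case: SB => [SB|[A _ <-]].
  have : act h (Std (srt n)) (h @` B) by exists B.
  rewrite hStd => -[|->]; [by left|right].
  by apply: unionsU; exact: un.
right; suff -> : h @` union_of A = [set p | exists2 w, w \in [seq nth [::] (srt n) (i : 'I_(size (srt n))) | i <- enum A] & (h @` cyl w) p].
  apply: unions_big => _ /mapP[i _ ->]; apply: hcyl; exact: mem_nth.
apply/seteqP; split=> p.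
  move=> [q [i iA iq] <-]; exists (nth [::] (srt n) i); last by exists q.
  by apply/mapP; exists i; rewrite ?mem_enum.
by move=> [_ /mapP[i + ->] [q iq <-]]; rewrite mem_enum => iA; exists q => //; exists i.
Qed.

(** Three roots plus the margin 4 of [linked_same_leaves]. *)
Local Notation msize := 7.

(** The three trees at the base are refined to a level at which [g] carries cylinders to cylinders
    with their families; relabelling the leaves by [f] then represents the translated family. *)
Lemma state_of g : exists x, [/\ valid x, size x = 3 & Sfam x = act g fam0].
Proof.
(* The leaves of the base forest already have length 1, so refining by [k] reaches length [k.+1],
   which is at least [k0]. *)
have [k0 [f fP]] := almost g; pose k := k0.-1.
pose x0 := lstate (srt 0); have v0 : valid x0 by apply: valid_lstate; exact: cylpart_srt.
have [vk fk] := refine_valid (fun=> k) v0; set xk := sbind _ x0 in vk fk.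
pose F w := f (insubd root w).
have szk w : w \in lv xk -> size w = k.+1.
  rewrite (perm_mem (lv_sbind _ _)) => /flatten_mapP[v].
  rewrite (perm_mem (lv_lstate _)) => /mapP[i _ ->] /size_full ->.
  by rewrite addnC addn1.
have FP w : w \in lv xk -> [/\ F w != root, g @` cyl w = cyl (F w) & act g (fam w) = fam (F w)].
  move=> wx; have [rw _] := cylpart_neq0 vk wx.
  have E : insubd root w = w :> label by rewrite insubdK.
  have := fP (insubd root w); rewrite E szk// /k; apply; exact: leqSpred.
have sub w w' : w \in lv xk -> w' \in lv xk -> prefix (F w) (F w') -> w = w'.
  move=> wx w'x /cyl_subE; have [_ <- _] := FP w wx; have [_ <- _] := FP w' w'x.
  have [rw' _] := cylpart_neq0 vk w'x; move=> /image_sub/(cyl_sub rw').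
  by have [_ [_ _ H _]] := vk; exact: H.
exists (sbind (fun w => Leaf (F w : label)) xk); split.
- split; first by apply: canons_sbind.
  have lE : perm_eq (lv (sbind (fun w => (Leaf (F w : label) : tree)) xk)) [seq (F w : label) | w <- lv xk].
    rewrite (perm_trans (lv_sbind _ _))//; elim: (lv xk) => //= w l IHl.
    by rewrite perm_cons.
  apply: (@cylpart_perm [seq (F w : label) | w <- lv xk]); first by rewrite perm_sym.
  have [_ [_ ul _ cov]] := vk; split.
  + move=> _ /mapP[w wx ->]; split; first exact: reducedV.
    by have [] := FP w wx.
  + rewrite map_inj_in_uniq// => w w' wx w'x E; apply: sub => //.
    by rewrite E prefix_refl.
  + by move=> _ _ /mapP[w wx ->] /mapP[w' w'x ->] /(sub w w' wx w'x) ->.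
  + move=> p; have [w wx wp] := cov ((g^-1)%g p); exists (F w : label); first by apply/mapP; exists w.
    have [_ <- _] := FP w wx; exists ((g^-1)%g p) => //.
    exact: (neretin_invK g).2.
- by rewrite !size_sbind size_lstate size_srt.
- by rewrite (@Sfam_sbind g) ?fk -?Std0// => w /FP[].
Qed.

Lemma refine_level x k : valid x -> (forall w, w \in lv x -> (size w <= k)%N) ->
  exists y, [/\ valid y, size y = size x, Sfam y = Sfam x & forall w, w \in lv y -> size w = k].
Proof.
move=> vx xk; have [vy fy] := refine_valid (fun w => (k - size w)%N) vx.
exists (sbind (fun w => full w (k - size w)) x); split=> //; first exact: size_sbind.
move=> w; rewrite (perm_mem (lv_sbind _ _)) => /flatten_mapP[v vx' /size_full ->].
by rewrite subnKC// xk.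
Qed.

Lemma level_leaves x y k : valid x -> valid y -> (forall w, w \in lv x -> size w = k) ->
  (forall w, w \in lv y -> size w = k) -> perm_eq (lv x) (lv y).
Proof.
move=> vx vy xk yk; have [_ [_ ux _ covx]] := vx; have [_ [_ uy _ covy]] := vy.
apply: uniq_perm => // w.
have sub x' y' : valid x' -> valid y' -> (forall w, w \in lv x' -> size w = k) ->
  (forall w, w \in lv y' -> size w = k) -> w \in lv x' -> w \in lv y'.
  move=> vx' [_ [_ _ _ cov]] xk' yk' wx; have [rw _] := cylpart_neq0 vx' wx.
  have [p wp] := cyl_neq0 rw; have [v vy' vp] := cov p.
  suff -> : w = v by [].
  by move: wp vp; rewrite /cyl /= (xk' w wx) (yk' v vy') => <- <-.
by apply/idP/idP; exact: sub.
Qed.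

Lemma connect_states g : exists x y, [/\ valid x, valid y, size x = 3 & size y = 3] /\
  [/\ Sfam x = fam0, Sfam y = act g fam0, perm_eq (lv x) (lv y) & linked msize x y].
Proof.
have [x1 [vx1 sx1 fx1]] := state_of 1%g; have [y1 [vy1 sy1 fy1]] := state_of g.
pose k := (\max_(w <- lv x1 ++ lv y1) size w)%N.
have le w : w \in lv x1 ++ lv y1 -> (size w <= k)%N.
  by move=> wl; rewrite /k (big_rem w)//= leq_maxl.
have [w wx|x [vx sx fx lx]] := refine_level (k := k) vx1; first by apply: le; rewrite mem_cat wx.
have [w wx|y [vy sy fy ly]] := refine_level (k := k) vy1; first by apply: le; rewrite mem_cat wx orbT.
have xy := level_leaves vx vy lx ly.
rewrite sx1 in sx; rewrite sy1 in sy; rewrite fx1 act1 in fx; rewrite fy1 in fy.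
exists x, y; split=> //; split=> //; apply: linked_same_leaves; rewrite ?sx ?sy//.
- by case: vx.
- by case: vy.
- by case: vx => _ [].
Qed.

End Edges.

(** * From relations to loops of states *)

Section Transfer.
Local Notation madj := (@sadj treeC node 3).
Local Notation sfam := (nat * set (set P))%type.
Implicit Types (x y z : state) (p q : seq state) (F : set (set P)) (g h : N) (fs : seq sfam).

(* The default value 1 is never used for valid states with at least three roots. *)
Definition marking x : N := xget (neretin1 2) [set g : N | act g (Std (srt (size x - 3))) = Sfam x].

Lemma markingP x : valid x -> (2 < size x)%N -> act (marking x) (Std (srt (size x - 3))) = Sfam x.
Proof.
move=> vx sx; rewrite /marking; case: xgetP => [g _ //|nP].
have [|g gE] := @realize x (size x - 3) vx; first by rewrite subnK.
by have := nP g; rewrite /= gE.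
Qed.

Lemma marking_fam x F : valid x -> sized x = (3, F) -> act (marking x) fam0 = F.
Proof.
move=> vx [sx <-]; rewrite -(markingP vx); last by rewrite sx.
by rewrite sx subnn Std0.
Qed.

(** A finite union of left cosets of [K] that contains [K] itself. The bound 19 exceeds the index
    [size x - 3] of every state with at most 18 roots. *)
Definition transition : set N := [set h | exists2 n, (n < 19)%N & near_std n (act h fam0)].

Lemma finite_transition : finite_set ((fun h => act h fam0) @` transition).
Proof.
apply: (@sub_finite_set _ _ (\bigcup_(n in `I_19) near_std n)).
  by move=> _ [h [n n19 nh] <-]; exists n.
by apply: bigcup_finite => [|n _]; [exact: finite_II|exact: finite_near].
Qed.

Lemma K_transition h : K h -> transition h.
Proof.
move=> Kh; exists 0 => //; rewrite Kh -Std0; split; first by [].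
by move=> B; left.
Qed.

Lemma transition_K g h : transition g -> K h -> transition (g * h)%g.
Proof. by move=> [n n19 ng] Kh; exists n => //; rewrite actM Kh. Qed.

Lemma marking_transition x y : valid x -> valid y -> madj 18 x y ->
  [\/ x = y, transition ((marking x)^-1 * marking y)%g | transition ((marking y)^-1 * marking x)%g].
Proof.
have H a b (u : state) : valid (a +` (b +` u))%mset -> valid (node a b +` u)%mset ->
    (2 < size (node a b +` u)%mset)%N -> (size (a +` (b +` u))%mset < 19)%N ->
    transition ((marking (a +` (b +` u))%mset)^-1 * marking (node a b +` u)%mset)%g.
  move=> v v' s1 s2; have sE : size (a +` (b +` u))%mset = (size (node a b +` u)%mset).+1 by rewrite !sizeE.
  exists (size (node a b +` u)%mset - 3).+1.
    by move: s1 s2; rewrite sE; move: (size _) => m; clear; lia.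
  apply: (near_merge v); last exact: markingP.
  have <- : size (a +` (b +` u))%mset - 3 = (size (node a b +` u)%mset - 3).+1.
    by move: s1; rewrite sE; move: (size _) => m; clear; lia.
  by apply: markingP v _; rewrite sE ltnW.
move=> vx vy /and3P[/andP[x3 x18] /andP[y3 y18] /asboolP].
case=> [->|[a [b [u [xE yE]]]]|[a [b [u [xE yE]]]]]; first exact: Or31.
  by apply: Or32; rewrite xE yE; apply: H; rewrite -?xE -?yE.
by apply: Or33; rewrite xE yE; apply: H; rewrite -?xE -?yE.
Qed.

Section EdgeWords.
Variables (S : set N) (k1 : nat).
Hypothesis transitionW : transition `<=` W S k1.

Lemma edge_ex x y : exists e : word S, valid x -> valid y -> madj 18 x y ->
  Defs.eval e = ((marking x)^-1 * marking y)%g /\ (size e <= k1)%N.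
Proof.
have [[vx [vy xy]]|nH] := pselect (valid x /\ valid y /\ madj 18 x y); last first.
  by exists [::] => vx vy xy; case: nH.
suff [e eE es] : W S k1 ((marking x)^-1 * marking y)%g by exists e.
case: (marking_transition vx vy xy) => [->|/transitionW//|/transitionW/WV].
  by rewrite mulVg; exact: W_mono (leq0n _) _ (W1 S).
by rewrite invgM invgK.
Qed.

Definition edge x y : word S := projT1 (cid (edge_ex x y)).

Lemma edgeP x y : valid x -> valid y -> madj 18 x y ->
  Defs.eval (edge x y) = ((marking x)^-1 * marking y)%g /\ (size (edge x y) <= k1)%N.
Proof. exact: projT2 (cid (edge_ex x y)). Qed.

Fixpoint edges x p : word S := if p is y :: q then edge x y ++ edges y q else [::].

Lemma edges_cat x p q : edges x (p ++ q) = edges x p ++ edges (last x p) q.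
Proof. by elim: p x => //= y p IHp x; rewrite IHp catA. Qed.

Lemma valid_adj n x y : madj n x y -> valid x -> valid y.
Proof. by move=> /and3P[_ _ /asboolP]; exact: valid_step. Qed.

Lemma valid_last n x p : path (madj n) x p -> valid x -> valid (last x p).
Proof. by elim: p x => //= y p IHp x /andP[xy yp] vx; apply: IHp yp (valid_adj xy vx). Qed.

Lemma edgesP x p : valid x -> path (madj 18) x p ->
  Defs.eval (edges x p) = ((marking x)^-1 * marking (last x p))%g /\ (size (edges x p) <= k1 * size p)%N.
Proof.
elim: p x => [|y p IHp] x vx /=; first by rewrite eval_nil mulVg muln0.
move=> /andP[xy yp]; have vy := valid_adj xy vx; have [E1 s1] := edgeP vx vy xy.
have [E2 s2] := IHp y vy yp; rewrite eval_cat E1 E2 size_cat mulgA mulgK mulnS leq_add//.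
Qed.

(** A tile has at most 12 sides, each with a word of length at most [k1]. Its boundary word
    evaluates to 1 because the markings telescope, so each tile costs one relator. *)
Lemma edges_htp m n x p q : (k1 * 12 <= m)%N -> valid x -> htp (madj 18) 12 n x p q ->
  weq m n (edges x p) (edges x q).
Proof.
move=> km vx H; elim: H vx => {n x p q}.
- move=> x p q xp xq pq spq vx; have [E1 s1] := edgesP vx xp; have [E2 s2] := edgesP vx xq.
  apply: weq_rel; first by rewrite E1 E2 pq.
  apply: leq_trans km; apply: leq_trans (leq_add s1 s2) _.
  by rewrite -mulnDr leq_mul2l spq orbT.
- by move=> x p _ _; exact: weq_refl.
- by move=> n x p q _ IH /IH/weq_sym.
- by move=> i j x p q r _ IH1 _ IH2 vx; apply: weq_trans (IH1 vx) (IH2 vx).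
- move=> i j x p q r s h1 IH1 h2 IH2 vx; have [xp _ pq] := htp_path h1.
  by rewrite !edges_cat -pq; apply: weq_cat (IH1 vx) (IH2 (valid_last xp vx)).
- by move=> i j x p q _ IH ij /IH; exact: weq_le.
Qed.

Lemma madj_sub i j : (i <= j)%N -> subrel (madj i) (madj j).
Proof.
move=> ij x y /and3P[/andP[x3 xi] /andP[y3 yi] xy]; apply/and3P; split=> //.
  by rewrite x3 (leq_trans xi).
by rewrite y3 (leq_trans yi).
Qed.

(** A path of states from [fam0] to its translate by [g] spells the change of marking; the markings
    at the two ends differ from 1 and from [g] by elements of [K]. *)
Lemma generated g : exists k, W S k g.
Proof.
have [x [y [[vx vy sx sy] [fx fy xy [p [xp py]]]]]] := connect_states g.
have xp18 : path (madj 18) x p by apply: sub_path xp; exact: madj_sub.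
have [E s] := edgesP vx xp18; rewrite py in E.
have Kx : K (marking x) by apply: marking_fam; rewrite // /sized sx fx.
have Ky : K ((marking y)^-1 * g)%g.
  rewrite /K /= actM -fy -(@marking_fam y (Sfam y)) ?actK// /sized sy//.
exists (k1 + k1 * size p + k1)%N.
have -> : g = (marking x * ((marking x)^-1 * marking y) * ((marking y)^-1 * g))%g by rewrite !mulgA mulgK mulgV mul1g.
apply: WM; last by apply: transitionW; exact: K_transition.
apply: WM; first by apply: transitionW; exact: K_transition.
by rewrite -E; exists (edges x p).
Qed.

End EdgeWords.

Lemma compact_transition : compact transition.
Proof. exact: compact_finite_orbit transition_K finite_transition. Qed.

Lemma generating_transition : generating transition.
Proof.
move=> g; have [|k [w wg _]] := @generated transition 1 _ g; last by exists w.
by move=> h th; exists [:: (exist _ h (mem_set th), false)] => //; rewrite eval1.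
Qed.

Definition gact g (m : sfam) : sfam := (m.1, act g m.2).

Lemma fam_move_act g m m' : fam_move m m' -> fam_move (gact g m) (gact g m').
Proof.
move=> /asboolP H; apply/asboolP; case: H => [->|[n1 mm]|[n1 mm]]; first exact: Or31.
  by apply: Or32; split=> //; exact: merge_fam_act.
by apply: Or33; split=> //; exact: merge_fam_act.
Qed.

Lemma fam_move_sym : symmetric fam_move.
Proof.
have H m m' : fam_move m m' -> fam_move m' m.
  by move=> /asboolP[->|[? ?]|[? ?]]; apply/asboolP; [exact: Or31|exact: Or33|exact: Or32].
by move=> m m'; apply/idP/idP; exact: H.
Qed.

Definition small (m : sfam) := (3 <= m.1 <= 7)%N.
Definition base : sfam := (3, fam0).

Definition short_path l g fs := [/\ path fam_move base fs, last base fs = (3, act g fam0),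
  all small fs & (size fs <= l)%N].

Lemma states_fam_move x p : valid x -> path (madj 7) x p ->
  path fam_move (sized x) (map sized p) /\ all small (map sized p).
Proof.
elim: p x => //= y p IHp x vx /andP[xy yp]; have vy := valid_adj xy vx.
have [h1 h2] := IHp y vy yp; rewrite h1 h2 !andbT; move: xy => /and3P[_ y37 /asboolP xy].
rewrite /small /sized y37; split=> //; apply/asboolP; case: xy vx vy => [->|[a [b [u [-> ->]]]]|[a [b [u [-> ->]]]]] vx vy.
- exact: Or31.
- by apply: Or32; split; [rewrite /= !sizeE|exact: merge_fam_Sfam].
- by apply: Or33; split; [rewrite /= !sizeE|exact: merge_fam_Sfam].
Qed.

Lemma short_path_ex g : exists l fs, short_path l g fs.
Proof.
have [x [y [[vx vy sx sy] [fx fy xy [p [xp py]]]]]] := connect_states g.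
have [h1 h2] := states_fam_move vx xp; have bx : sized x = base by rewrite /sized sx fx.
exists (size p), (map sized p); split=> //; rewrite -?bx ?size_map//.
by rewrite last_map py /sized sy fy.
Qed.

Lemma path_act g m fs : path fam_move m fs -> path fam_move (gact g m) (map (gact g) fs).
Proof. by move=> mf; rewrite path_map; apply: sub_path mf => a b; exact: fam_move_act. Qed.

Lemma small_act g fs : all small fs -> all small (map (gact g) fs).
Proof. by rewrite all_map. Qed.

Lemma short_path_inv l g fs : short_path l g fs -> exists fs', short_path l (g^-1)%g fs'.
Proof.
move=> [h1 h2 h3 h4]; exists (map (gact (g^-1)%g) (rv base fs)).
have gl : gact (g^-1)%g (last base fs) = base by rewrite h2 /gact /= actK.
split; last by rewrite size_map size_rv.
- by rewrite -[X in path _ X]gl; apply: path_act; exact: (rv_path fam_move_sym h1).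
- by rewrite -{1}gl last_map last_rv.
- apply: small_act; rewrite all_rev.
  have : all small (base :: fs) by rewrite /= h3.
  by rewrite lastI all_rcons => /andP[].
Qed.

Section Loops.
Variable S : set N.
Hypothesis cS : compact S.

(** [short_path] depends on [g] only through [act g fam0], hence through the coset of [K], which is
    open; compactness of [S] then makes the length uniform. *)
Lemma letter_path : exists l, forall a : S * bool, exists fs, short_path l (Defs.eval [:: a]) fs.
Proof.
have [|s Ss|l lP] := @compact_bound S cS (fun l g => exists fs, short_path l g fs).
- by move=> i j g ij [fs [h1 h2 h3 h4]]; exists fs; split=> //; exact: leq_trans h4 ij.
- have [l [fs fsP]] := short_path_ex s; exists l, 0 => h; rewrite U0E => Kh; exists fs.
  by rewrite /short_path actM Kh.
exists l => -[s b]; rewrite eval1 /=; have [fs fsP] := lP _ (set_valP s).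
by case: b; [exact: short_path_inv fsP|exists fs].
Qed.

Variables (l : nat) (seg : S * bool -> seq sfam).
Hypothesis segP : forall a, short_path l (Defs.eval [:: a]) (seg a).

Fixpoint wpath g (w : word S) : seq sfam :=
  if w is a :: w' then map (gact g) (seg a) ++ wpath (g * Defs.eval [:: a])%g w' else [::].

Lemma wpathP g w : [/\ path fam_move (3, act g fam0) (wpath g w),
  last (3, act g fam0) (wpath g w) = (3, act (g * Defs.eval w)%g fam0),
  all small (wpath g w) & (size (wpath g w) <= l * size w)%N].
Proof.
elim: w g => [|a w IHw] g; first by rewrite eval_nil mulg1 muln0.
have [h1 h2 h3 h4] := segP a; have [i1 i2 i3 i4] := IHw (g * Defs.eval [:: a])%g.
have gb : (3, act g fam0) = gact g base by [].
rewrite -[wpath _ _]/(map (gact g) (seg a) ++ wpath (g * Defs.eval [:: a])%g w).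
have E : last (3, act g fam0) (map (gact g) (seg a)) = (3, act (g * Defs.eval [:: a])%g fam0).
  by rewrite gb last_map h2 actM.
split.
- by rewrite cat_path E i1 andbT gb; exact: path_act.
- by rewrite last_cat E i2 -mulgA -eval_cat cat1s.
- by rewrite all_cat small_act.
- by rewrite size_cat size_map mulnS leq_add.
Qed.

Variable k1 : nat.
Hypothesis transitionW : transition `<=` W S k1.

(** [g] and the marking of a state over [act g fam0] agree up to an element of [K], and elements of
    [K] are words of length at most [k1]. *)
Lemma corr_ex g x : exists e : word S, valid x -> sized x = (3, act g fam0) ->
  Defs.eval e = (g^-1 * marking x)%g /\ (size e <= k1)%N.
Proof.
have [[vx xg]|nH] := pselect (valid x /\ sized x = (3, act g fam0)); last first.
  by exists [::] => vx xg; case: nH.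
have Kx : K (g^-1 * marking x)%g by rewrite -[K _]/(_ = _) actM (marking_fam vx xg) actK.
by have [e eE es] := transitionW (K_transition Kx); exists e.
Qed.

Definition corr g x : word S := projT1 (cid (corr_ex g x)).

Lemma corrP g x : valid x -> sized x = (3, act g fam0) ->
  Defs.eval (corr g x) = (g^-1 * marking x)%g /\ (size (corr g x) <= k1)%N.
Proof. exact: projT2 (cid (corr_ex g x)). Qed.

(* One relator of bounded length for each letter: the square whose horizontal
   sides are the letter and the path of states above it. *)
Lemma compare m (w : word S) g x p : (1 + k1 + (k1 + k1 * l) <= m)%N ->
  valid x -> path (madj 18) x p -> sized x = (3, act g fam0) -> map sized p = wpath g w ->
  weq m (size w) (w ++ corr (g * Defs.eval w)%g (last x p)) (corr g x ++ edges transitionW x p).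
Proof.
move=> km; elim: w g x p => [|a w IHw] g x p vx xp xg /=.
  by case: p xp => //= _ _; rewrite eval_nil mulg1 cats0; exact: weq_refl.
move=> pE; pose p1 := take (size (seg a)) p; pose p2 := drop (size (seg a)) p.
have pE12 : p = p1 ++ p2 by rewrite cat_take_drop.
have p1E : map sized p1 = map (gact g) (seg a).
  by rewrite /p1 map_take pE -(size_map (gact g)) take_size_cat.
have p2E : map sized p2 = wpath (g * Defs.eval [:: a])%g w.
  by rewrite /p2 map_drop pE -(size_map (gact g)) drop_size_cat.
move: xp; rewrite {1}pE12 cat_path => /andP[xp1 xp2].
have vx1 := valid_last xp1 vx; set x1 := last x p1 in xp2 vx1.
have x1g : sized x1 = (3, act (g * Defs.eval [:: a])%g fam0).
  have [_ h2 _ _] := segP a; rewrite /x1 -last_map p1E xg.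
  by rewrite -[(3, act g fam0)]/(gact g base) last_map h2 /gact /= actM.
have := IHw _ x1 p2 vx1 xp2 x1g p2E; rewrite -mulgA -eval_cat => H.
have -> : last x p = last x1 p2 by rewrite pE12 last_cat.
rewrite {1}pE12 edges_cat -/x1 -[(size w).+1]addn1.
apply: weq_trans (weq_catl [:: a] H) _; rewrite !catA; apply: weq_catr.
have [E1 s1] := corrP vx1 x1g; have [E2 s2] := corrP vx xg.
have [E3 s3] := edgesP transitionW vx xp1.
apply: weq_rel; first by rewrite !eval_cat E1 E2 E3 invgM !mulgA mulgV mul1g mulgK.
rewrite !size_cat /=; apply: leq_trans km; apply: leq_add; first by rewrite leq_add2l.
apply: leq_add => //; apply: leq_trans s3 _; rewrite leq_mul2l; apply/orP; right.
have [_ _ _ sl] := segP a; apply: leq_trans sl.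
by rewrite -(size_map sized) p1E size_map.
Qed.

Lemma fillF_mono N0 n k k' : (k <= k')%N -> (fillF N0 n k <= fillF N0 n k')%N.
Proof. by move=> kk'; rewrite /fillF /passF leq_mul2l !leq_add2r leq_mul2r kk' !orbT. Qed.

Lemma relation_area m n (w : word S) : (1 + k1 + (k1 + k1 * l) <= m)%N -> (k1 * 12 <= m)%N ->
  Defs.relation w -> (size w <= n)%N -> weq m (n + fillF 18 (3 + l * n) (l * n)) w [::].
Proof.
move=> km1 km2 rw wn; have v0 : valid (lstate (srt 0)) by apply: valid_lstate; exact: cylpart_srt.
have b0 : sized (lstate (srt 0)) = base by rewrite /base -Std0 /sized size_lstate size_srt.
have [] := wpathP 1%g w; rewrite rw mulg1 act1 => h1 h2 h3 h4.
(* The base forest has three leaves, and the lift adds at most one for each of the at most [l * n]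
   moves. *)
have [|r [p [[R1 R2 R3] rp pE]]] := @lift_path (wpath 1%g w) _ v0; first by rewrite b0.
have [vx fx _ sx] := R3 _ v0 (perm_refl _); set x := r _ in rp vx fx sx.
have xb : sized x = base by rewrite -b0 /sized R2 fx.
have ln : (l * size w <= l * n)%N by rewrite leq_mul2l wn orbT.
have sp : (size p <= l * n)%N.
  by rewrite -(size_map sized) pE (leq_trans h4).
have xp7 : path (madj 7) x p.
  have x37 : (3 <= size x <= 7)%N by case: xb => ->.
  move: h3; rewrite -pE; elim: (p) (x) x37 rp => //= y q IHq z z37 /andP[/asboolP zy yq] /andP[y37 sq].
  have y37' : (3 <= size y <= 7)%N := y37.
  by rewrite IHq// andbT sadjE z37 y37'; apply/asboolP.
have xp18 : path (madj 18) x p by apply: sub_path xp7; exact: madj_sub.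
have vl := valid_last xp7 vx.
(* The moves preserve the leaves, and the family has returned to [fam0] because [w] is a relation,
   so [Sfam_inj] closes the lift. *)
have lE : last x p = x.
  have lb : sized (last x p) = base by rewrite -last_map pE xb.
  have step_path y q : path stepb y q -> perm_eq (lv y) (lv (last y q)).
    elim: q y => //= y' q IHq y /andP[/asboolP yy' yq].
    by rewrite (permPl (step_lv yy')); exact: IHq.
  apply: Sfam_inj => //; first by rewrite perm_sym; exact: step_path.
  by move: lb; rewrite -xb => -[].
have H : htp (madj 18) 12 (fillF 18 (3 + l * n) (size p)) x p [::].
  apply: (loop_fill _ _ (M := 7)) => //; try by case: vx.
  - by apply/andP; split=> //; case: xb => ->.
  - by case: vx => _ [].
  - apply: leq_trans sx _; apply: leq_add; last exact: leq_trans h4 ln.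
    by rewrite (perm_size (lv_lstate _)) size_srt.
have xg : sized x = (3, act (1%g : N) fam0) by rewrite act1.
have := compare km1 vx xp18 xg pE; rewrite lE rw mulg1 => C.
(* The loop closes, so the same correction word stands at both ends of the comparison. Once the edge
   word is filled, the two corrections cancel. *)
have E := weq_catl (corr 1%g x) (edges_htp transitionW km2 vx H).
have := weq_catr (word_inv (corr 1%g x)) (weq_trans C E); rewrite /= cats0 -catA => D.
have wE := free_sym (feq_catl w (feq_mulV (corr 1%g x))); rewrite cats0 in wE.
have := weq_trans (weq_feq m wE) (weq_trans D (weq_feq m (feq_mulV _))).
rewrite addn0 add0n; apply: weq_le; apply: leq_add => //; exact: fillF_mono.
Qed.

End Loops.

End Transfer.

End Geometry.

(** * Polynomial bounds *)

Section Growth.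
Implicit Types (f : nat -> nat) (d n : nat).

Definition poly_bound d f := exists C, forall n, (f n <= C * n.+1 ^ d)%N.

Lemma poly_bound_le d d' f : (d <= d')%N -> poly_bound d f -> poly_bound d' f.
Proof.
move=> dd' [C CP]; exists C => n; apply: leq_trans (CP n) _.
by rewrite leq_mul2l leq_pexp2l ?orbT.
Qed.

Lemma poly_bound_cst d c : poly_bound d (fun=> c).
Proof. by exists c => n; rewrite leq_pmulr// expn_gt0. Qed.

Lemma poly_bound_id : poly_bound 1 id.
Proof. by exists 1%N => n; rewrite mul1n expn1. Qed.

Lemma poly_boundD d f f' : poly_bound d f -> poly_bound d f' ->
  poly_bound d (fun n => f n + f' n)%N.
Proof.
by move=> [C CP] [C' CP']; exists (C + C')%N => n; rewrite mulnDl leq_add.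
Qed.

Lemma poly_boundM d d' f f' : poly_bound d f -> poly_bound d' f' ->
  poly_bound (d + d') (fun n => f n * f' n)%N.
Proof.
move=> [C CP] [C' CP']; exists (C * C')%N => n.
by rewrite expnD mulnACA leq_mul.
Qed.

Lemma poly_bound_fill l : poly_bound 5 (fun n => n + fillF 18 (3 + l * n) (l * n))%N.
Proof.
have b1 := poly_bound_id; have bl : poly_bound 1 (fun n => l * n)%N.
  exact: (poly_boundM (poly_bound_cst 0 l) b1).
have b3 : poly_bound 1 (fun n => 3 + l * n)%N by apply: poly_boundD => //; exact: poly_bound_cst.
have b4 : poly_bound 1 (fun n => (3 + l * n).+1).
  exact: (poly_boundD (poly_bound_cst 1 1) b3).
have b2 : poly_bound 1 (fun n => 2 * (3 + l * n).+1)%N := poly_boundM (poly_bound_cst 0 2) b4.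
have bs : poly_bound 3 (fun n => swapF 18 (3 + l * n)).
  rewrite /swapF; apply: (poly_boundM (poly_bound_cst 0 _)).
  exact: (poly_boundM b2 (poly_boundM b2 b2)).
have b34 c : poly_bound 3 (fun n => c * (3 + l * n))%N.
  exact: poly_bound_le (poly_boundM (poly_bound_cst 0 c) b3).
have bq : poly_bound 3 (fun n => squareF 18 (3 + l * n)).
  apply: poly_boundD; last exact: poly_bound_cst.
  by apply: poly_boundD => //; exact: (poly_boundM (poly_bound_cst 0 4) bs).
have bp : poly_bound 4 (fun n => passF 18 (3 + l * n) (l * n)).
  apply: poly_boundD; last exact: poly_bound_cst.
  apply: poly_boundD; last exact: poly_bound_le (b34 8).
  apply: poly_boundD; last exact: poly_bound_le bs.
  apply: (poly_boundM bl); apply: poly_boundD => //; exact: poly_bound_cst.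
apply: poly_boundD; first exact: poly_bound_le b1.
exact: (poly_boundM b4 bp).
Qed.

Lemma poly_bound_asymp d f f' : poly_bound d f -> (forall n, (f' n <= f n)%N) ->
  asymp_le f' (fun n => n ^ d)%N.
Proof.
(* The summand 2 absorbs the shift from [n] to [n.+1] for positive [n]; at 0 the additive constant
   suffices. *)
move=> [C CP] f'f; exists (C + 2)%N => -[|n].
  rewrite muln0; apply: leq_trans (f'f 0) (leq_trans (CP 0) _).
  by rewrite exp1n muln1; apply: leq_trans (leq_addl _ _); exact: leq_addr.
apply: leq_trans (f'f _) (leq_trans (CP _) _); rewrite -addnA; apply: leq_trans (leq_addr _ _).
apply: leq_mul; first exact: leq_addr.
case: d {CP} => [|d]; first by rewrite !expn0.
rewrite leq_exp2r//; apply: (@leq_trans (2 * n.+1)); first by lia.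
by rewrite leq_mul2r leq_addl orbT.
Qed.

End Growth.

Lemma area_ex (G : groupType) (S : set G) m (w : word S) k : conj_product m k w ->
  exists2 j, (j <= k)%N & is_area m w j.
Proof.
move=> wk; have ex : exists j, `[< conj_product m j w >] by exists k; apply/asboolP.
case: (ex_minnP ex) => j /asboolP wj jmin; exists j.
  by apply: jmin; apply/asboolP.
by split=> // i wi; apply: jmin; apply/asboolP.
Qed.

Lemma dehn_function_ex (G : groupType) (S : set G) m (f : nat -> nat) :
  (forall n (w : word S), Defs.relation w -> (size w <= n)%N -> weq m (f n) w [::]) ->
  exists2 delta, dehn_function S m delta & forall n, (delta n <= f n)%N.
Proof.
move=> H; pose A n := [set k | exists w : word S, [/\ Defs.relation w, (size w <= n)%N & is_area m w k]].
have Af n k : `[< A n k >] -> (k <= f n)%N.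
  move=> /asboolP[w [rw wn [_ wk]]]; apply: wk; exact/weq_conj_product/H.
have ex n : exists k, `[< A n k >].
  have r0 : Defs.relation ([::] : word S) by exact: eval_nil.
  have [k _ ak] := area_ex (weq_conj_product (H n _ r0 (leq0n n))).
  by exists k; apply/asboolP; exists [::].
exists (fun n => ex_maxn (ex n) (@Af n)) => n; case: ex_maxnP => k Ak kmax.
  split; first by move=> j Aj; apply: kmax; apply/asboolP.
  by move=> j; apply; exact/asboolP.
exact: Af.
Qed.

Theorem corollary1p3 :
  (exists S : set (neretin 2), compact S /\ generating S) /\
  forall S : set (neretin 2), compact S -> generating S ->
    exists m0 : nat, forall m : nat, (m0 <= m)%N ->
      presented S m /\
      exists delta : nat -> nat,
        dehn_function S m delta /\ asymp_le delta (fun n => (n ^ 11)%N).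
Proof.
split; first by exists transition; split; [exact: compact_transition|exact: generating_transition].
move=> S cS gS; have [l lP] := letter_path cS; have /choice[seg segP] := lP.
have [k1 k1P] := W_finite_orbit cS gS finite_transition.
(* The first bound is the boundary length of a square in [compare], the second that of a tile with
   12 sides. *)
exists (maxn (1 + k1 + (k1 + k1 * l)) (k1 * 12))%N => m; rewrite geq_max => /andP[m1 m2].
have area n (w : word S) := @relation_area S l seg segP k1 k1P m n w m1 m2.
split.
  split=> // w rw; exists (size w + fillF 18 (3 + l * size w) (l * size w))%N.
  exact/weq_conj_product/area.
have [delta d1 d2] := dehn_function_ex area; exists delta; split=> //.
(* The area bound has degree 5, which is below the exponent 11. *)
apply: poly_bound_asymp d2; exact: poly_bound_le (poly_bound_fill l).
Qed.
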